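(* Let $d\ge1$. There exists a constant $C_d>1$ depending only on the dimension $d$ such that for every $\nu>0$ and every $\epsilon>0$ there exists $h_0\in C^\infty(\mathbb T^d)$ for which the following hold: (1) $\int_{\mathbb T^d}h_0(x)\,dx=0$ and $\|\nabla h_0\|_\infty<1$. (2) There exists $t_0>0$ such that the solution $h$ with initial data $h_0$ to $$\partial_t h=\nabla\cdot\bigl((|\nabla h|^2-1)\nabla h\bigr)-\nu\Delta^2h$$ on $\mathbb T^d$ satisfies $$\|\nabla h(t_0,\cdot)\|_\infty>C_d-\epsilon .$$
   Context: $\mathbb T^d=\mathbb R^d/2\pi\mathbb Z^d$; functions are real-valued; $\|\nabla h\|_\infty$ is the $L^\infty(\mathbb T^d)$ norm of the Euclidean length $|\nabla h|$. The solution with initial data $h_0$ is the unique mild solution $h(t)=e^{-\nu t\Delta^2}h_0+\int_0^t\nabla\cdot e^{-\nu(t-s)\Delta^2}((|\nabla h|^2-1)\nabla h)(s)\,ds$, where $e^{-\nu t\Delta^2}$ is the Fourier multiplier $e^{-\nu t|k|^4}$, with $h\in C_t^0H_x^{d/2}$, $t^{1/4}\nabla h\in C_t^0C_x^0$, $t^{1/4}h\in C_t^0H_x^{d/2+1}$ on each $[0,T]$ with $T$ less than its maximal lifespan $T_*\in(0,\infty]$; it is smooth for smooth data. The assertion about $h(t_0,\cdot)$ includes that $t_0<T_*$. *)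

(* Defs.v *)
From HB Require Import structures.
From mathcomp Require Import all_boot all_order all_algebra.
From mathcomp Require Import all_classical all_reals all_analysis.
From mathcomp Require Import complex.

Set Implicit Arguments.
Unset Strict Implicit.
Unset Printing Implicit Defensive.

Import Order.TTheory GRing.Theory Num.Theory.
Import numFieldNormedType.Exports.

Local Open Scope classical_set_scope.
Local Open Scope ring_scope.

(* Functions on the torus R^d / 2 pi Z^d are represented by 2 pi-periodic
   functions on 'rV[R]_d; the norm that MathComp-Analysis puts on 'rV[R]_d is the
   sup norm, so the Euclidean length is defined separately. *)

Section tuple_cons.
Context d0 (T : measurableType d0) (d : nat).

Definition tuple_cons (x : T * d.-tuple T) : d.+1.-tuple T :=
  [tuple of x.1 :: x.2].

Lemma measurable_tuple_cons : measurable_fun [set: T * d.-tuple T] tuple_cons.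
Proof. exact: measurable_cons. Qed.

End tuple_cons.

Section torus_measure.
Variable R : realType.
Local Notation T := (measurableTypeR R).

Definition circle_measure : set T -> \bar R :=
  mrestr lebesgue_measure (measurable_itv `[0 : R, 2 * pi]).

HB.instance Definition _ := Measure.on circle_measure.

Lemma circle_measure_setT_fin : circle_measure setT \is a fin_num.
Proof.
rewrite /circle_measure /mrestr setTI lebesgue_measure_itv /=.
by case: ifP.
Qed.

Section step.
Variables (d : nat) (m : {finite_measure set (d.-tuple T) -> \bar R}).

Definition torus_step : set (d.+1.-tuple T) -> \bar R :=
  pushforward (circle_measure \x m)%E (@tuple_cons _ T d).

Let torus_step0 : torus_step set0 = 0%E.
Proof. by rewrite /torus_step /pushforward preimage_set0 measure0. Qed.

Let torus_step_ge0 A : (0 <= torus_step A)%E.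
Proof. exact: (measure_ge0 (circle_measure \x m)%E). Qed.

Let torus_step_sigma_additive : semi_sigma_additive torus_step.
Proof.
have mcons B : measurable B -> measurable (@tuple_cons _ T d @^-1` B).
  by move=> mB; rewrite -[X in measurable X]setTI; exact: measurable_tuple_cons.
move=> F mF tF mUF; rewrite /torus_step /pushforward preimage_bigcup.
have := @measure_semi_sigma_additive _ _ _ (circle_measure \x m)%E
  (fun i => @tuple_cons _ T d @^-1` F i).
apply.
- by move=> n; exact: mcons.
- apply/trivIsetP => /= i j _ _ ij; rewrite -preimage_setI.
  by move/trivIsetP : tF => /(_ _ _ _ _ ij) ->//; rewrite preimage_set0.
- by rewrite -preimage_bigcup; exact: mcons.
Qed.

HB.instance Definition _ := isMeasure.Build _ _ _ torus_step
  torus_step0 torus_step_ge0 torus_step_sigma_additive.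

Lemma torus_step_fin : fin_num_fun torus_step.
Proof.
apply: lty_fin_num_fun.
have fin : ((circle_measure \x m) (setT `*` setT) < +oo)%E.
  rewrite product_measure1E // -ge0_fin_numE ?mule_ge0 //.
  by rewrite fin_numM ?circle_measure_setT_fin ?fin_num_measure.
by rewrite setXTT in fin.
Qed.

HB.instance Definition _ :=
  Measure_isFinite.Build _ _ _ torus_step torus_step_fin.

End step.

(* The Lebesgue measure on the fundamental domain [0, 2 pi]^d, that is, the d-fold
   product of circle_measure; the library has no n-ary product measure. *)
Fixpoint torus_measure (d : nat) : {finite_measure set (d.-tuple T) -> \bar R} :=
  match d with
  | 0%N => dirac [tuple]
  | d'.+1 => torus_step (torus_measure d')
  end.

End torus_measure.

Section torus_analysis.
Variables (R : realType) (d : nat).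
Local Notation vec := 'rV[R]_d.
Local Notation freq := 'rV[int]_d.

Definition row_of_tuple (x : d.-tuple R) : vec := \row_i tnth x i.

Definition torus_periodic (f : vec -> R) : Prop :=
  forall (x : vec) (k : freq), f (x + (2 * pi) *: map_mx intr k) = f x.

Definition euclid_norm (v : vec) : R := Num.sqrt (\sum_i v 0 i ^+ 2).

Definition partial (i : 'I_d) (f : vec -> R) (x : vec) : R :=
  'D_'e_i f x.

Definition grad (f : vec -> R) (x : vec) : vec := \row_i partial i f x.

Definition div (V : vec -> vec) (x : vec) : R :=
  \sum_i partial i (fun y => V y 0 i) x.

Definition iter_partial (s : seq 'I_d) (f : vec -> R) : vec -> R :=
  foldr partial f s.

Definition smooth_torus (f : vec -> R) : Prop :=
  torus_periodic f /\
  forall s : seq 'I_d, continuous (iter_partial s f) /\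
    forall x i, derivable (iter_partial s f) x 'e_i.

Definition torus_int (f : vec -> R) : R :=
  \int[torus_measure R d]_x f (row_of_tuple x).

Definition Linfty_norm (V : vec -> vec) : \bar R :=
  Lnorm (torus_measure R d) +oo%E
    (fun x => (euclid_norm (V (row_of_tuple x)))%:E).

Definition sup_norm (V : vec -> vec) : \bar R :=
  ereal_sup (range (fun x => (euclid_norm (V x))%:E)).

Definition freq_dot (k : freq) (x : vec) : R := \sum_i (k 0 i)%:~R * x 0 i.

Definition freq_sq (k : freq) : R := \sum_i (k 0 i)%:~R ^+ 2.

(* (2 pi)^-d * \int f(x) exp (- i k.x) dx, through its real and imaginary parts *)
Definition fourier_coef (f : vec -> R) (k : freq) : complex R :=
  Complex ((2 * pi) ^- d * torus_int (fun x => f x * cos (freq_dot k x)))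
          (- ((2 * pi) ^- d * torus_int (fun x => f x * sin (freq_dot k x)))).

Definition expi (theta : R) : complex R := Complex (cos theta) (sin theta).

Definition freq_box (N : nat) : set freq :=
  [set k | forall i, `|k 0 i| <= N%:Z].

(* The Fourier multiplier with symbol m, as the sum of its Fourier series over
   growing boxes. The real part loses nothing here: f is real-valued and m is real
   and (in all uses) even, so that the partial sums are real. *)
Definition fourier_multiplier (m : freq -> R) (f : vec -> R) (x : vec) : R :=
  lim ((complex.Re (\sum_(k \in freq_box N)
          Complex (m k) 0 * fourier_coef f k * expi (freq_dot k x)))
       @[N --> \oo]).

(* exp (- nu t Delta^2) *)
Definition bilaplacian_semigroup (nu t : R) : (vec -> R) -> vec -> R :=
  fourier_multiplier (fun k => expR (- (nu * t * freq_sq k ^+ 2))).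

(* the inhomogeneous Sobolev norm of H^s, +oo outside H^s *)
Definition sobolev_norm (s : R) (f : vec -> R) : \bar R :=
  ((\esum_(k in [set: freq])
      ((1 + freq_sq k) `^ s * Normc.normc (fourier_coef f k) ^+ 2)%:E) `^ 2^-1)%E.

(* N need only be a norm on E: it may be infinite outside E. *)
Definition continuous_in_time (X : zmodType) (E : set X) (N : X -> \bar R)
    (T : R) (u : R -> X) : Prop :=
  forall t, t \in `[0, T] ->
    E (u t) /\ N (u s - u t) @[s --> within [set` `[0, T]] (nbhs t)] --> 0%E.

Definition C0tHsx (s T : R) (u : R -> vec -> R) : Prop :=
  continuous_in_time (X := vec -> R) [set f | (sobolev_norm s f < +oo)%E]
    (sobolev_norm s) T u.

Definition C0tC0x (T : R) (u : R -> vec -> vec) : Prop :=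
  continuous_in_time (X := vec -> vec) [set V | continuous V] sup_norm T u.

Definition flux (f : vec -> R) (x : vec) : vec :=
  (euclid_norm (grad f x) ^+ 2 - 1) *: grad f x.

Definition div_semigroup (nu t : R) (V : vec -> vec) : vec -> R :=
  div (fun y => \row_i bilaplacian_semigroup nu t (fun z => V z 0 i) y).

(* Mild solutions on [0, T]. At time 0 the factor t^(1/4) is 0, whence the
   gradient is only required to exist for t > 0. The Duhamel integral is taken for
   every x: the class of h bounds its integrand by
   C (t - s)^(-1/4) (s^(-1/4) + s^(-3/4)). *)
Definition mild_solution_on (nu : R) (h0 : vec -> R) (T : R)
    (h : R -> vec -> R) : Prop :=
  [/\ forall t, t \in `[0, T] -> torus_periodic (h t),
      forall t x i, t \in `]0, T] -> derivable (h t) x 'e_i,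
      [/\ C0tHsx (d%:R / 2) T h,
          C0tC0x T (fun t x => t `^ (4^-1) *: grad (h t) x) &
          C0tHsx (d%:R / 2 + 1) T (fun t x => t `^ (4^-1) * h t x)] &
      forall t x, t \in `[0, T] ->
        h t x = bilaplacian_semigroup nu t h0 x +
          \int[lebesgue_measure]_(s in `[0, t])
            div_semigroup nu (t - s) (flux (h s)) x].

Definition mild_solution (nu : R) (h0 : vec -> R) (Tend : \bar R)
    (h : R -> vec -> R) : Prop :=
  forall T : R, 0 < T -> (T%:E < Tend)%E -> mild_solution_on nu h0 T h.

(* h is the unique mild solution with initial data h0, and Tstar its maximal
   lifespan; the values of h outside [0, Tstar) are irrelevant. *)
Definition maximal_mild_solution (nu : R) (h0 : vec -> R) (Tstar : \bar R)
    (h : R -> vec -> R) : Prop :=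
  [/\ (0 < Tstar)%E,
      mild_solution nu h0 Tstar h &
      forall (Tend : \bar R) (g : R -> vec -> R),
        (0 < Tend)%E -> mild_solution nu h0 Tend g ->
        (Tend <= Tstar)%E /\
        forall (t : R) x, 0 <= t -> (t%:E < Tend)%E -> g t x = h t x].

End torus_analysis.

(* Main.v *)
Require Import Defs.
From HB Require Import structures.
From mathcomp Require Import all_boot all_order all_algebra.
From mathcomp Require Import all_classical all_reals all_analysis.
From mathcomp Require Import measurable_realfun ess_sup_inf.
From mathcomp Require Import complex ring lra zify.

(** The gradient can overshoot because the semigroup of the bilaplacian has no maximum
    principle.
    Take data that depend on one coordinate only, with slope close to
      (9/8) cos (lam x) - (1/8) cos (3 lam x) = (3 cos (lam x) - cos^3 (lam x)) / 2,
    slightly scaled down. The third harmonic keeps the slope below 1 at the maximum of the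
    fundamental, where it is subtracted. Under exp(-nu t Delta^2) it decays 81 times as fast
    as the fundamental: at time 1 / (27 nu lam^4) it has lost more than three quarters of its
    size while the fundamental has lost less than 1/27, and the slope at the maximum exceeds
    1.03 ([overshoot]). The frequency lam is free. Over this time the nonlinear term perturbs the
    linear evolution by a multiple of 1 / (nu lam^2), so that for large lam the slope of the
    solution still exceeds 101/100, on a slab of positive measure ([Linfty_norm_ge]).

    Two facts about the equation carry this out.

    Existence. Finite sums of cosines with time dependent amplitudes are closed under products and
    under Duhamel's integral, and a norm with weights e^|m| on the m-th harmonic is
    submultiplicative ([mnorm_mul]). Duhamel's integral gains the factor 1 / (nu lam^2)
    ([mnorm_duh]), so that the Picard iteration contracts when lam is large
    ([iterate_increment_norm]), for all times at once. Its limit is global; it satisfies the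
    Duhamel formula ([duhamel_sol]) and has the regularity in time of the solution class
    ([C0tHsx_sol], [C0tC0x_grad_sol]), because the weights dominate all powers of the frequency.

    Uniqueness. As the solution is global, its maximality means that every mild solution g with
    the same data agrees with it as long as g lives ([mild_unique]). The class only gives
    |grad g| = o(t^(-1/4)), which is critical: the square of the Lipschitz constant of the flux
    is o(1/s). The mean square difference of the two gradients is estimated one Fourier mode at a
    time, by the Cauchy-Schwarz inequality in time; the kernel that appears has a singular mass
    independent of the frequency ([singular_kernel_le]), and the modes are summed by Bessel's
    inequality and Parseval's identity ([grad_gap_le]). The smallness near time 0 then makes the
    estimate a contraction.

    The Fourier analysis needed for this rests on the uniform density of trigonometric
    polynomials in the continuous periodic functions ([fejer_density]). *)

Set Implicit Arguments.
Unset Strict Implicit.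
Unset Printing Implicit Defensive.

Import Order.TTheory GRing.Theory Num.Theory.
Import numFieldNormedType.Exports.

Local Open Scope classical_set_scope.
Local Open Scope ring_scope.

(** * Trigonometric polynomials *)
Section trig_poly.
Variables (R : realType) (d : nat).
Local Notation vec := 'rV[R]_d.
Local Notation freq := 'rV[int]_d.
Implicit Types (k l : freq) (x y : vec) (f g : vec -> R).

Lemma freq_dotDl k l x : freq_dot (k + l) x = freq_dot k x + freq_dot l x.
Proof.
by rewrite /freq_dot -big_split /=; apply: eq_bigr => i _; rewrite mxE rmorphD/= mulrDl.
Qed.

Lemma freq_dotNl k x : freq_dot (- k) x = - freq_dot k x.
Proof.
by rewrite /freq_dot -sumrN; apply: eq_bigr => i _; rewrite mxE rmorphN/= mulNr.
Qed.

Lemma freq_dotBl k l x : freq_dot (k - l) x = freq_dot k x - freq_dot l x.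
Proof. by rewrite freq_dotDl freq_dotNl. Qed.

Lemma freq_dot0l x : freq_dot (0 : freq) x = 0.
Proof. by rewrite /freq_dot big1 // => i _; rewrite mxE mul0r. Qed.

Lemma freq_dotDr k x y : freq_dot k (x + y) = freq_dot k x + freq_dot k y.
Proof. by rewrite /freq_dot -big_split /=; apply: eq_bigr => i _; rewrite mxE mulrDr. Qed.

Lemma freq_dotZr k a x : freq_dot k (a *: x) = a * freq_dot k x.
Proof. by rewrite /freq_dot mulr_sumr; apply: eq_bigr => i _; rewrite mxE mulrCA. Qed.

Lemma freq_dot_delta k i : freq_dot k ('e_i : vec) = (k 0 i)%:~R.
Proof.
rewrite /freq_dot (bigD1 i)//= mxE !eqxx mulr1 big1 ?addr0 // => j ji.
by rewrite mxE eqxx (negPf ji) mulr0.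
Qed.

Lemma freq_dot_axis (m : int) i x : freq_dot (m *: ('e_i : freq)) x = m%:~R * x 0 i.
Proof.
rewrite /freq_dot (bigD1 i)//= !mxE !eqxx mulr1 big1 ?addr0 // => j ji.
by rewrite !mxE eqxx (negPf ji) mulr0 mul0r.
Qed.

(** A list of triples (a, b, k) stands for the sum of a cos(k.x) + b sin(k.x); finite
    lists, rather than finitely supported coefficient functions, make products a plain
    concatenation. *)
Definition tp (p : seq (R * R * freq)) (x : vec) : R :=
  \sum_(a <- p) (a.1.1 * cos (freq_dot a.2 x) + a.1.2 * sin (freq_dot a.2 x)).

Definition is_tp f := exists p, f = tp p.

Lemma is_tp_cos k : is_tp (fun x => cos (freq_dot k x)).
Proof. by exists [:: (1, 0, k)]; apply/funext => x; rewrite /tp big_seq1 /= mul1r mul0r addr0. Qed.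

Lemma is_tp_sin k : is_tp (fun x => sin (freq_dot k x)).
Proof. by exists [:: (0, 1, k)]; apply/funext => x; rewrite /tp big_seq1 /= mul1r mul0r add0r. Qed.

Lemma is_tp_cst c : is_tp (fun=> c).
Proof.
exists [:: (c, 0, 0)]; apply/funext => x.
by rewrite /tp big_seq1 /= freq_dot0l cos0 mulr1 mul0r addr0.
Qed.

Lemma is_tpD f g : is_tp f -> is_tp g -> is_tp (fun x => f x + g x).
Proof. by move=> [p ->] [q ->]; exists (p ++ q); apply/funext => x; rewrite /tp big_cat. Qed.

Lemma is_tp_sum (I : Type) (s : seq I) (F : I -> vec -> R) :
  (forall i, is_tp (F i)) -> is_tp (fun x => \sum_(i <- s) F i x).
Proof.
move=> H; elim: s => [|i s IH].
  by under eq_fun do rewrite big_nil; exact: is_tp_cst.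
by under eq_fun do rewrite big_cons; exact: is_tpD.
Qed.

Lemma is_tpZ c f : is_tp f -> is_tp (fun x => c * f x).
Proof.
move=> [p ->]; exists [seq (c * a.1.1, c * a.1.2, a.2) | a <- p].
apply/funext => x; rewrite /tp big_map mulr_sumr; apply: eq_bigr => a _ /=.
by rewrite mulrDr !mulrA.
Qed.

Lemma is_tpM f g : is_tp f -> is_tp g -> is_tp (fun x => f x * g x).
Proof.
move=> [p ->] [q ->]; rewrite /tp.
under eq_fun do rewrite mulr_suml.
apply: is_tp_sum => -[[a b] k] /=.
under eq_fun do rewrite mulr_sumr.
apply: is_tp_sum => -[[c e] l] /=.
have -> : (fun x => (a * cos (freq_dot k x) + b * sin (freq_dot k x)) *
    (c * cos (freq_dot l x) + e * sin (freq_dot l x))) = (fun x =>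
  (((a * c - b * e) / 2 * cos (freq_dot (k + l) x) +
   (a * c + b * e) / 2 * cos (freq_dot (k - l) x)) +
   ((a * e + b * c) / 2 * sin (freq_dot (k + l) x) +
   (b * c - a * e) / 2 * sin (freq_dot (k - l) x)))).
  by apply/funext => x; rewrite !freq_dotDl !freq_dotNl !(cosD,sinD,cosN,sinN); field.
by do 2 apply: is_tpD; apply: is_tpZ; (exact: is_tp_cos || exact: is_tp_sin).
Qed.

Lemma is_tp_prod (I : Type) (s : seq I) (F : I -> vec -> R) :
  (forall i, is_tp (F i)) -> is_tp (fun x => \prod_(i <- s) F i x).
Proof.
move=> H; elim: s => [|i s IH].
  by under eq_fun do rewrite big_nil; exact: is_tp_cst.
by under eq_fun do rewrite big_cons; exact: is_tpM.
Qed.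

End trig_poly.

(** * Fejer approximation *)
Section fejer.
Variable R : realType.

(** C and S are the real and imaginary parts of a geometric sum of characters; multiplying the
    sum by its ratio shifts it by one term. *)
Lemma geometric_cos_sin (N : nat) (y : R) :
  let C := \sum_(a < N) cos (a%:R * y) in let S := \sum_(a < N) sin (a%:R * y) in
  (1 - cos y) * (C ^+ 2 + S ^+ 2) = 1 - cos (N%:R * y).
Proof.
move=> C S.
have H1 : C - (cos y * C - sin y * S) = 1 - cos (N%:R * y).
  rewrite /C /S; elim: N {C S} => [|N IH]; first by rewrite !big_ord0 mul0r cos0; ring.
  rewrite !big_ord_recr/= -natr1 mulrDl mul1r cosD; lra.
have H2 : S - (sin y * C + cos y * S) = - sin (N%:R * y).
  rewrite /C /S; elim: N {C S H1} => [|N IH]; first by rewrite !big_ord0 mul0r sin0; ring.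
  rewrite !big_ord_recr/= -natr1 mulrDl mul1r sinD; lra.
have c1 := cos2Dsin2 y; have c2 := cos2Dsin2 (N%:R * y).
have : (C - (cos y * C - sin y * S)) ^+ 2 + (S - (sin y * C + cos y * S)) ^+ 2 =
  2 * (1 - cos (N%:R * y)).
  by rewrite H1 H2; lra.
have -> : (C - (cos y * C - sin y * S)) ^+ 2 + (S - (sin y * C + cos y * S)) ^+ 2 =
  2 * ((1 - cos y) * (C ^+ 2 + S ^+ 2)).
  have := congr1 (fun z => z * (C ^+ 2 + S ^+ 2)) c1; rewrite /=; lra.
by move/(mulfI (lt0r_neq0 (@ltr0Sn R 1))).
Qed.

Lemma cos_lt1 (y : R) : 0 < y < 2 * pi -> cos y < 1.
Proof.
move=> /andP[y0 y2].
have -> : y = (y / 2) *+ 2 by rewrite -mulr_natr; field.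
rewrite cos_mulr2n cos2sin2.
have : 0 < sin (y / 2) by apply: sin_gt0_pi; apply/andP; split; lra.
set s := sin _ => s0; have : 0 < s ^+ 2 by rewrite exprn_gt0.
by rewrite -mulr_natr; lra.
Qed.

Lemma cos_nat2pi n : cos (n%:R * (2 * pi) : R) = 1.
Proof.
elim: n => [|n IH]; first by rewrite mul0r cos0.
by rewrite -natr1 mulrDl mul1r [X in _ + X]mulr_natl cosD2pi.
Qed.

(** [geometric_cos_sin] at an angle of which N steps make m whole turns. *)
Lemma grid_character_sum (N m : nat) (z : R) : (0 < m < N)%N ->
  \sum_(j < N) cos (z - m%:R * (2 * pi * j%:R / N%:R)) = 0.
Proof.
move=> /andP[m0 mN].
have N0 : (0 : R) < N%:R by rewrite ltr0n (leq_trans _ mN).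
pose al := m%:R * (2 * pi) / N%:R : R.
have eq j : m%:R * (2 * pi * j%:R / N%:R) = j%:R * al by rewrite /al; field; lra.
have pi0 : 0 < pi :> R := pi_gt0 R.
have : cos al < 1.
  apply: cos_lt1; rewrite /al; apply/andP; split.
    by rewrite !(divr_gt0, mulr_gt0)// ltr0n.
  by rewrite ltr_pdivrMr// mulrC ltr_pM2l ?ltr_nat//; lra.
have := geometric_cos_sin N al => /=.
have -> : N%:R * al = m%:R * (2 * pi) by rewrite /al; field; lra.
rewrite cos_nat2pi subrr => /eqP; rewrite mulf_eq0 subr_eq0.
set C := \sum_(_ < _) _; set S := \sum_(_ < _) _.
case/orP => [/eqP <-|]; first by rewrite ltxx.
rewrite paddr_eq0 ?sqr_ge0// !sqrf_eq0 => /andP[/eqP C0 /eqP S0] _.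
under eq_bigr do rewrite eq cosB.
by rewrite big_split/= -!mulr_sumr -/C -/S C0 S0 !mulr0 addr0.
Qed.

(** The Fejer kernel as a squared modulus, which makes its positivity evident. *)
Definition fejer (N : nat) (y : R) : R :=
  N%:R^-1 * ((\sum_(a < N) cos (a%:R * y)) ^+ 2 + (\sum_(a < N) sin (a%:R * y)) ^+ 2).

Lemma fejer_ge0 N y : 0 <= fejer N y.
Proof. by rewrite mulr_ge0// addr_ge0 ?sqr_ge0. Qed.

(** The second moment of the kernel: this is where concentration comes from. *)
Lemma fejer_moment N y : (1 - cos y) * fejer N y <= 2 / N%:R.
Proof.
rewrite /fejer mulrCA geometric_cos_sin mulrC ler_wpM2r//.
have := cos_geN1 (N%:R * y); lra.
Qed.

Definition grid (N j : nat) : R := 2 * pi * j%:R / N%:R.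

(** Expanding the squares, all terms but the N diagonal ones vanish on the grid by
    [grid_character_sum]. *)
Lemma fejer_sum N (x : R) : (0 < N)%N -> \sum_(j < N) fejer N (x - grid N j) = N%:R.
Proof.
move=> N0; have NR : N%:R != 0 :> R by rewrite pnatr_eq0 -lt0n.
rewrite /fejer -mulr_sumr; apply: (mulfI NR); rewrite mulrA mulfV// mul1r.
transitivity (\sum_(j < N) \sum_(a < N) \sum_(b < N)
    cos (a%:R * (x - grid N j) - b%:R * (x - grid N j))).
  apply: eq_bigr => j _; rewrite !expr2 !mulr_suml -big_split/=.
  apply: eq_bigr => a _; rewrite !mulr_sumr -big_split/=.
  by apply: eq_bigr => b _; rewrite cosB.
rewrite exchange_big/= -[in RHS](card_ord N) -sum1_card natr_sum mulr_suml.
apply: eq_bigr => a _; rewrite exchange_big/= (bigD1 a)//= mul1r.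
rewrite [X in _ + X]big1 ?addr0.
  by apply: eq_bigr => j _; rewrite subrr cos0.
have H (p q : nat) : (p < q < N)%N ->
    \sum_(j < N) cos (q%:R * (x - grid N j) - p%:R * (x - grid N j)) = 0.
  move=> /andP[pq qN].
  rewrite -[RHS](@grid_character_sum N (q - p) ((q - p)%N%:R * x)); last first.
    by rewrite subn_gt0 pq /= (leq_ltn_trans _ qN)// leq_subr.
  by apply: eq_bigr => j _; congr cos; rewrite natrB ?(ltnW pq)// /grid; ring.
move=> b ba; have [ab|ab] := ltnP a b.
  rewrite -[RHS](H a b) ?ab ?ltn_ord//.
  by apply: eq_bigr => j _; rewrite -cosN opprB.
by apply: H; rewrite ltn_ord andbT ltn_neqAle ab andbT.
Qed.

End fejer.

Section periodic.
Variables (R : realType) (d : nat).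
Local Notation vec := 'rV[R]_d.
Local Notation freq := 'rV[int]_d.
Implicit Types (k l : freq) (x y : vec) (f g : vec -> R) (e : R).

Definition cper f := continuous f /\ torus_periodic f.

Let pi0 : 0 < pi :> R := pi_gt0 R.

Lemma continuous_fin_dist f x e : continuous f -> 0 < e ->
  exists2 r, 0 < r & forall y, (forall i, `|x 0 i - y 0 i| < r) -> `|f x - f y| < e.
Proof.
move=> cf e0.
have /cvgrPdist_lt/(_ e e0)/nbhs_ballP[r /= r0 H] := cf x.
exists r => // y xy; apply: H; split=> // i j.
by rewrite (ord1 i); exact: xy.
Qed.

Lemma shift_to_cube x : exists k, forall i, 0 <= (x + (2 * pi) *: map_mx intr k) 0 i <= 2 * pi.
Proof.
exists (\row_i - Num.floor (x 0 i / (2 * pi))) => i; rewrite !mxE.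
have := floor_itv (x 0 i / (2 * pi)); set n := Num.floor _.
rewrite rmorphD rmorphN /= ler_pdivlMr ?mulr_gt0// ltr_pdivrMr ?mulr_gt0// => /andP[].
by move=> a b; apply/andP; split; lra.
Qed.

Lemma shift_near0 (z : R) : exists n : int, `|z + 2 * pi * n%:~R| <= pi.
Proof.
exists (- Num.floor (z / (2 * pi) + 2^-1)).
have := floor_itv (z / (2 * pi) + 2^-1); set n := Num.floor _.
have gen (p : R) : 0 < p -> z / (2 * p) + 2^-1 = (z + p) / (2 * p).
  by move=> p0; field; rewrite gt_eqF.
rewrite gen//.
rewrite rmorphD rmorphN /= ler_pdivlMr ?mulr_gt0// ltr_pdivrMr ?mulr_gt0// => /andP[].
by move=> a b; rewrite ler_norml; apply/andP; split; lra.
Qed.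

Lemma cos_int2pi (z : R) (n : int) : cos (z + 2 * pi * n%:~R) = cos z.
Proof.
have H (m : nat) (w : R) : cos (w + 2 * pi * m%:R) = cos w.
  elim: m => [|m IH]; first by rewrite mulr0 addr0.
  by rewrite -[m.+1%:R]natr1 mulrDr mulr1 addrA mulr_natl cosD2pi -mulr_natl IH.
case: n => m; first exact: H.
rewrite NegzE rmorphN /= mulrN -[in RHS](subrK (2 * pi * m.+1%:R) z).
by rewrite H.
Qed.

(** Compactness of one period cell suffices: a common shift brings x into it, and y need
    not follow. *)
Lemma cper_unif f : cper f -> forall e, 0 < e ->
  exists2 r, 0 < r & forall x y, (forall i, `|x 0 i - y 0 i| < r) -> `|f x - f y| < e.
Proof.
move=> [cf pf] e e0.
pose K := [set v : vec | forall i : 'I_d, [set` `[0, 2 * pi]] (v ord0 i)].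
have cK : compact K by apply: (@rV_compact R d (fun=> [set` `[0, 2 * pi]])) => i; exact: segment_compact.
have /compact_near_coveringP nK := cK.
have := nK R (0^'+) (fun r x => forall y, (forall i, `|x 0 i - y 0 i| < r) -> `|f x - f y| < e) _.
case=> [x Kx|r /= r0 H].
  have [r r0 H] := continuous_fin_dist x cf (divr_gt0 e0 (ltr0Sn R 1)).
  have r2 : 0 < r / 2 by rewrite divr_gt0.
  exists (ball x (r / 2), [set s | 0 < s < r / 2]) => /=.
    split; first exact: nbhsx_ballx.
    near=> s; apply/andP; split; near: s; first exact: nbhs_right_gt.
    by apply: nbhs_right_lt.
  move=> [x' s] /= [bx /andP[s0 sr]] y xy.
  have xx' i : `|x 0 i - x' 0 i| < r / 2 by case: bx => _; exact.
  have -> : f x' - f y = (f x - f y) - (f x - f x') by ring.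
  rewrite (le_lt_trans (ler_normB _ _))// (splitr e) ltrD//; apply: H => i.
    have -> : x 0 i - y 0 i = (x 0 i - x' 0 i) + (x' 0 i - y 0 i) by ring.
    rewrite (le_lt_trans (ler_normD _ _))// (splitr r) ltrD//.
    by rewrite (lt_trans (xy i)).
  by rewrite (lt_trans (xx' i))//; lra.
exists (r / 2); first by rewrite divr_gt0.
have rH := H (r / 2).
move=> x y xy; have [k Hk] := shift_to_cube x.
rewrite -(pf x k) -(pf y k); apply: rH.
- by rewrite /= sub0r normrN gtr0_norm ?divr_gt0//; lra.
- by rewrite divr_gt0.
- by move=> i /=; rewrite in_itv /=; exact: Hk.
- by move=> i; rewrite mxE [X in _ - X]mxE opprD addrACA subrr addr0.
Unshelve. all: by end_near.
Qed.

Lemma cper_bounded f : cper f -> exists2 M, 0 <= M & forall x, `|f x| <= M.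
Proof.
move=> [cf pf].
pose K := [set v : vec | forall i : 'I_d, [set` `[0, 2 * pi]] (v ord0 i)].
have cK : compact K by apply: (@rV_compact R d (fun=> [set` `[0, 2 * pi]])) => i; exact: segment_compact.
have : compact (f @` K) by apply: continuous_compact => //; exact: continuous_subspaceT.
move=> /compact_bounded[M [Mr HM]].
exists (`|M| + 1); first by rewrite addr_ge0.
move=> x; have [k Hk] := shift_to_cube x; rewrite -(pf x k).
apply: HM; first by rewrite (le_lt_trans (ler_norm _))// ltrDl.
by exists (x + (2 * pi) *: map_mx intr k) => // i /=; rewrite in_itv /= Hk.
Qed.

(** Distances on the torus are controlled by the sums of 1 - cos, the quantity whose
    average against the Fejer kernel is small. *)
Lemma cper_modulus f : cper f -> forall e, 0 < e -> exists2 K, 0 <= K &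
  forall x y, `|f x - f y| <= e + K * \sum_i (1 - cos (x 0 i - y 0 i)).
Proof.
move=> cpf e e0; have [r r0 H] := cper_unif cpf e0.
have [M M0 HM] := cper_bounded cpf.
pose s := Num.min r 1.
have s0 : 0 < s by rewrite lt_min r0 ltr01.
have pige1 : 1 <= pi :> R by have := pi_ge2 R; lra.
have c1 : cos s < 1.
  by apply: cos_lt1; rewrite s0 /= (@le_lt_trans _ _ 1)//; [rewrite /s ge_min lexx orbT | lra].
have K0 : 0 <= 2 * M / (1 - cos s) by rewrite divr_ge0//; lra.
exists (2 * M / (1 - cos s)) => // x y.
have nn i : 0 <= 1 - cos (x 0 i - y 0 i) by rewrite subr_ge0 cos_le1.
pose n i := projT1 (cid (shift_near0 (x 0 i - y 0 i))).
have Hn i : `|x 0 i - y 0 i + 2 * pi * (n i)%:~R| <= pi := projT2 (cid (shift_near0 _)).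
have [Hs|] := pselect (forall i, `|x 0 i - y 0 i + 2 * pi * (n i)%:~R| < s).
  rewrite -(cpf.2 x (\row_i n i)) ler_wpDr ?mulr_ge0 ?sumr_ge0//.
  apply/ltW/H => i; rewrite !mxE.
  have := Hs i; rewrite addrAC => /lt_le_trans; apply.
  by rewrite /s ge_min lexx.
move=> /existsNP[i /negP]; rewrite -leNgt => Hi.
have ci : 1 - cos s <= 1 - cos (x 0 i - y 0 i).
  have cos_abs z : cos `|z| = cos z :> R.
    by have [?|?] := leP 0 z; [rewrite ger0_norm|rewrite ltr0_norm// cosN].
  rewrite lerD2l lerN2 -(cos_int2pi _ (n i)) -cos_abs.
  have pis : s <= pi by rewrite (le_trans _ pige1)// /s ge_min lexx orbT.
  move: Hi; rewrite le_eqVlt => /orP[/eqP <-//|Hi].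
  by apply/ltW; rewrite ltr_cos// in_itv /= ?Hn ?normr_ge0 ?(ltW s0).
have fM : `|f x - f y| <= 2 * M.
  by rewrite (le_trans (ler_normB _ _))// mulr_natl mulr2n lerD.
apply: le_trans fM _; rewrite ler_wpDl ?(ltW e0)//.
apply: (@le_trans _ _ (2 * M / (1 - cos s) * (1 - cos s))).
  by rewrite divfK//; lra.
rewrite ler_wpM2l// (le_trans ci)// (bigD1 i)//= lerDl sumr_ge0//.
Qed.

Lemma is_tp_fejer N i (c : R) : is_tp (fun x => fejer N (x 0 i - c)).
Proof.
have cE (a : nat) : is_tp (fun x : vec => cos (a%:R * (x 0 i - c))).
  have -> : (fun x : vec => cos (a%:R * (x 0 i - c))) = (fun x : vec =>
     cos (a%:R * c) * cos (freq_dot (a%:Z *: ('e_i : freq)) x) +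
     sin (a%:R * c) * sin (freq_dot (a%:Z *: ('e_i : freq)) x)).
    by apply/funext => x; rewrite freq_dot_axis mulrBr cosB pmulrn; ring.
  by apply: is_tpD; apply: is_tpZ; [exact: is_tp_cos|exact: is_tp_sin].
have sE (a : nat) : is_tp (fun x : vec => sin (a%:R * (x 0 i - c))).
  have -> : (fun x : vec => sin (a%:R * (x 0 i - c))) = (fun x : vec =>
     cos (a%:R * c) * sin (freq_dot (a%:Z *: ('e_i : freq)) x) +
     (- sin (a%:R * c)) * cos (freq_dot (a%:Z *: ('e_i : freq)) x)).
    by apply/funext => x; rewrite freq_dot_axis mulrBr sinB pmulrn; ring.
  by apply: is_tpD; apply: is_tpZ; [exact: is_tp_sin|exact: is_tp_cos].
rewrite /fejer; apply: is_tpZ; apply: is_tpD;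
  under eq_fun do rewrite expr2; apply: is_tpM; exact: is_tp_sum.
Qed.

(** Sampling on a grid, instead of integrating against the kernel, keeps the approximant a
    finite sum. *)
Theorem fejer_density f : cper f -> forall e, 0 < e ->
  exists p, forall x, `|f x - tp p x| <= e.
Proof.
move=> cpf e e0; have e2 : 0 < e / 2 by rewrite divr_gt0.
have [K K0 HK] := cper_modulus cpf e2.
pose N := (Num.truncn (4 * K * d%:R / e)).+1.
have N0 : (0 < N)%N by [].
have NR : (0 : R) < N%:R by rewrite ltr0n.
have HN : K * (d%:R * (2 / N%:R)) <= e / 2.
  have : 4 * K * d%:R / e < N%:R by rewrite /N truncnS_gt.
  rewrite ltr_pdivrMr// => h.
  have -> : K * (d%:R * (2 / N%:R)) = 2 * K * d%:R / N%:R by ring.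
  by rewrite ler_pdivrMr//; lra.
pose pt (j : {ffun 'I_d -> 'I_N}) : vec := \row_i grid R N (j i).
pose w (i : 'I_d) (m : 'I_N) (x : vec) := N%:R^-1 * fejer N (x 0 i - grid R N m).
pose W (j : {ffun 'I_d -> 'I_N}) (x : vec) := \prod_i w i (j i) x.
have w0 i m x : 0 <= w i m x by rewrite mulr_ge0 ?fejer_ge0// invr_ge0 ltW.
have W0 j x : 0 <= W j x by rewrite prodr_ge0.
have w1 i x : \sum_m w i m x = 1.
  by rewrite /w -mulr_sumr fejer_sum// mulVf// lt0r_neq0.
have W1 x : \sum_j W j x = 1.
  by rewrite /W -(bigA_distr_bigA (fun i m => w i m x)) big1// => i _.
have tpP : is_tp (fun x => \sum_j f (pt j) * W j x).
  apply: is_tp_sum => j; apply: is_tpZ; apply: is_tp_prod => i.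
  by apply: is_tpZ; exact: is_tp_fejer.
have [p Hp] := tpP; exists p => x; rewrite -Hp.
have -> : f x - \sum_j f (pt j) * W j x = \sum_j (f x - f (pt j)) * W j x.
  under [RHS]eq_bigr do rewrite mulrBl.
  by rewrite sumrB -mulr_sumr W1 mulr1.
rewrite (le_trans (ler_norm_sum _ _ _))//.
apply: (@le_trans _ _ (\sum_j (e / 2 + K * \sum_i (1 - cos (x 0 i - pt j 0 i))) * W j x)).
  by apply: ler_sum => j _; rewrite normrM (ger0_norm (W0 _ _)) ler_wpM2r// HK.
under eq_bigr do rewrite mulrDl.
rewrite big_split/= -mulr_sumr W1 mulr1 [leRHS](splitr e) lerD2l (le_trans _ HN)//.
under eq_bigr do rewrite -mulrA mulr_suml.
rewrite -mulr_sumr ler_wpM2l// exchange_big/=.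
have -> : d%:R * (2 / N%:R) = \sum_(i < d) (2 / N%:R) :> R.
  by rewrite sumr_const card_ord mulr_natl.
apply: ler_sum => i _.
pose w' (l : 'I_d) (m : 'I_N) := (if l == i then 1 - cos (x 0 i - grid R N m) else 1) * w l m x.
have E j : (1 - cos (x 0 i - pt j 0 i)) * W j x = \prod_l w' l (j l).
  rewrite /W /w' [in RHS]big_split/=; congr (_ * _).
  by rewrite (bigD1 i)//= eqxx mxE big1 ?mulr1// => l /negPf ->.
under eq_bigr do rewrite E.
rewrite -(bigA_distr_bigA w') (bigD1 i)//= [X in _ * X]big1 ?mulr1; last first.
  by move=> l /negPf li; rewrite /w' li; under eq_bigr do rewrite mul1r.
rewrite /w' eqxx; apply: (@le_trans _ _ (\sum_(m < N) N%:R^-1 * (2 / N%:R))).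
  apply: ler_sum => m _; rewrite /w mulrCA ler_wpM2l ?invr_ge0 ?(ltW NR)//.
  exact: fejer_moment.
by rewrite sumr_const card_ord -[_ *+ N]mulr_natl mulrA mulfV ?mul1r// lt0r_neq0.
Qed.

End periodic.

(** * Continuous periodic functions *)
Lemma cvg_sumr (R : realType) (T I : Type) (F : set_system T) (s : seq I)
    (f : I -> T -> R) (l : I -> R) : Filter F -> (forall i, f i x @[x --> F] --> l i) ->
  \sum_(i <- s) f i x @[x --> F] --> \sum_(i <- s) l i.
Proof.
move=> FF fl; elim: s => [|i s IH].
  by rewrite big_nil; under eq_cvg do rewrite big_nil; exact: cvg_cst.
by rewrite big_cons; under eq_cvg do rewrite big_cons; apply: cvgD.
Qed.

Section cper_closure.
Variables (R : realType) (d : nat).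
Local Notation vec := 'rV[R]_d.
Local Notation freq := 'rV[int]_d.
Implicit Types (k l : freq) (x y : vec) (f g : vec -> R) (e c : R).

Lemma freq_dot_continuous k : continuous (fun x : vec => freq_dot k x).
Proof.
move=> x; rewrite /freq_dot; apply: (@cvg_sumr R vec _ (nbhs x)) => i.
by apply: cvgMr; exact: coord_continuous.
Qed.

Lemma freq_dot_shift k l x :
  freq_dot k (x + (2 * pi) *: map_mx intr l) = freq_dot k x + 2 * pi * (\sum_i k 0 i * l 0 i)%:~R.
Proof.
rewrite freq_dotDr freq_dotZr; congr (_ + _ * _).
rewrite /freq_dot rmorph_sum/=; apply: eq_bigr => i _.
by rewrite mxE rmorphM.
Qed.

Lemma sin_int2pi (z : R) (n : int) : sin (z + 2 * pi * n%:~R) = sin z.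
Proof.
have H (w : R) : sin w = cos (w - pi / 2) by rewrite cosBpihalf.
by rewrite !H addrAC cos_int2pi.
Qed.

Lemma cper_cos k : cper (fun x : vec => cos (freq_dot k x)).
Proof.
split=> [x|x l]; last by rewrite freq_dot_shift cos_int2pi.
apply: (@continuous_comp _ _ _ (freq_dot k) cos); first exact: freq_dot_continuous.
exact: continuous_cos.
Qed.

Lemma cper_sin k : cper (fun x : vec => sin (freq_dot k x)).
Proof.
split=> [x|x l]; last by rewrite freq_dot_shift sin_int2pi.
apply: (@continuous_comp _ _ _ (freq_dot k) sin); first exact: freq_dot_continuous.
exact: continuous_sin.
Qed.

Lemma cper_cst c : cper (fun _ : vec => c).
Proof. by split=> [|x l //]; exact: cst_continuous. Qed.

Lemma cperD f g : cper f -> cper g -> cper (fun x => f x + g x).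
Proof.
move=> [cf pf] [cg pg]; split=> [x|x l]; last by rewrite pf pg.
exact: (@cvgD _ _ _ (nbhs x) _ f g _ _ (cf x) (cg x)).
Qed.

Lemma cperM f g : cper f -> cper g -> cper (fun x => f x * g x).
Proof.
move=> [cf pf] [cg pg]; split=> [x|x l]; last by rewrite pf pg.
exact: (@cvgM _ _ (nbhs x) _ f g _ _ (cf x) (cg x)).
Qed.

Lemma cperZ c f : cper f -> cper (fun x => c * f x).
Proof. by apply: cperM; exact: cper_cst. Qed.

Lemma cperN f : cper f -> cper (fun x => - f x).
Proof. by move=> /(cperZ (-1)); under eq_fun do rewrite mulN1r. Qed.

Lemma cperB f g : cper f -> cper g -> cper (fun x => f x - g x).
Proof. by move=> cf /cperN; exact: cperD. Qed.

Lemma cper_norm f : cper f -> cper (fun x => `|f x|).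
Proof.
move=> [cf pf]; split=> [x|x l]; last by rewrite pf.
exact: (@cvg_norm _ _ _ (nbhs x) _ f _ (cf x)).
Qed.

Lemma cper_sum (I : Type) (s : seq I) (F : I -> vec -> R) :
  (forall i, cper (F i)) -> cper (fun x => \sum_(i <- s) F i x).
Proof.
move=> H; elim: s => [|i s IH].
  by under eq_fun do rewrite big_nil; exact: cper_cst.
by under eq_fun do rewrite big_cons; exact: cperD.
Qed.

Lemma cper_sqr f : cper f -> cper (fun x => f x ^+ 2).
Proof. by move=> cf; under eq_fun do rewrite expr2; exact: cperM. Qed.

Lemma cper_tp p : cper (tp p : vec -> R).
Proof.
rewrite /tp; apply: cper_sum => -[[a b] k] /=.
by apply: cperD; apply: cperZ; [exact: cper_cos|exact: cper_sin].
Qed.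

Lemma cper_uniform_limit f :
  (forall e, 0 < e -> exists2 g, cper g & forall x, `|f x - g x| <= e) -> cper f.
Proof.
move=> H; split=> [x|x k].
  apply/(@cvgrPdist_lt _ _ _ (nbhs x)) => e e0.
  have e3 : 0 < e / 3 by rewrite divr_gt0.
  have [g [cg _] Hg] := H _ e3.
  have /cvgrPdist_lt/(_ _ e3) := cg x.
  move=> gx; apply: (@filterS _ (nbhs x) (nbhs_filter x) _ _ _ gx) => y xy.
  have -> : f x - f y = (f x - g x) + (g x - g y) - (f y - g y) by ring.
  rewrite (le_lt_trans (ler_normB _ _))// (le_lt_trans (lerD (ler_normD _ _) (Hg y)))//.
  have := Hg x; lra.
apply/eqP; rewrite -subr_eq0 -normr_le0; apply/ler_addgt0Pl => e e0; rewrite addr0.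
have e3 : 0 < e / 2 by rewrite divr_gt0.
have [g [_ pg] Hg] := H _ e3; set x' := x + _.
have -> : f x' - f x = (f x' - g x') - (f x - g x) by rewrite pg; ring.
by rewrite (le_trans (ler_normB _ _))// (splitr e) lerD.
Qed.

End cper_closure.

Section affine_derivatives.
Variable R : realType.

Lemma is_derive_affine (a b x : R) : is_derive x (1 : R) (fun s => a + b * s) b.
Proof.
have -> : (fun s => a + b * s) = cst a + b \*: (@id R) by [].
by apply: is_derive_eq; rewrite add0r /GRing.scale /= mulr1.
Qed.

Lemma is_derive_cos_affine (a b x : R) :
  is_derive x (1 : R) (fun s => cos (a + b * s)) (- b * sin (a + b * x)).
Proof.
have d := is_derive_affine a b x.
have := @is_derive1_comp R cos _ _ _ _ (is_derive_cos _) d.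
by rewrite !mulNr mulrC.
Qed.

Lemma is_derive_sin_affine (a b x : R) :
  is_derive x (1 : R) (fun s => sin (a + b * s)) (b * cos (a + b * x)).
Proof.
have d := is_derive_affine a b x.
have := @is_derive1_comp R sin _ _ _ _ (is_derive_sin _) d.
by rewrite mulrC.
Qed.

End affine_derivatives.

(** * Integration on the torus *)
Section circle.
Variable R : realType.

Lemma circle_measure_fin : fin_num_fun (@circle_measure R).
Proof.
by apply: lty_fin_num_fun; rewrite -ge0_fin_numE ?circle_measure_setT_fin.
Qed.

HB.instance Definition _ :=
  Measure_isFinite.Build _ _ _ (@circle_measure R) circle_measure_fin.

Let pi20 : 0 < 2 * pi :> R. Proof. by rewrite mulr_gt0 ?pi_gt0. Qed.

Lemma circle_integral (f : R -> R) : measurable_fun setT f ->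
  (@circle_measure R).-integrable setT (EFin \o f) ->
  (\int[@circle_measure R]_x (f x)%:E = \int[lebesgue_measure]_(x in `[0%R, (2 * pi)%R]) (f x)%:E)%E.
Proof.
move=> mf intf; rewrite (@negligible_integral _ (measurableTypeR R) R (@circle_measure R) setT (~` `[0, 2 * pi]) (EFin \o f))//.
- rewrite setDE setCK setTI; apply: eq_measure_integral => A mA AI.
  by rewrite /circle_measure /mrestr; congr lebesgue_measure; rewrite setIidl.
- exact: measurableC.
- suff : lebesgue_measure ((~` `[0, 2 * pi]) `&` [set` `[0 : R, 2 * pi]]) = 0%E by [].
  by rewrite setIC setICr measure0.
Qed.

Lemma circle_integrable (f : R -> R) (M : R) : measurable_fun setT f ->
  (forall x, `|f x| <= M) -> (@circle_measure R).-integrable setT (EFin \o f).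
Proof.
move=> mf fM; apply: measurable_bounded_integrable => //.
  by rewrite -ge0_fin_numE ?circle_measure_setT_fin.
by exists M; split=> [|y My x _]; [exact: num_real | rewrite /= (le_trans (fM x))// ltW].
Qed.

Lemma circle_setT : @circle_measure R setT = (2 * pi)%:E.
Proof.
rewrite /circle_measure /mrestr setTI lebesgue_measure_itv /= lte_fin pi20.
by rewrite oppr0 adde0.
Qed.

Lemma circle_cos (m : int) : (\int[@circle_measure R]_x (cos (m%:~R * x))%:E =
  (if m == 0 then 2 * pi else 0)%:E)%E.
Proof.
case: eqP => [->|/eqP m0].
  under eq_integral do rewrite mul0r cos0.
  by rewrite integral_cst// mul1e; exact: circle_setT.
have mR : m%:~R != 0 :> R by rewrite intr_eq0.
have ccos : continuous (fun x : R => cos (m%:~R * x)).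
  by move=> x; exact: (continuous_comp (@mulrl_continuous _ (m%:~R) x) (@continuous_cos _ _)).
have csin : continuous (fun x : R => (m%:~R)^-1 * sin (m%:~R * x)).
  move=> x; apply: cvgMr.
  exact: (continuous_comp (@mulrl_continuous _ (m%:~R) x) (@continuous_sin _ _)).
have dsin (x : R) : is_derive x (1 : R) (fun x : R => (m%:~R)^-1 * sin (m%:~R * x)) (cos (m%:~R * x)).
  have := @is_deriveZ _ _ _ _ (m%:~R)^-1 x 1 _ (is_derive_sin_affine 0 (m%:~R) x).
  rewrite add0r /GRing.scale /= mulrA mulVf// mul1r.
  by congr is_derive; apply/funext => z; rewrite /= add0r.
have mcos : measurable_fun setT (fun x : R => cos (m%:~R * x)).
  by apply: continuous_measurable_fun.
rewrite circle_integral//; last by apply: (circle_integrable (M := 1)) => // x; exact: cos_max.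
rewrite (@continuous_FTC2 _ _ (fun x => (m%:~R)^-1 * sin (m%:~R * x)))//.
- have -> : m%:~R * (2 * pi) = 0 + 2 * pi * m%:~R :> R by rewrite add0r mulrC.
  by rewrite sin_int2pi !(mulr0, sin0) -EFinB subrr.
- exact: continuous_subspaceT.
- split; [by move=> x _; apply: ex_derive|apply: cvg_at_right_filter; exact: csin|
    apply: cvg_at_left_filter; exact: csin].
- by move=> x _; rewrite derive1E; apply: derive_val.
Qed.

Lemma circle_sin (m : int) : (\int[@circle_measure R]_x (sin (m%:~R * x))%:E = 0)%E.
Proof.
have [->|m0] := eqVneq m 0.
  by under eq_integral do rewrite mul0r sin0; rewrite integral0.
have mR : m%:~R != 0 :> R by rewrite intr_eq0.
have csin : continuous (fun x : R => sin (m%:~R * x)).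
  by move=> x; exact: (continuous_comp (@mulrl_continuous _ (m%:~R) x) (@continuous_sin _ _)).
have ccos : continuous (fun x : R => - (m%:~R)^-1 * cos (m%:~R * x)).
  move=> x; apply: cvgMr.
  exact: (continuous_comp (@mulrl_continuous _ (m%:~R) x) (@continuous_cos _ _)).
have dcos (x : R) : is_derive x (1 : R) (fun x : R => - (m%:~R)^-1 * cos (m%:~R * x)) (sin (m%:~R * x)).
  have := @is_deriveZ _ _ _ _ (- (m%:~R)^-1) x 1 _ (is_derive_cos_affine 0 (m%:~R) x).
  rewrite add0r /GRing.scale /= mulrA mulrNN mulVf// mul1r.
  by congr is_derive; apply/funext => z; rewrite /= add0r.
have msin : measurable_fun setT (fun x : R => sin (m%:~R * x)).
  by apply: continuous_measurable_fun.
rewrite circle_integral//; last by apply: (circle_integrable (M := 1)) => // x; exact: sin_max.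
rewrite (@continuous_FTC2 _ _ (fun x => - (m%:~R)^-1 * cos (m%:~R * x)))//.
- have -> : m%:~R * (2 * pi) = 0 + 2 * pi * m%:~R :> R by rewrite add0r mulrC.
  by rewrite cos_int2pi mulr0 -EFinB subrr.
- exact: continuous_subspaceT.
- split; [by move=> x _; apply: ex_derive|apply: cvg_at_right_filter; exact: ccos|
    apply: cvg_at_left_filter; exact: ccos].
- by move=> x _; rewrite derive1E; apply: derive_val.
Qed.

End circle.

Section torus_integral.
Variable R : realType.
Local Notation T := (measurableTypeR R).

Lemma tuple_bounded_integrable (d : nat) (f : d.-tuple T -> R) (M : R) :
  measurable_fun setT f -> (forall x, `|f x| <= M) ->
  (torus_measure R d).-integrable setT (EFin \o f).
Proof.
move=> mf fM; apply: measurable_bounded_integrable => //.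
  by rewrite -ge0_fin_numE ?fin_num_measure.
by exists M; split=> [|y My x _]; [exact: num_real | rewrite /= (le_trans (fM x))// ltW].
Qed.

(** The measure is a product pushed forward to tuples, so that this is Fubini's theorem. *)
Lemma torus_integral_step (d : nat) (f : d.+1.-tuple T -> R) (M : R) :
  measurable_fun setT f -> (forall x, `|f x| <= M) ->
  (\int[torus_measure R d.+1]_t (f t)%:E =
   \int[@circle_measure R]_x \int[torus_measure R d]_t (f (tuple_cons (x, t)))%:E)%E.
Proof.
move=> mf fM.
have mfc : measurable_fun setT (fun z : T * d.-tuple T => f (tuple_cons z)).
  by apply: measurableT_comp => //; exact: measurable_tuple_cons.
have ifc : ((@circle_measure R) \x (torus_measure R d))%E.-integrable setT
    (fun z : T * d.-tuple T => (f (tuple_cons z))%:E).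
  apply: (measurable_bounded_integrable (f := fun z : T * d.-tuple T => f (tuple_cons z))) => //.
    have : (((@circle_measure R) \x (torus_measure R d)) (setT `*` setT) < +oo)%E.
      rewrite product_measure1E// -ge0_fin_numE ?mule_ge0//.
      by rewrite fin_numM ?circle_measure_setT_fin ?fin_num_measure.
    by rewrite setXTT.
  by exists M; split=> [|y My x _]; [exact: num_real | rewrite /= (le_trans (fM _))// ltW].
rewrite (integral12_prod_meas1 ifc).
rewrite [LHS]/= /torus_step integral_pushforward//.
- exact: measurable_tuple_cons.
- exact: measurableT_comp.
Qed.

Lemma freq_dot_cons (d : nat) (k : 'rV[int]_d.+1) (x : R) (t : d.-tuple R) :
  freq_dot k (row_of_tuple (tuple_cons (x, t) : d.+1.-tuple R)) =
  (k 0 ord0)%:~R * x + freq_dot (\row_i k 0 (lift ord0 i)) (row_of_tuple t).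
Proof.
rewrite /freq_dot big_ord_recl; congr (_ * _ + _).
  by rewrite mxE tnth0.
by apply: eq_bigr => i _; rewrite !mxE tnthS.
Qed.

Lemma measurable_freq_dot (d : nat) (k : 'rV[int]_d) :
  measurable_fun [set: d.-tuple T] (fun t => freq_dot k (row_of_tuple t) : R).
Proof.
apply: measurable_sum => i; under eq_fun do rewrite mxE.
by apply: measurable_funM => //; exact: measurable_tnth.
Qed.

Lemma measurable_cos_freq (d : nat) (k : 'rV[int]_d) :
  measurable_fun [set: d.-tuple T] (fun t => cos (freq_dot k (row_of_tuple t)) : R).
Proof.
apply: measurableT_comp; last exact: measurable_freq_dot.
by apply: continuous_measurable_fun; exact: continuous_cos.
Qed.

Lemma measurable_sin_freq (d : nat) (k : 'rV[int]_d) :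
  measurable_fun [set: d.-tuple T] (fun t => sin (freq_dot k (row_of_tuple t)) : R).
Proof.
apply: measurableT_comp; last exact: measurable_freq_dot.
by apply: continuous_measurable_fun; exact: continuous_sin.
Qed.

(** The addition formulas separate the first coordinate, for an induction on the dimension. *)
Lemma torus_characters (d : nat) (k : 'rV[int]_d) :
  (\int[torus_measure R d]_t (cos (freq_dot k (row_of_tuple t)))%:E =
     (if k == 0 then (2 * pi) ^+ d else 0)%:E)%E /\
  (\int[torus_measure R d]_t (sin (freq_dot k (row_of_tuple t)))%:E = 0)%E.
Proof.
elim: d k => [|d IH] k.
  have -> : k = 0 by apply/rowP => -[].
  rewrite eqxx expr0; split.
    rewrite (eq_integral (cst 1%E)).
      by rewrite integral_cst// mul1e; exact: diracT.
    by move=> t _; rewrite freq_dot0l cos0.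
  rewrite (eq_integral (cst 0%E)) ?integral0//.
  by move=> t _; rewrite freq_dot0l sin0.
pose k' : 'rV[int]_d := \row_i k 0 (lift ord0 i).
have [Ic Is] := IH k'.
have c1 x : `|cos x| <= 1 :> R by exact: cos_max.
have s1 x : `|sin x| <= 1 :> R by exact: sin_max.
have int_c : (torus_measure R d).-integrable setT
    (EFin \o (fun t => cos (freq_dot k' (row_of_tuple t)))).
  by apply: (tuple_bounded_integrable (M := 1)) => //; exact: measurable_cos_freq.
have int_s : (torus_measure R d).-integrable setT
    (EFin \o (fun t => sin (freq_dot k' (row_of_tuple t)))).
  by apply: (tuple_bounded_integrable (M := 1)) => //; exact: measurable_sin_freq.
set C := if k' == 0 then _ else _ in Ic.
have inner a b : (\int[torus_measure R d]_t (a * cos (freq_dot k' (row_of_tuple t)) +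
    b * sin (freq_dot k' (row_of_tuple t)))%:E = (a * C)%:E)%E.
  transitivity (\int[torus_measure R d]_t ((a%:E * (cos (freq_dot k' (row_of_tuple t)))%:E) +
     (b%:E * (sin (freq_dot k' (row_of_tuple t)))%:E)))%E.
    by apply: eq_integral.
  rewrite integralD//; [|exact: integrableZl|exact: integrableZl].
  by rewrite !integralZl// Ic Is mule0 adde0 EFinM.
have ccos m : (@circle_measure R).-integrable setT (fun x : T => (cos (m%:~R * x))%:E).
  apply: (circle_integrable (M := 1)) => //; apply: continuous_measurable_fun => x.
  exact: (continuous_comp (@mulrl_continuous _ (m%:~R) x) (@continuous_cos _ _)).
have csin m : (@circle_measure R).-integrable setT (fun x : T => (sin (m%:~R * x))%:E).
  apply: (circle_integrable (M := 1)) => //; apply: continuous_measurable_fun => x.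
  exact: (continuous_comp (@mulrl_continuous _ (m%:~R) x) (@continuous_sin _ _)).
split.
  rewrite (torus_integral_step (M := 1)) => //; last exact: measurable_cos_freq.
  transitivity (\int[@circle_measure R]_x (C%:E * (cos ((k 0 ord0)%:~R * x))%:E))%E.
    apply: eq_integral => x _; rewrite muleC -EFinM -(inner _ (- sin ((k 0 ord0)%:~R * x))).
    by apply: eq_integral => t _; rewrite freq_dot_cons cosD mulNr.
  rewrite integralZl// circle_cos -EFinM; congr EFin.
  rewrite /C; have [k00|k00] := eqVneq (k 0 ord0) 0; last first.
    have /negPf -> : k != 0 by apply: contraNneq k00 => ->; rewrite mxE.
    by rewrite mulr0.
  have -> : (k == 0) = (k' == 0).
    apply/eqP/eqP => [k_0|k'0]; first by apply/rowP => i; rewrite !mxE k_0 mxE.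
    apply/rowP => i; rewrite mxE; have [j ->|->] := unliftP ord0 i; last by rewrite k00.
    by have /rowP/(_ j) := k'0; rewrite !mxE.
  by case: ifP => _; rewrite ?mul0r// exprSr.
rewrite (torus_integral_step (M := 1)) => //; last exact: measurable_sin_freq.
transitivity (\int[@circle_measure R]_x (C%:E * (sin ((k 0 ord0)%:~R * x))%:E))%E.
  apply: eq_integral => x _; rewrite muleC -EFinM -(inner _ (cos ((k 0 ord0)%:~R * x))).
  by apply: eq_integral => t _; rewrite freq_dot_cons sinD.
by rewrite integralZl// circle_sin mule0.
Qed.

End torus_integral.

Section torus_int_theory.
Variables (R : realType) (d : nat).
Local Notation vec := 'rV[R]_d.
Local Notation freq := 'rV[int]_d.
Implicit Types (k l : freq) (x y : vec) (f g : vec -> R) (e c : R).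

(** Trigonometric polynomials are visibly measurable for the product structure of tuples; their
    uniform limits follow. *)
Lemma cper_measurable f : cper f ->
  measurable_fun [set: d.-tuple (measurableTypeR R)] (fun t => f (row_of_tuple t)).
Proof.
move=> cf.
have H (n : nat) : exists p, forall x, `|f x - tp p x| <= n.+1%:R^-1.
  by apply: fejer_density.
pose p n := projT1 (cid (H n)).
have Hp n x : `|f x - tp (p n) x| <= n.+1%:R^-1 := projT2 (cid (H n)) x.
apply: (@measurable_fun_cvg _ _ _ _ (fun n t => tp (p n) (row_of_tuple t))) => [n|t _].
  rewrite /tp; apply: measurable_sum => -[[a b] k] /=.
  apply: measurable_funD; apply: measurable_funM => //;
    [exact: measurable_cos_freq|exact: measurable_sin_freq].
apply/cvgrPdist_le => e e0; near=> n.
apply: le_trans (Hp _ _) _; near: n.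
have /cvgrPdist_le/(_ e e0) := @cvg_harmonic R; apply: filterS => n.
by rewrite sub0r normrN ger0_norm// /harmonic/= invr_ge0.
Unshelve. all: by end_near.
Qed.

Lemma cper_integrable f : cper f ->
  (torus_measure R d).-integrable setT (EFin \o (fun t => f (row_of_tuple t))).
Proof.
move=> cf; have [M _ HM] := cper_bounded cf.
by apply: (tuple_bounded_integrable (M := M)) => //; exact: cper_measurable.
Qed.

Lemma torus_intD f g : cper f -> cper g ->
  torus_int (fun x => f x + g x) = torus_int f + torus_int g.
Proof. by move=> cf cg; apply: RintegralD => //; exact: cper_integrable. Qed.

Lemma torus_intZ c f : cper f -> torus_int (fun x => c * f x) = c * torus_int f.
Proof. by move=> cf; apply: RintegralZl => //; exact: cper_integrable. Qed.

Lemma torus_intB f g : cper f -> cper g ->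
  torus_int (fun x => f x - g x) = torus_int f - torus_int g.
Proof. by move=> cf cg; apply: RintegralB => //; exact: cper_integrable. Qed.

Lemma torus_int_le f g : cper f -> cper g -> (forall x, f x <= g x) ->
  torus_int f <= torus_int g.
Proof. by move=> cf cg fg; apply: le_Rintegral => //; exact: cper_integrable. Qed.

Lemma torus_int_norm f : cper f -> `|torus_int f| <= torus_int (fun x => `|f x|).
Proof. by move=> cf; apply: le_normr_Rintegral => //; exact: cper_integrable. Qed.

Lemma torus_int_cos k : torus_int (fun x => cos (freq_dot k x) : R) =
  if k == 0 then (2 * pi) ^+ d else 0.
Proof. by rewrite /torus_int /Rintegral (torus_characters _ k).1. Qed.

Lemma torus_int_sin k : torus_int (fun x => sin (freq_dot k x) : R) = 0.
Proof. by rewrite /torus_int /Rintegral (torus_characters _ k).2. Qed.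

Lemma torus_int_cst c : torus_int (fun _ : vec => c) = c * (2 * pi) ^+ d.
Proof.
have /= := torus_intZ c (@cper_cos R d 0).
rewrite torus_int_cos eqxx => <-; congr torus_int.
by apply/funext => x; rewrite freq_dot0l cos0 mulr1.
Qed.

Lemma torus_int_sum (I : Type) (s : seq I) (F : I -> vec -> R) :
  (forall i, cper (F i)) ->
  torus_int (fun x => \sum_(i <- s) F i x) = \sum_(i <- s) torus_int (F i).
Proof.
move=> H; elim: s => [|i s IH].
  by under eq_fun do rewrite big_nil; rewrite torus_int_cst mul0r big_nil.
under eq_fun do rewrite big_cons; rewrite big_cons torus_intD ?IH//.
exact: cper_sum.
Qed.

End torus_int_theory.

(** * Fourier coefficients, Bessel and Parseval *)
Lemma big_seq_delta (R : realType) (I : eqType) (s : seq I) (l : I) (F : I -> R) :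
  uniq s -> l \in s -> \sum_(k <- s) (k == l)%:R * F k = F l.
Proof.
move=> us ls; rewrite (bigD1_seq l)//= eqxx mul1r big1 ?addr0// => k /negPf ->.
by rewrite mul0r.
Qed.

Section fourier.
Variables (R : realType) (d : nat).
Local Notation vec := 'rV[R]_d.
Local Notation freq := 'rV[int]_d.
Implicit Types (k l : freq) (x y : vec) (f g : vec -> R) (e c : R) (a b : freq -> R).

Definition avg f : R := (2 * pi) ^- d * torus_int f.
(** No factor 2: sums run over the whole lattice, where k and -k share the contribution
    of a mode. *)
Definition fcos f k : R := avg (fun x => f x * cos (freq_dot k x)).
Definition fsin f k : R := avg (fun x => f x * sin (freq_dot k x)).

Let vol_gt0 : 0 < (2 * pi) ^- d :> R.
Proof. by rewrite invr_gt0 exprn_gt0// mulr_gt0 ?pi_gt0. Qed.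

Lemma avgD f g : cper f -> cper g -> avg (fun x => f x + g x) = avg f + avg g.
Proof. by move=> cf cg; rewrite /avg torus_intD// mulrDr. Qed.

Lemma avgB f g : cper f -> cper g -> avg (fun x => f x - g x) = avg f - avg g.
Proof. by move=> cf cg; rewrite /avg torus_intB// mulrBr. Qed.

Lemma avgZ c f : cper f -> avg (fun x => c * f x) = c * avg f.
Proof. by move=> cf; rewrite /avg torus_intZ// mulrCA. Qed.

Lemma avg_sum (I : Type) (s : seq I) (F : I -> vec -> R) : (forall i, cper (F i)) ->
  avg (fun x => \sum_(i <- s) F i x) = \sum_(i <- s) avg (F i).
Proof. by move=> cF; rewrite /avg torus_int_sum// mulr_sumr. Qed.

Lemma avg_cst c : avg (fun=> c) = c.
Proof. by rewrite /avg torus_int_cst mulrCA mulVf ?mulr1// gt_eqF// -invr_gt0. Qed.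

Lemma avg_le f g : cper f -> cper g -> (forall x, f x <= g x) -> avg f <= avg g.
Proof. by move=> cf cg fg; rewrite ler_pM2l// torus_int_le. Qed.

Lemma avg_ge0 f : cper f -> (forall x, 0 <= f x) -> 0 <= avg f.
Proof. by move=> cf f0; rewrite -[leLHS](avg_cst 0) avg_le//; exact: cper_cst. Qed.

Lemma avg_norm f : cper f -> `|avg f| <= avg (fun x => `|f x|).
Proof. by move=> cf; rewrite /avg normrM (gtr0_norm vol_gt0) ler_pM2l// torus_int_norm. Qed.

Lemma avg_bound f c : cper f -> (forall x, `|f x| <= c) -> `|avg f| <= c.
Proof.
move=> cf fc; rewrite (le_trans (avg_norm cf))// -[leRHS]avg_cst avg_le//.
  exact: cper_norm.
exact: cper_cst.
Qed.

Lemma avg_cos k : avg (fun x => cos (freq_dot k x)) = (k == 0)%:R.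
Proof.
rewrite /avg torus_int_cos; case: ifP => _; last by rewrite mulr0.
by rewrite mulVf// gt_eqF// -invr_gt0.
Qed.

Lemma avg_sin k : avg (fun x => sin (freq_dot k x)) = 0.
Proof. by rewrite /avg torus_int_sin mulr0. Qed.

Lemma avg_coscos k l : avg (fun x => cos (freq_dot k x) * cos (freq_dot l x)) =
  ((k == l)%:R + (k == - l)%:R) / 2.
Proof.
have -> : (fun x => cos (freq_dot k x) * cos (freq_dot l x)) = (fun x : vec =>
    2^-1 * (cos (freq_dot (k - l) x) + cos (freq_dot (k + l) x))).
  by apply/funext => x; rewrite freq_dotBl freq_dotDl cosB cosD; field.
have cc j := @cper_cos R d j.
rewrite avgZ; last exact: cperD.
by rewrite avgD// !avg_cos subr_eq0 addr_eq0 mulrC.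
Qed.

Lemma avg_sinsin k l : avg (fun x => sin (freq_dot k x) * sin (freq_dot l x)) =
  ((k == l)%:R - (k == - l)%:R) / 2.
Proof.
have -> : (fun x => sin (freq_dot k x) * sin (freq_dot l x)) = (fun x : vec =>
    2^-1 * (cos (freq_dot (k - l) x) - cos (freq_dot (k + l) x))).
  by apply/funext => x; rewrite freq_dotBl freq_dotDl cosB cosD; field.
have cc j := @cper_cos R d j.
rewrite avgZ; last exact: cperB.
by rewrite avgB// !avg_cos subr_eq0 addr_eq0 mulrC.
Qed.

Lemma avg_sincos k l : avg (fun x => sin (freq_dot k x) * cos (freq_dot l x)) = 0.
Proof.
have -> : (fun x => sin (freq_dot k x) * cos (freq_dot l x)) = (fun x : vec =>
    2^-1 * (sin (freq_dot (k - l) x) + sin (freq_dot (k + l) x))).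
  by apply/funext => x; rewrite freq_dotBl freq_dotDl sinB sinD; field.
have cc j := @cper_sin R d j.
rewrite avgZ; last exact: cperD.
by rewrite avgD// !avg_sin addr0 mulr0.
Qed.

Lemma fcosN f k : fcos f (- k) = fcos f k.
Proof. by congr avg; apply/funext => x; rewrite freq_dotNl cosN. Qed.

Lemma fsinN f k : cper f -> fsin f (- k) = - fsin f k.
Proof.
move=> cf; rewrite -mulN1r -avgZ; last by apply: cperM => //; exact: cper_sin.
by congr avg; apply/funext => x; rewrite freq_dotNl sinN; ring.
Qed.

Lemma fcosB f g k : cper f -> cper g -> fcos (fun x => f x - g x) k = fcos f k - fcos g k.
Proof.
move=> cf cg; have cc := @cper_cos R d k.
by rewrite /fcos -avgB; [congr avg; apply/funext => x; ring|exact: cperM|exact: cperM].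
Qed.

Lemma fsinB f g k : cper f -> cper g -> fsin (fun x => f x - g x) k = fsin f k - fsin g k.
Proof.
move=> cf cg; have cc := @cper_sin R d k.
by rewrite /fsin -avgB; [congr avg; apply/funext => x; ring|exact: cperM|exact: cperM].
Qed.

Lemma fcos_bound f k c : cper f -> (forall x, `|f x| <= c) -> `|fcos f k| <= c.
Proof.
move=> cf fc; apply: avg_bound => [|x]; first by apply: cperM => //; exact: cper_cos.
by rewrite normrM -[leRHS]mulr1 ler_pM// cos_max.
Qed.

Lemma fsin_bound f k c : cper f -> (forall x, `|f x| <= c) -> `|fsin f k| <= c.
Proof.
move=> cf fc; apply: avg_bound => [|x]; first by apply: cperM => //; exact: cper_sin.
by rewrite normrM -[leRHS]mulr1 ler_pM// sin_max.
Qed.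

(** The boxes enumerated as lists: sums over them become ordinary iterated sums. *)
Definition fbox (N : nat) : seq freq :=
  [seq \row_i ((nat_of_ord (h i))%:Z - N%:Z) |
    h : {ffun 'I_d -> 'I_(N.*2.+1)} <- enum {ffun 'I_d -> 'I_(N.*2.+1)}].

Lemma fbox_uniq N : uniq (fbox N).
Proof.
rewrite map_inj_uniq ?enum_uniq// => h h' /rowP hh'; apply/ffunP => i.
have := hh' i; rewrite !mxE => /addIr /eqP; rewrite eqz_nat => /eqP ij.
exact: val_inj.
Qed.

Lemma mem_fbox N k : (k \in fbox N) = [forall i, `|k 0 i| <= N%:Z].
Proof.
apply/mapP/forallP => [[h _ -> i]|H].
  rewrite mxE ler_norml; have := ltn_ord (h i). by set m := nat_of_ord _; lia.
have lt i : (absz (k 0%R i + N%:Z)%R < N.*2.+1)%N by have := H i; rewrite ler_norml; lia.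
exists [ffun i => Ordinal (lt i)]; first by rewrite mem_enum.
by apply/rowP => i; rewrite mxE ffunE /=; have := H i; rewrite ler_norml; lia.
Qed.

Lemma fboxN N k : (- k \in fbox N) = (k \in fbox N).
Proof. by rewrite !mem_fbox; apply: eq_forallb => i; rewrite mxE normrN. Qed.

Lemma fbox_sub M N k : (M <= N)%N -> k \in fbox M -> k \in fbox N.
Proof.
rewrite !mem_fbox => MN /forallP H; apply/forallP => i.
by rewrite (le_trans (H i))// lez_nat.
Qed.

Lemma fbox_absorb k : exists N, k \in fbox N.
Proof.
exists (\sum_i absz (k 0%R i))%N; rewrite mem_fbox; apply/forallP => i.
by rewrite -abszE lez_nat (bigD1 i)//= leq_addr.
Qed.

Definition psum (N : nat) a b x : R :=
  \sum_(k <- fbox N) (a k * cos (freq_dot k x) + b k * sin (freq_dot k x)).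

Lemma cper_psum N a b : cper (psum N a b).
Proof.
by apply: cper_sum => k; apply: cperD; apply: cperZ; [exact: cper_cos|exact: cper_sin].
Qed.

Lemma Re_sum (I : Type) (s : seq I) (F : I -> complex R) :
  complex.Re (\sum_(i <- s) F i) = \sum_(i <- s) complex.Re (F i).
Proof.
elim: s => [|i s IH]; first by rewrite !big_nil.
by rewrite !big_cons -IH; case: (F i) (\sum_(_ <- _) _) => ? ? [].
Qed.

Lemma fourier_multiplierE (m : freq -> R) f x : fourier_multiplier m f x =
  limn (fun N => psum N (fun k => m k * fcos f k) (fun k => m k * fsin f k) x).
Proof.
rewrite /fourier_multiplier; congr (lim (_ @ \oo)); apply/funext => N.
have -> : freq_box N = [set` fbox N].
  by apply/seteqP; split=> k /=; rewrite mem_fbox => /forallP.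
rewrite -fsbig_seq ?fbox_uniq// Re_sum; apply: eq_bigr => k _ /=.
by rewrite /fcos /fsin /avg; ring.
Qed.

(** The parities which make the coefficients of a real series over the whole lattice unique. *)
Definition even_coef a := forall k, a (- k) = a k.
Definition odd_coef b := forall k, b (- k) = - b k.

Lemma fcos_psum N a b l : even_coef a -> l \in fbox N -> fcos (psum N a b) l = a l.
Proof.
move=> ea lN; have cc := @cper_cos R d; have cs := @cper_sin R d.
transitivity (\sum_(k <- fbox N) (a k * avg (fun x => cos (freq_dot k x) * cos (freq_dot l x)) +
    b k * avg (fun x => sin (freq_dot k x) * cos (freq_dot l x)))).
  rewrite /fcos /psum; under eq_fun do rewrite mulr_suml.
  rewrite avg_sum => [|k]; last by apply: cperM => //; apply: cperD; exact: cperZ.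
  apply: eq_bigr => k _; rewrite -!avgZ; [|exact: cperM|exact: cperM].
  rewrite -avgD; [|by apply: cperZ; exact: cperM|by apply: cperZ; exact: cperM].
  by congr avg; apply/funext => x; ring.
transitivity (\sum_(k <- fbox N) ((k == l)%:R * (a k / 2) + (k == - l)%:R * (a k / 2))).
  by apply: eq_bigr => k _; rewrite avg_coscos avg_sincos; ring.
by rewrite big_split/= !big_seq_delta ?fbox_uniq ?fboxN// ea; field.
Qed.

Lemma fsin_psum N a b l : odd_coef b -> l \in fbox N -> fsin (psum N a b) l = b l.
Proof.
move=> ob lN; have cc := @cper_cos R d; have cs := @cper_sin R d.
transitivity (\sum_(k <- fbox N) (a k * avg (fun x => sin (freq_dot l x) * cos (freq_dot k x)) +
    b k * avg (fun x => sin (freq_dot k x) * sin (freq_dot l x)))).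
  rewrite /fsin /psum; under eq_fun do rewrite mulr_suml.
  rewrite avg_sum => [|k]; last by apply: cperM => //; apply: cperD; exact: cperZ.
  apply: eq_bigr => k _; rewrite -!avgZ; [|exact: cperM|exact: cperM].
  rewrite -avgD; [|by apply: cperZ; exact: cperM|by apply: cperZ; exact: cperM].
  by congr avg; apply/funext => x; ring.
transitivity (\sum_(k <- fbox N) ((k == l)%:R * (b k / 2) - (k == - l)%:R * (b k / 2))).
  by apply: eq_bigr => k _; rewrite avg_sinsin avg_sincos; ring.
by rewrite sumrB !big_seq_delta ?fbox_uniq ?fboxN// ob; field.
Qed.

Lemma avg_mul_psum f N a b : cper f -> avg (fun x => f x * psum N a b x) =
  \sum_(k <- fbox N) (a k * fcos f k + b k * fsin f k).
Proof.
move=> cf; have cc := @cper_cos R d; have cs := @cper_sin R d.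
rewrite /psum; under eq_fun do rewrite mulr_sumr.
rewrite avg_sum => [|k]; last by apply: cperM => //; apply: cperD; exact: cperZ.
apply: eq_bigr => k _; rewrite /fcos /fsin -!avgZ; [|exact: cperM|exact: cperM].
rewrite -avgD; [|by apply: cperZ; exact: cperM|by apply: cperZ; exact: cperM].
by congr avg; apply/funext => x; ring.
Qed.

Lemma avg_psum_sqr N a b : even_coef a -> odd_coef b ->
  avg (fun x => psum N a b x ^+ 2) = \sum_(k <- fbox N) (a k ^+ 2 + b k ^+ 2).
Proof.
move=> ea ob; under eq_fun do rewrite expr2.
rewrite avg_mul_psum; last exact: cper_psum.
rewrite big_seq [RHS]big_seq; apply: eq_bigr => k kN.
by rewrite fcos_psum// fsin_psum// !expr2.
Qed.

Definition energy f (N : nat) : R := \sum_(k <- fbox N) (fcos f k ^+ 2 + fsin f k ^+ 2).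

Let fpart f N := psum N (fcos f) (fsin f).

Lemma avg_residual f N : cper f ->
  avg (fun x => (f x - fpart f N x) ^+ 2) = avg (fun x => f x ^+ 2) - energy f N.
Proof.
move=> cf; have cP := cper_psum N (fcos f) (fsin f).
have -> : (fun x => (f x - fpart f N x) ^+ 2) = (fun x =>
    f x ^+ 2 - 2 * (f x * fpart f N x) + fpart f N x ^+ 2).
  by apply/funext => x; ring.
have cfP : cper (fun x => f x * fpart f N x) by exact: cperM.
rewrite avgD; [|by apply: cperB; [exact: cper_sqr|exact: cperZ]|exact: cper_sqr].
rewrite avgB; [|exact: cper_sqr|exact: cperZ].
rewrite avgZ// avg_mul_psum// avg_psum_sqr; [|exact: fcosN|by move=> k; exact: fsinN].
have -> : \sum_(k <- fbox N) (fcos f k * fcos f k + fsin f k * fsin f k) = energy f N.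
  by apply: eq_bigr => k _; rewrite !expr2.
rewrite -/(energy f N); ring.
Qed.

Lemma bessel f N : cper f -> energy f N <= avg (fun x => f x ^+ 2).
Proof.
move=> cf; rewrite -subr_ge0 -avg_residual//; apply: avg_ge0 => [|x]; last exact: sqr_ge0.
by apply: cper_sqr; apply: cperB => //; exact: cper_psum.
Qed.

Lemma tp_absorb (p : seq (R * R * freq)) : exists N, forall q, q \in p -> q.2 \in fbox N.
Proof.
elim: p => [|q p [N HN]]; first by exists 0%N.
have [M HM] := fbox_absorb q.2; exists (maxn N M) => r.
rewrite inE => /orP[/eqP ->|rp]; first exact: fbox_sub (leq_maxr _ _) HM.
exact: fbox_sub (leq_maxl _ _) (HN _ rp).
Qed.

(** The partial Fourier sum is the best approximation among trigonometric polynomials of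
    the same box, so completeness follows from uniform density. *)
Theorem parseval_le f e : cper f -> 0 < e ->
  exists N, avg (fun x => f x ^+ 2) <= energy f N + e.
Proof.
move=> cf e0; have se0 : 0 < Num.sqrt e by rewrite sqrtr_gt0.
have [p Hp] := fejer_density cf se0.
have [N HN] := tp_absorb p; exists N.
rewrite addrC -lerBlDr -avg_residual//.
pose P := fpart f N; have cP : cper P := cper_psum N _ _.
have cr : cper (fun x => f x - P x) by exact: cperB.
have ct : cper (tp p : vec -> R) by exact: cper_tp.
have cfP : cper (fun x => f x - tp p x) by exact: cperB.
have orth_tp : avg (fun x => (f x - P x) * tp p x) = 0.
  have cc := @cper_cos R d; have cs := @cper_sin R d.
  rewrite /tp; under eq_fun do rewrite mulr_sumr.
  rewrite avg_sum => [|k]; last by apply: cperM => //; apply: cperD; exact: cperZ.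
  rewrite big_seq big1// => -[[a b] l] /HN /= lN.
  transitivity (a * fcos (fun x => f x - P x) l + b * fsin (fun x => f x - P x) l).
    rewrite /fcos /fsin -!avgZ; [|exact: cperM|exact: cperM].
    rewrite -avgD; [|by apply: cperZ; exact: cperM|by apply: cperZ; exact: cperM].
    by congr avg; apply/funext => x; ring.
  rewrite fcosB// fsinB// fcos_psum//; last exact: fcosN.
  rewrite fsin_psum//; last by move=> k; exact: fsinN.
  by rewrite !subrr !mulr0 addr0.
have orth_P : avg (fun x => (f x - P x) * P x) = 0.
  rewrite avg_mul_psum// big_seq big1// => l lN.
  rewrite fcosB// fsinB// fcos_psum//; last exact: fcosN.
  rewrite fsin_psum//; last by move=> k; exact: fsinN.
  by rewrite !subrr !mulr0 addr0.
have E : avg (fun x => (f x - P x) ^+ 2) = avg (fun x => (f x - P x) * (f x - tp p x)).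
  have -> : (fun x => (f x - P x) ^+ 2) = (fun x => (f x - P x) * (f x - tp p x) +
      ((f x - P x) * tp p x - (f x - P x) * P x)) by apply/funext => x; ring.
  have c1 := cperM cr ct; have c2 := cperM cr cP; have c3 := cperM cr cfP.
  by rewrite avgD//; [rewrite avgB// orth_tp orth_P subrr addr0|exact: cperB].
have le1 : avg (fun x => (f x - P x) * (f x - tp p x)) <=
    2^-1 * avg (fun x => (f x - P x) ^+ 2) + 2^-1 * avg (fun x => (f x - tp p x) ^+ 2).
  have c1 := cper_sqr cr; have c2 := cper_sqr cfP.
  rewrite -!avgZ// -avgD; [|exact: cperZ|exact: cperZ].
  apply: avg_le => [||x]; [exact: cperM|by apply: cperD; exact: cperZ|].
  have := sqr_ge0 ((f x - P x) - (f x - tp p x)); nra.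
have le2 : avg (fun x => (f x - tp p x) ^+ 2) <= e.
  rewrite -[leRHS]avg_cst; apply: avg_le => [||x]; [exact: cper_sqr|exact: cper_cst|].
  by rewrite -[leRHS]sqr_sqrtr ?(ltW e0)// -[leLHS]real_normK ?num_real// lerXn2r ?nnegrE.
rewrite -/P; move: E le1 le2; lra.
Qed.

End fourier.

Section multiplier_tp.
Variables (R : realType) (d : nat).
Local Notation vec := 'rV[R]_d.
Local Notation freq := 'rV[int]_d.
Implicit Types (k l : freq) (x y : vec) (f g : vec -> R) (e c : R) (a b : freq -> R).

Lemma fcos_tp (p : seq (R * R * freq)) k :
  fcos (tp p : vec -> R) k = \sum_(q <- p) q.1.1 * (((k == q.2)%:R + (k == - q.2)%:R) / 2).
Proof.
have cc := @cper_cos R d; have cs := @cper_sin R d.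
rewrite /fcos /tp; under eq_fun do rewrite mulr_suml.
rewrite avg_sum => [|q]; last by apply: cperM => //; apply: cperD; exact: cperZ.
apply: eq_bigr => -[[a b] l] _ /=.
transitivity (a * avg (fun x : vec => cos (freq_dot k x) * cos (freq_dot l x)) +
  b * avg (fun x : vec => sin (freq_dot l x) * cos (freq_dot k x))).
  rewrite -!avgZ; [|exact: cperM|exact: cperM].
  rewrite -avgD; [|by apply: cperZ; exact: cperM|by apply: cperZ; exact: cperM].
  by congr avg; apply/funext => x; ring.
by rewrite avg_coscos avg_sincos mulr0 addr0.
Qed.

Lemma fsin_tp (p : seq (R * R * freq)) k :
  fsin (tp p : vec -> R) k = \sum_(q <- p) q.1.2 * (((k == q.2)%:R - (k == - q.2)%:R) / 2).
Proof.
have cc := @cper_cos R d; have cs := @cper_sin R d.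
rewrite /fsin /tp; under eq_fun do rewrite mulr_suml.
rewrite avg_sum => [|q]; last by apply: cperM => //; apply: cperD; exact: cperZ.
apply: eq_bigr => -[[a b] l] _ /=.
transitivity (a * avg (fun x : vec => sin (freq_dot k x) * cos (freq_dot l x)) +
  b * avg (fun x : vec => sin (freq_dot k x) * sin (freq_dot l x))).
  rewrite -!avgZ; [|exact: cperM|exact: cperM].
  rewrite -avgD; [|by apply: cperZ; exact: cperM|by apply: cperZ; exact: cperM].
  by congr avg; apply/funext => x; ring.
by rewrite avg_sinsin avg_sincos mulr0 add0r.
Qed.

Definition tp_mult (m : freq -> R) (p : seq (R * R * freq)) : seq (R * R * freq) :=
  [seq (m q.2 * q.1.1, m q.2 * q.1.2, q.2) | q <- p].

Lemma fourier_multiplier_tp (m : freq -> R) (p : seq (R * R * freq)) x :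
  (forall k, m (- k) = m k) -> fourier_multiplier m (tp p) x = tp (tp_mult m p) x.
Proof.
move=> em; rewrite fourier_multiplierE; apply/cvg_lim => //.
have [N0 HN0] := tp_absorb p.
apply: cvg_near_cst; near=> N.
have NN : (N0 <= N)%N by near: N; exists N0.
have HN q : q \in p -> q.2 \in fbox d N by move=> /HN0; exact: fbox_sub.
rewrite /psum /tp [RHS]big_map /=.
under eq_bigr do rewrite fcos_tp fsin_tp !mulr_sumr !mulr_suml -big_split/=.
rewrite exchange_big/= big_seq [RHS]big_seq; apply: eq_bigr => -[[a b] l] /HN /= lN.
transitivity (\sum_(k <- fbox d N)
  ((k == l)%:R * (m k / 2 * (a * cos (freq_dot k x) + b * sin (freq_dot k x))) +
   (k == - l)%:R * (m k / 2 * (a * cos (freq_dot k x) - b * sin (freq_dot k x))))).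
  by apply: eq_bigr => k _; ring.
rewrite big_split/= !big_seq_delta ?fbox_uniq ?fboxN// em freq_dotNl cosN sinN.
by field.
Unshelve. all: by end_near.
Qed.

End multiplier_tp.

(** * Absolutely convergent trigonometric series *)
Section box_series.
Variables (R : realType) (d : nat).
Local Notation vec := 'rV[R]_d.
Local Notation freq := 'rV[int]_d.
Implicit Types (k l : freq) (x y : vec) (e c : R) (w W a b : freq -> R).

Definition bsum w (N : nat) : R := \sum_(k <- fbox d N) w k.

Definition box_summable w := exists C, forall N, bsum (fun k => `|w k|) N <= C.

Lemma bsum_subset w (M N : nat) : (M <= N)%N ->
  bsum w N = bsum w M + \sum_(k <- fbox d N | k \notin fbox d M) w k.
Proof.
move=> MN; rewrite /bsum (bigID (fun k => k \in fbox d M))/=; congr (_ + _).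
rewrite -big_filter; apply: perm_big; apply: uniq_perm.
- by rewrite filter_uniq// fbox_uniq.
- exact: fbox_uniq.
- move=> k; rewrite mem_filter; apply/andP/idP => [[]//|kM]; split=> //.
  exact: fbox_sub kM.
Qed.

Lemma bsum_nd w : (forall k, 0 <= w k) -> {homo bsum w : n m / (n <= m)%N >-> n <= m}.
Proof. by move=> w0 M N MN; rewrite (bsum_subset w MN) lerDl sumr_ge0. Qed.

Lemma bsum_le w W N : (forall k, w k <= W k) -> bsum w N <= bsum W N.
Proof. by move=> wW; apply: ler_sum. Qed.

Lemma bsumD w W N : bsum (fun k => w k + W k) N = bsum w N + bsum W N.
Proof. exact: big_split. Qed.

Lemma box_summable_le w W : (forall k, `|w k| <= W k) -> box_summable W -> box_summable w.
Proof.
move=> wW [C HC]; exists C => N; apply: le_trans (HC N); apply: bsum_le => k.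
by rewrite (le_trans (wW k))// ler_norm.
Qed.

Lemma box_summableZ c w : box_summable w -> box_summable (fun k => c * w k).
Proof.
move=> [C HC]; exists (`|c| * C) => N; rewrite /bsum.
under eq_bigr do rewrite normrM; rewrite -mulr_sumr ler_wpM2l//; exact: HC.
Qed.

Lemma bsum_ge0_cvg W : (forall k, 0 <= W k) -> box_summable W -> cvgn (bsum W).
Proof.
move=> W0 [C HC]; apply: nondecreasing_is_cvgn; first exact: bsum_nd.
by exists C => _ [N _ <-]; apply: le_trans (HC N); apply: bsum_le => k; exact: ler_norm.
Qed.

Lemma bsum_cvg w : box_summable w -> cvgn (bsum w).
Proof.
move=> sw; have sn : box_summable (fun k => `|w k|).
  case: sw => C HC; exists C => N; apply: le_trans (HC N).
  by apply: ler_sum => k _; rewrite normr_id.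
have c1 : cvgn (bsum (fun k => w k + `|w k|)).
  apply: bsum_ge0_cvg => [k|]; first by have := ler_norm (- w k); rewrite normrN; lra.
  apply: (@box_summable_le _ (fun k => 2 * `|w k|)); last exact: box_summableZ.
  by move=> k; rewrite (le_trans (ler_normD _ _))// normr_id; lra.
have c2 : cvgn (bsum (fun k => `|w k|)) by exact: bsum_ge0_cvg.
have -> : bsum w = (fun N => bsum (fun k => w k + `|w k|) N - bsum (fun k => `|w k|) N).
  by apply/funext => N; rewrite bsumD addrK.
exact: is_cvgB.
Qed.

(** The tail bound depends on the majorant alone: convergence is uniform in parameters. *)
Lemma bsum_tail W : (forall k, 0 <= W k) -> box_summable W -> forall e, 0 < e ->
  exists N0, forall N w, (N0 <= N)%N -> (forall k, `|w k| <= W k) ->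
    `|limn (bsum w) - bsum w N| <= e.
Proof.
move=> W0 sW e e0; have cW := bsum_ge0_cvg W0 sW.
have /cvgrPdist_le/(_ e e0)[N0 _ HN0] := cW.
exists N0 => N w NN wW.
have sw : box_summable w by exact: box_summable_le wW sW.
have H M : (N <= M)%N -> `|bsum w M - bsum w N| <= e.
  move=> NM; apply: (@le_trans _ _ (limn (bsum W) - bsum W N)).
    apply: (@le_trans _ _ (bsum W M - bsum W N)).
      rewrite (bsum_subset w NM) (bsum_subset W NM) ![_ + _ - _]addrAC !subrr !add0r.
      by rewrite (le_trans (ler_norm_sum _ _ _))//; apply: ler_sum.
    by rewrite lerD2r; apply: nondecreasing_cvgn_le => //; exact: bsum_nd.
  by rewrite (le_trans (ler_norm _))//; exact: HN0.
have cw := bsum_cvg sw.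
have : (fun M => `|bsum w M - bsum w N|) @ \oo --> `|limn (bsum w) - bsum w N|.
  by apply: cvg_norm; apply: cvgB; [exact: cw|exact: cvg_cst].
move=> cv; rewrite -(cvg_lim _ cv)//; apply: limr_le; first by apply/cvg_ex; eexists; exact: cv.
by near=> M; apply: H; near: M; exists N.
Unshelve. all: by end_near.
Qed.

Lemma lim_bsum_bound w W C : (forall k, `|w k| <= W k) -> (forall N, bsum W N <= C) ->
  `|limn (bsum w)| <= C.
Proof.
move=> wW HC.
have sw : box_summable w.
  by exists C => N; apply: le_trans (HC N); apply: bsum_le.
have cv : (fun N => `|bsum w N|) @ \oo --> `|limn (bsum w)|.
  by apply: cvg_norm; exact: bsum_cvg.
rewrite -(cvg_lim _ cv)//; apply: limr_le; first by apply/cvg_ex; eexists; exact: cv.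
near=> N; rewrite (le_trans (ler_norm_sum _ _ _))//.
by apply: le_trans (HC N); apply: ler_sum.
Unshelve. all: by end_near.
Qed.

Lemma lim_bsumD w1 w2 : box_summable w1 -> box_summable w2 ->
  limn (bsum (fun k => w1 k + w2 k)) = limn (bsum w1) + limn (bsum w2).
Proof.
move=> s1 s2; rewrite -limD; [|exact: bsum_cvg|exact: bsum_cvg].
by congr (lim (_ @ \oo)); apply/funext => N; exact: bsumD.
Qed.

Lemma lim_bsumZ c w : box_summable w -> limn (bsum (fun k => c * w k)) = c * limn (bsum w).
Proof.
move=> s1; have -> : bsum (fun k => c * w k) = (fun N => c * bsum w N).
  by apply/funext => N; rewrite /bsum mulr_sumr.
by apply/cvg_lim => //; apply: cvgMr; exact: bsum_cvg.
Qed.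

Lemma geometric_two_sided (N : nat) :
  \sum_(j < N.*2.+1) expR (- `|(j%:Z - N%:Z)%:~R|) <= 2 / (1 - expR (-1)) :> R.
Proof.
have q1 : expR (-1) < 1 :> R by rewrite -[ltRHS]expR0 ltr_expR; lra.
have q0 : 0 < expR (-1) :> R by exact: expR_gt0.
have geo n : \sum_(j < n) expR (- j%:R) <= 1 / (1 - expR (-1)) :> R.
  rewrite ler_pdivlMr ?subr_gt0//.
  have -> : (\sum_(j < n) expR (- j%:R)) * (1 - expR (-1)) = 1 - expR (- n%:R) :> R.
    elim: n => [|n IH]; first by rewrite big_ord0 mul0r oppr0 expR0 subrr.
    by rewrite big_ord_recr/= mulrDl IH -[n.+1%:R]natr1 opprD expRD; ring.
  by have := expR_gt0 (- n%:R : R); lra.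
have -> : N.*2.+1 = (N.+1 + N)%N by lia.
rewrite big_split_ord/= (_ : 2 / (1 - expR (-1)) = 1 / (1 - expR (-1)) + 1 / (1 - expR (-1)) :> R); last by lra.
apply: lerD.
  rewrite (reindex_inj rev_ord_inj)/=; apply: le_trans (geo N.+1); apply: ler_sum => j _.
  rewrite ler_expR lerN2 -[leLHS]ger0_norm// -[j%:R]/((j%:Z)%:~R) -!intr_norm ler_int.
  by have := ltn_ord j; lia.
apply: le_trans (geo N); apply: ler_sum => j _.
rewrite ler_expR lerN2 -[leLHS]ger0_norm// -[j%:R]/((j%:Z)%:~R) -!intr_norm ler_int; lia.
Qed.

Lemma freq_sq_ge0 k : 0 <= freq_sq R k.
Proof. by apply: sumr_ge0 => i _; exact: sqr_ge0. Qed.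

Lemma gaussian_summable : box_summable (fun k => expR (- freq_sq R k)).
Proof.
exists ((2 / (1 - expR (-1))) ^+ d) => N.
apply: (@le_trans _ _ (\sum_(h : {ffun 'I_d -> 'I_(N.*2.+1)})
    \prod_i expR (- `|((h i)%:Z - N%:Z)%:~R|))).
  rewrite /bsum big_map big_enum/=; apply: ler_sum => h _.
  rewrite ger0_norm ?expR_ge0// -expR_sum ler_expR sumrN lerN2; apply: ler_sum => i _.
  rewrite mxE -[leRHS]real_normK ?num_real// -intr_norm -rmorphXn/= ler_int.
  set z := `|_|; have : 0 <= z by []; nia.
rewrite -(bigA_distr_bigA (fun _ j => expR (- `|((nat_of_ord j)%:Z - N%:Z)%:~R|))).
rewrite prodr_const card_ord lerXn2r// ?nnegrE.
- by apply: sumr_ge0 => j _; exact: expR_ge0.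
- by rewrite divr_ge0// subr_ge0 -[leRHS]expR0 ler_expR; lra.
- exact: geometric_two_sided.
Qed.

(** Completing the square bounds the summand by a multiple of the Gaussian. *)
Lemma biharmonic_summable (p : nat) c : 0 < c ->
  box_summable (fun k => (1 + freq_sq R k) ^+ p * expR (- (c * freq_sq R k ^+ 2))).
Proof.
move=> c0; apply: (@box_summable_le _ (fun k => expR ((p.+1%:R) ^+ 2 / (4 * c)) * expR (- freq_sq R k))).
  move=> k; set s := freq_sq R k; have s0 : 0 <= s := freq_sq_ge0 k.
  rewrite ger0_norm ?mulr_ge0 ?exprn_ge0 ?expR_ge0//; last by lra.
  apply: (@le_trans _ _ (expR (p%:R * s) * expR (- (c * s ^+ 2)))).
    rewrite ler_wpM2r ?expR_ge0// expRM_natl lerXn2r ?nnegrE ?expR_ge0//; first by lra.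
    exact: expR_ge1Dx.
  rewrite -!expRD ler_expR.
  have -> : p.+1%:R ^+ 2 / (4 * c) = c * (p.+1%:R / (2 * c)) ^+ 2 by field; lra.
  have := sqr_ge0 (s - p.+1%:R / (2 * c)) => /(mulr_ge0 (ltW c0)).
  have -> : c * (s - p.+1%:R / (2 * c)) ^+ 2 =
    c * s ^+ 2 - s * p.+1%:R + c * (p.+1%:R / (2 * c)) ^+ 2 by field; lra.
  rewrite -[p.+1%:R]natr1; lra.
exact: box_summableZ gaussian_summable.
Qed.

End box_series.

Section trig_taylor.
Variable R : realType.
Implicit Types z u : R.

Lemma sin_le_norm z : `|sin z| <= `|z|.
Proof.
have H (y : R) : 0 < y -> `|sin y| <= y.
  move=> y0; have [|c _] := @MVT R sin cos 0 y y0 (fun x _ => is_derive_sin x).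
    by apply: continuous_subspaceT; exact: continuous_sin.
  by rewrite sin0 !subr0 => ->; rewrite normrM (gtr0_norm y0) ler_piMl ?cos_max// ltW.
have [z0|z0|->] := ltgtP z 0; last by rewrite sin0.
  by rewrite (ltr0_norm z0) -normrN -sinN H// oppr_gt0.
by rewrite (gtr0_norm z0) H.
Qed.

Lemma cos_sub1_le z : `|cos z - 1| <= z ^+ 2 / 2.
Proof.
have {1}-> : z = z / 2 + z / 2 by field.
rewrite cosD -!expr2 cos2sin2; have := sin_le_norm (z / 2).
rewrite -(ler_pXn2r (n := 2)) ?nnegrE// !real_normK ?num_real//.
have := sqr_ge0 (sin (z / 2)); rewrite ler_norml; set s := sin _ => s0 sz.
by apply/andP; split; lra.
Qed.

Lemma sin_sub_le z : `|sin z - z| <= z ^+ 2.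
Proof.
have H (y : R) : 0 < y -> `|sin y - y| <= y ^+ 2.
  move=> y0; have [|c /itvP cy] := @MVT R (fun s => sin s - s) (fun s => cos s - 1) 0 y y0
    (fun x _ => is_deriveB (is_derive_sin x) (is_derive_id x 1)).
    by apply: continuous_subspaceT => x; apply: cvgB; [exact: continuous_sin|exact: cvg_id].
  rewrite sin0 !subr0 => ->; rewrite normrM (gtr0_norm y0) expr2 ler_wpM2r ?(ltW y0)//.
  have [y2|y2] := leP 2 y.
    by rewrite ler_norml; have := cos_le1 c; have := cos_geN1 c; lra.
  rewrite (le_trans (cos_sub1_le c))//.
  have c0 : 0 < c by rewrite cy.
  have cy' : c < y by rewrite cy.
  nra.
have [z0|z0|->] := ltgtP z 0; last by rewrite sin0 subrr normr0 sqr_ge0.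
  have := H (- z); rewrite oppr_gt0 => /(_ z0).
  by rewrite sqrrN sinN opprK -normrN opprD !opprK.
exact: H.
Qed.

Lemma trig_taylor (p q u z : R) :
  `|p * cos (z + u) + q * sin (z + u) - (p * cos u + q * sin u) -
    z * (q * cos u - p * sin u)| <= 2 * (`|p| + `|q|) * z ^+ 2.
Proof.
have -> : p * cos (z + u) + q * sin (z + u) - (p * cos u + q * sin u) -
    z * (q * cos u - p * sin u) =
  p * (cos u * (cos z - 1) - sin u * (sin z - z)) +
  q * (sin u * (cos z - 1) + cos u * (sin z - z)) by rewrite cosD sinD; ring.
have H (s t : R) : `|s| <= 1 -> `|t| <= 1 ->
    `|s * (cos z - 1) + t * (sin z - z)| <= 2 * z ^+ 2.
  move=> s1 t1; apply: (le_trans (ler_normD _ _)); rewrite !normrM.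
  have := cos_sub1_le z; have := sin_sub_le z; have := sqr_ge0 z.
  have := normr_ge0 s; have := normr_ge0 t.
  have := normr_ge0 (cos z - 1); have := normr_ge0 (sin z - z); nra.
have -> : 2 * (`|p| + `|q|) * z ^+ 2 = `|p| * (2 * z ^+ 2) + `|q| * (2 * z ^+ 2) by ring.
apply: (le_trans (ler_normD _ _)); rewrite !normrM.
have -> : cos u * (cos z - 1) - sin u * (sin z - z) =
  cos u * (cos z - 1) + (- sin u) * (sin z - z) by ring.
by apply: lerD; rewrite ler_wpM2l// H ?normrN ?cos_max ?sin_max.
Qed.

End trig_taylor.

(** A difference quotient with a quadratic error survives limits of functions, unlike a
    derivative: all derivatives of infinite sums below are obtained from such estimates. *)
Lemma quadratic_is_derive (R : realType) (V : normedModType R) (f : V -> R) (x v : V) (D C : R) :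
  (forall h : R, `|f (h *: v + x) - f x - h * D| <= C * h ^+ 2) -> is_derive x v f D.
Proof.
move=> H.
have cv : (fun h : R => h^-1 *: ((f \o shift x) (h *: v) - f x)) @ 0^' --> D.
  apply/cvgrPdist_le => e e0; near=> h.
  have h0 : h != 0 by near: h; exact: nbhs_dnbhs_neq.
  have hn : 0 < `|h| by rewrite normr_gt0.
  rewrite distrC; have -> : h^-1 *: ((f \o shift x) (h *: v) - f x) - D =
      h^-1 * (f (h *: v + x) - f x - h * D).
    by rewrite /GRing.scale /= [in RHS]mulrBr mulrA mulVf// mul1r.
  rewrite normrM normfV ler_pdivrMl//; apply: le_trans (H h) _.
  rewrite -[h ^+ 2]real_normK ?num_real// expr2 mulrCA ler_wpM2l ?(ltW hn)//.
  apply: (@le_trans _ _ (`|C| * `|h|)); first by rewrite ler_wpM2r ?(ltW hn)// ler_norm.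
  have : `|h| <= e / (`|C| + 1).
    near: h; apply: dnbhs0_le.
    by rewrite divr_gt0// ltr_wpDl.
  rewrite ler_pdivlMr ?ltr_wpDl//; have := normr_ge0 C; nra.
have dv : derivable f x v by apply/cvg_ex; exists D.
by split=> //; apply/cvg_lim.
Unshelve. all: by end_near.
Qed.

Section series_derivative.
Variables (R : realType) (d : nat).
Local Notation vec := 'rV[R]_d.
Local Notation freq := 'rV[int]_d.
Implicit Types (k l : freq) (x y : vec) (e c : R) (a b : freq -> R) (f : vec -> R).

Definition tseries a b x : R := limn (fun N => psum N a b x).

(** The weight 1 + |k|^2 is what the Taylor remainders of second order cost. *)
Definition tsummable a b := box_summable (fun k => (1 + freq_sq R k) * (`|a k| + `|b k|)).

Let tterm a b x k := a k * cos (freq_dot k x) + b k * sin (freq_dot k x).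

Lemma tseriesE a b x : tseries a b x = limn (bsum (tterm a b x)).
Proof. by []. Qed.

Lemma tterm_le a b x k : `|tterm a b x k| <= `|a k| + `|b k|.
Proof.
rewrite (le_trans (ler_normD _ _))// !normrM.
by rewrite lerD// ler_piMr ?cos_max ?sin_max.
Qed.

Lemma tsummable_abs a b : tsummable a b -> box_summable (fun k => `|a k| + `|b k|).
Proof.
apply: box_summable_le => k; rewrite ger0_norm ?addr_ge0// ler_peMl ?addr_ge0//.
by rewrite lerDl freq_sq_ge0.
Qed.

Lemma tterm_summable a b x : tsummable a b -> box_summable (tterm a b x).
Proof. by move/tsummable_abs; apply: box_summable_le => k; exact: tterm_le. Qed.

Lemma freq_coord_sqr_le k i : ((k 0 i)%:~R : R) ^+ 2 <= freq_sq R k.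
Proof. by rewrite /freq_sq (bigD1 i)//= lerDl sumr_ge0// => j _; exact: sqr_ge0. Qed.

Lemma freq_coord_le k i : `|(k 0 i)%:~R : R| <= 1 + freq_sq R k.
Proof.
have := freq_coord_sqr_le k i; rewrite -real_normK ?num_real//.
by set z := `|_|; have := sqr_ge0 (z - 1); nra.
Qed.

Theorem tseries_derive a b x i : tsummable a b ->
  is_derive x ('e_i : vec) (tseries a b)
    (tseries (fun k => (k 0 i)%:~R * b k) (fun k => - ((k 0 i)%:~R * a k)) x).
Proof.
move=> sab; have [C HC] := sab.
apply: (@quadratic_is_derive _ _ _ _ _ _ (2 * C)) => h.
have s1 y := tterm_summable y sab.
have s2 : box_summable (tterm (fun k => (k 0 i)%:~R * b k) (fun k => - ((k 0 i)%:~R * a k)) x).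
  apply: box_summable_le sab => k; rewrite (le_trans (tterm_le _ _ _ _))//.
  rewrite normrN !normrM -mulrDr addrC ler_wpM2r ?addr_ge0//; exact: freq_coord_le.
have E : tseries a b (h *: 'e_i + x) - tseries a b x -
    h * tseries (fun k => (k 0 i)%:~R * b k) (fun k => - ((k 0 i)%:~R * a k)) x =
  limn (bsum (fun k => tterm a b (h *: 'e_i + x) k + (-1) * tterm a b x k +
    (- h) * tterm (fun k => (k 0 i)%:~R * b k) (fun k => - ((k 0 i)%:~R * a k)) x k)).
  have z1 := box_summableZ (-1) (s1 x); have z2 := box_summableZ (- h) s2.
  rewrite lim_bsumD//; last first.
    have [C1 H1] := s1 (h *: 'e_i + x); have [C2 H2] := z1.
    exists (C1 + C2) => N; apply: le_trans (lerD (H1 N) (H2 N)).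
    by rewrite -bsumD; apply: bsum_le => k; exact: ler_normD.
  by rewrite lim_bsumD// !lim_bsumZ// -!tseriesE mulN1r mulNr.
rewrite E; apply: (@lim_bsum_bound _ _ _ (fun k => 2 * h ^+ 2 * ((1 + freq_sq R k) * (`|a k| + `|b k|)))).
  move=> k; rewrite /tterm freq_dotDr freq_dotZr freq_dot_delta.
  set u := freq_dot k x; set z := h * _.
  have -> : a k * cos (z + u) + b k * sin (z + u) + -1 * (a k * cos u + b k * sin u) +
      - h * ((k 0 i)%:~R * b k * cos u + - ((k 0 i)%:~R * a k) * sin u) =
    a k * cos (z + u) + b k * sin (z + u) - (a k * cos u + b k * sin u) -
      z * (b k * cos u - a k * sin u) by rewrite /z; ring.
  apply: (le_trans (trig_taylor _ _ _ _)).
  rewrite /z exprMn.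
  have := freq_coord_sqr_le k i; set q := _ ^+ 2 => qk.
  have A0 : 0 <= `|a k| + `|b k| by rewrite addr_ge0.
  have h0 := sqr_ge0 h; have k0 := freq_sq_ge0 R k.
  have -> : 2 * (`|a k| + `|b k|) * (h ^+ 2 * q) = 2 * h ^+ 2 * (q * (`|a k| + `|b k|)) by ring.
  apply: ler_wpM2l; first by rewrite mulr_ge0.
  by apply: ler_wpM2r => //; lra.
move=> N; rewrite /bsum -mulr_sumr -mulrA -[leRHS]mulrA ler_pM2l// mulrC ler_wpM2r ?sqr_ge0//.
apply: le_trans (HC N); apply: ler_sum => k _; exact: ler_norm.
Qed.

Lemma cper_tseries a b : tsummable a b -> cper (tseries a b).
Proof.
move=> /tsummable_abs sab; apply: cper_uniform_limit => e e0.
have W0 k : 0 <= `|a k| + `|b k| by rewrite addr_ge0.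
have [N0 HN] := bsum_tail W0 sab e0.
exists (psum N0 a b) => [|x]; first exact: cper_psum.
by rewrite tseriesE; apply: HN => // k; exact: tterm_le.
Qed.

Lemma tseries_approx a b e : tsummable a b -> 0 < e ->
  exists N0, forall N x, (N0 <= N)%N -> `|tseries a b x - psum N a b x| <= e.
Proof.
move=> /tsummable_abs sab e0.
have W0 k : 0 <= `|a k| + `|b k| by rewrite addr_ge0.
have [N0 HN] := bsum_tail W0 sab e0.
by exists N0 => N x NN; rewrite tseriesE; apply: HN => // k; exact: tterm_le.
Qed.

Lemma fcos_tseries a b l : tsummable a b -> even_coef a -> fcos (tseries a b) l = a l.
Proof.
move=> sab ea; apply/eqP; rewrite -subr_eq0 -normr_le0.
apply/ler_addgt0Pl => e e0; rewrite addr0.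
have [N0 HN] := tseries_approx sab e0; have [N1 lN] := fbox_absorb R l.
pose N := maxn N0 N1.
rewrite -(@fcos_psum _ _ N a b l ea); last exact: fbox_sub (leq_maxr _ _) lN.
have cs := cper_tseries sab; have cp := cper_psum N a b.
rewrite -fcosB//; apply: fcos_bound; first exact: cperB.
by move=> x; apply: HN; exact: leq_maxl.
Qed.

Lemma fsin_tseries a b l : tsummable a b -> odd_coef b -> fsin (tseries a b) l = b l.
Proof.
move=> sab ob; apply/eqP; rewrite -subr_eq0 -normr_le0.
apply/ler_addgt0Pl => e e0; rewrite addr0.
have [N0 HN] := tseries_approx sab e0; have [N1 lN] := fbox_absorb R l.
pose N := maxn N0 N1.
rewrite -(@fsin_psum _ _ N a b l ob); last exact: fbox_sub (leq_maxr _ _) lN.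
have cs := cper_tseries sab; have cp := cper_psum N a b.
rewrite -fsinB//; apply: fsin_bound; first exact: cperB.
by move=> x; apply: HN; exact: leq_maxl.
Qed.

Lemma avg_tseries_sqr a b C : tsummable a b -> even_coef a -> odd_coef b ->
  (forall N, bsum (fun k => a k ^+ 2 + b k ^+ 2) N <= C) ->
  avg (fun x => tseries a b x ^+ 2) <= C.
Proof.
move=> sab ea ob HC; apply/ler_addgt0Pl => e e0.
have [N HN] := parseval_le (cper_tseries sab) e0.
apply: le_trans HN _; rewrite addrC lerD2l; apply: le_trans (HC N).
by apply: ler_sum => k _; rewrite fcos_tseries// fsin_tseries.
Qed.

End series_derivative.

(** * The semigroup of the bilaplacian *)
Section semigroup.
Variables (R : realType) (d : nat).
Local Notation vec := 'rV[R]_d.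
Local Notation freq := 'rV[int]_d.
Implicit Types (k l : freq) (x y : vec) (e c nu t : R) (a b : freq -> R) (f : vec -> R)
  (V W : vec -> vec).

Definition decay c k : R := expR (- (c * freq_sq R k ^+ 2)).

Lemma freq_sqN k : freq_sq R (- k) = freq_sq R k.
Proof. by apply: eq_bigr => i _; rewrite mxE rmorphN sqrrN. Qed.

Lemma decayN c k : decay c (- k) = decay c k.
Proof. by rewrite /decay freq_sqN. Qed.

Lemma decay_ge0 c k : 0 <= decay c k. Proof. exact: expR_ge0. Qed.

Lemma tsummable_decay (p : nat) c M a b : 0 < c ->
  (forall k, `|a k| <= M * ((1 + freq_sq R k) ^+ p * decay c k)) ->
  (forall k, `|b k| <= M * ((1 + freq_sq R k) ^+ p * decay c k)) -> tsummable a b.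
Proof.
move=> c0 Ha Hb.
apply: box_summable_le (box_summableZ (2 * M) (biharmonic_summable d p.+1 c0)) => k.
have s0 := freq_sq_ge0 R k.
rewrite ger0_norm ?mulr_ge0 ?addr_ge0// exprS.
have := Ha k; have := Hb k; rewrite -/(decay c k); set w := _ * decay c k => bk ak.
have -> : 2 * M * ((1 + freq_sq R k) * (1 + freq_sq R k) ^+ p * decay c k) =
  (1 + freq_sq R k) * (M * w + M * w) by rewrite /w; ring.
by rewrite ler_wpM2l ?addr_ge0// lerD.
Qed.

Lemma bilaplacian_semigroupE nu t f : bilaplacian_semigroup nu t f =
  tseries (fun k => decay (nu * t) k * fcos f k) (fun k => decay (nu * t) k * fsin f k).
Proof. by apply/funext => x; exact: fourier_multiplierE. Qed.

Lemma tsummable_semigroup c f : 0 < c -> cper f ->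
  tsummable (fun k => decay c k * fcos f k) (fun k => decay c k * fsin f k).
Proof.
move=> c0 cf; have [M M0 HM] := cper_bounded cf.
apply: (@tsummable_decay 0 c M) => // k; rewrite expr0 mul1r normrM ger0_norm ?decay_ge0//
  mulrC ler_wpM2r ?decay_ge0//; [exact: fcos_bound|exact: fsin_bound].
Qed.

Definition div_cos c V k : R :=
  decay c k * \sum_i (k 0 i)%:~R * fsin (fun y => V y 0 i) k.

Definition div_sin c V k : R :=
  - (decay c k * \sum_i (k 0 i)%:~R * fcos (fun y => V y 0 i) k).

Definition cper_field V := forall i, cper (fun y => V y 0 i).

Lemma tsummable_div c V : 0 < c -> cper_field V -> tsummable (div_cos c V) (div_sin c V).
Proof.
move=> c0 cV.
pose M i := projT1 (cid2 (cper_bounded (cV i))).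
have HM i : forall x, `|V x 0 i| <= M i by rewrite /M; case: cid2.
have M0 i : 0 <= M i by rewrite /M; case: cid2.
have H (F : 'I_d -> R) k : (forall i, `|F i| <= M i) ->
    `|\sum_i (k 0 i)%:~R * F i| <= (1 + freq_sq R k) * \sum_i M i.
  move=> HF; rewrite (le_trans (ler_norm_sum _ _ _))// mulr_sumr; apply: ler_sum => i _.
  by rewrite normrM ler_pM// freq_coord_le.
apply: (@tsummable_decay 1 c (\sum_i M i)) => // k;
  rewrite ?normrN normrM ger0_norm ?decay_ge0// expr1 mulrA mulrC ler_wpM2r ?decay_ge0//;
  rewrite [leRHS]mulrC H// => i; [exact: fsin_bound|exact: fcos_bound].
Qed.

Lemma tseries_cvg a b x : tsummable a b -> psum N a b x @[N --> \oo] --> tseries a b x.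
Proof. by move=> sab; apply: bsum_cvg; exact: tterm_summable. Qed.

Lemma tseries_sum (I : Type) (s : seq I) (F G : I -> freq -> R) x :
  (forall i, tsummable (F i) (G i)) ->
  \sum_(i <- s) tseries (F i) (G i) x =
  tseries (fun k => \sum_(i <- s) F i k) (fun k => \sum_(i <- s) G i k) x.
Proof.
move=> sFG; apply/esym/cvg_lim => //.
have -> : (fun N => psum N (fun k => \sum_(i <- s) F i k) (fun k => \sum_(i <- s) G i k) x) =
    (fun N => \sum_(i <- s) psum N (F i) (G i) x).
  apply/funext => N; rewrite /psum exchange_big; apply: eq_bigr => k _.
  by rewrite !mulr_suml -big_split.
by apply: cvg_sumr => i; exact: tseries_cvg.
Qed.

Theorem div_semigroupE nu t V : 0 < nu * t -> cper_field V ->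
  div_semigroup nu t V = tseries (div_cos (nu * t) V) (div_sin (nu * t) V).
Proof.
move=> c0 cV; apply/funext => x; rewrite /div_semigroup /div.
set c := nu * t.
pose F i k := (k 0 i)%:~R * (decay c k * fsin (fun y => V y 0 i) k).
pose G i k := - ((k 0 i)%:~R * (decay c k * fcos (fun y => V y 0 i) k)).
transitivity (\sum_i tseries (F i) (G i) x).
  apply: eq_bigr => i _; rewrite /partial.
  under [X in 'D__ X _]eq_fun do rewrite mxE bilaplacian_semigroupE.
  by have h := tseries_derive x i (tsummable_semigroup c0 (cV i)); rewrite derive_val.
rewrite tseries_sum => [|i].
  congr (tseries _ _ _); apply/funext => k; rewrite /div_cos /div_sin mulr_sumr ?sumrN.
    by apply: eq_bigr => i _; rewrite /F; ring.
  by congr (- _); apply: eq_bigr => i _; ring.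
have [M M0 HM] := cper_bounded (cV i).
have H k z : `|z| <= M ->
    `|(k 0 i)%:~R * (decay c k * z)| <= M * ((1 + freq_sq R k) ^+ 1 * decay c k).
  move=> zM; rewrite !normrM (ger0_norm (decay_ge0 _ _)) expr1.
  have -> : M * ((1 + freq_sq R k) * decay c k) = (1 + freq_sq R k) * (decay c k * M) by ring.
  apply: ler_pM; rewrite ?mulr_ge0 ?decay_ge0 ?freq_coord_le//.
  by rewrite ler_wpM2l ?decay_ge0.
apply: (@tsummable_decay 1 c M) => // k; rewrite ?normrN; apply: H;
  [exact: fsin_bound|exact: fcos_bound].
Qed.

End semigroup.

Lemma cauchy_schwarz_sum (R : realType) (I : finType) (x y : I -> R) :
  (\sum_i x i * y i) ^+ 2 <= (\sum_i x i ^+ 2) * (\sum_i y i ^+ 2).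
Proof.
rewrite expr2 !mulr_suml -subr_ge0.
under eq_bigr do rewrite mulr_sumr.
under [X in _ - X]eq_bigr do rewrite mulr_sumr.
have sym : \sum_i \sum_j x i ^+ 2 * y j ^+ 2 = \sum_i \sum_j x j ^+ 2 * y i ^+ 2.
  by rewrite exchange_big.
have H : 0 <= \sum_i \sum_j (x i * y j - x j * y i) ^+ 2.
  by apply: sumr_ge0 => i _; apply: sumr_ge0 => j _; exact: sqr_ge0.
have : \sum_i \sum_j (x i * y j - x j * y i) ^+ 2 =
    \sum_i \sum_j x i ^+ 2 * y j ^+ 2 + \sum_i \sum_j x j ^+ 2 * y i ^+ 2 -
    2 * \sum_i \sum_j x i * y i * (x j * y j).
  rewrite mulr_sumr -big_split -sumrB; apply: eq_bigr => i _.
  rewrite mulr_sumr -big_split -sumrB; apply: eq_bigr => j _ /=; ring.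
rewrite -sym; move: H; lra.
Qed.

Section semigroup_bounds.
Variables (R : realType) (d : nat).
Local Notation vec := 'rV[R]_d.
Local Notation freq := 'rV[int]_d.
Implicit Types (k l : freq) (x y : vec) (e c nu t : R) (a b : freq -> R) (f : vec -> R)
  (V W : vec -> vec).

Lemma even_div_cos c V : cper_field V -> even_coef (div_cos c V).
Proof.
move=> cV k; rewrite /div_cos decayN; congr (_ * _); apply: eq_bigr => i _.
by rewrite mxE rmorphN fsinN ?mulrNN.
Qed.

Lemma odd_div_sin c V : odd_coef (div_sin c V).
Proof.
move=> k; rewrite /div_sin decayN opprK -mulrN -sumrN; congr (_ * _); apply: eq_bigr => i _.
by rewrite mxE rmorphN fcosN mulNr opprK.
Qed.

Lemma fcos_div_semigroup nu t V k : 0 < nu * t -> cper_field V ->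
  fcos (div_semigroup nu t V) k = div_cos (nu * t) V k.
Proof.
move=> c0 cV; rewrite div_semigroupE// fcos_tseries//; first exact: tsummable_div.
exact: even_div_cos.
Qed.

Lemma fsin_div_semigroup nu t V k : 0 < nu * t -> cper_field V ->
  fsin (div_semigroup nu t V) k = div_sin (nu * t) V k.
Proof.
move=> c0 cV; rewrite div_semigroupE// fsin_tseries//; first exact: tsummable_div.
exact: odd_div_sin.
Qed.

Lemma cper_div_semigroup nu t V : 0 < nu * t -> cper_field V -> cper (div_semigroup nu t V).
Proof. by move=> c0 cV; rewrite div_semigroupE//; apply: cper_tseries; exact: tsummable_div. Qed.

(** With y = |k|^2 c^(1/2) this reads y e^(-2 y^2) <= 1: the gain of one derivative from the
    semigroup, whatever the frequency. *)
Lemma freq_sq_decay c k : 0 < c -> freq_sq R k * decay c k ^+ 2 <= (Num.sqrt c)^-1.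
Proof.
move=> c0; have s0 := freq_sq_ge0 R k; set s := freq_sq R k in s0 *.
have q0 : 0 < Num.sqrt c by rewrite sqrtr_gt0.
have qc : Num.sqrt c ^+ 2 = c by rewrite sqr_sqrtr// ltW.
set q := Num.sqrt c in q0 qc *.
have -> : decay c k ^+ 2 = expR (- (2 * (s * q) ^+ 2)).
  by rewrite /decay -expRM_natl -/s -qc; congr expR; ring.
rewrite -[leRHS]mul1r ler_pdivlMr// mulrAC.
set y := s * q; have y0 : 0 <= y by rewrite mulr_ge0 ?(ltW q0).
rewrite expRN ler_pdivrMr ?expR_gt0// mul1r.
have := expR_ge1Dx (2 * y ^+ 2); have := sqr_ge0 (y - 1); nra.
Qed.

Lemma div_coef_sqr_le c V k : (div_cos c V k) ^+ 2 + (div_sin c V k) ^+ 2 <=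
  freq_sq R k * decay c k ^+ 2 *
  \sum_i (fcos (fun y => V y 0 i) k ^+ 2 + fsin (fun y => V y 0 i) k ^+ 2).
Proof.
rewrite big_split/=.
have := cauchy_schwarz_sum (fun i => (k 0 i)%:~R) (fun i => fsin (fun y => V y 0 i) k).
have := cauchy_schwarz_sum (fun i => (k 0 i)%:~R) (fun i => fcos (fun y => V y 0 i) k).
rewrite /div_cos /div_sin -/(freq_sq R k); set s := freq_sq R k.
set X := \sum_i _; set FX := \sum_i _; set Y := \sum_i _; set FY := \sum_i _ => hX hY.
have -> : (decay c k * Y) ^+ 2 + (- (decay c k * X)) ^+ 2 = decay c k ^+ 2 * (X ^+ 2 + Y ^+ 2) by ring.
have -> : s * decay c k ^+ 2 * (FX + FY) = decay c k ^+ 2 * (s * FX + s * FY) by ring.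
by apply: ler_wpM2l; [rewrite exprn_ge0 ?decay_ge0|exact: lerD].
Qed.

(** Smoothing in the mean square: Bessel's inequality reduces it to the maximum of the
    multiplier. *)
Lemma avg_div_semigroup_sqr nu t V : 0 < nu * t -> cper_field V ->
  avg (fun x => div_semigroup nu t V x ^+ 2) <=
  (Num.sqrt (nu * t))^-1 * \sum_i avg (fun x => V x 0 i ^+ 2).
Proof.
move=> c0 cV; rewrite div_semigroupE//; apply: avg_tseries_sqr => [|||N].
- exact: tsummable_div.
- exact: even_div_cos.
- exact: odd_div_sin.
apply: (@le_trans _ _ (\sum_(k <- fbox d N) (Num.sqrt (nu * t))^-1 *
    \sum_i (fcos (fun y => V y 0 i) k ^+ 2 + fsin (fun y => V y 0 i) k ^+ 2))).
  apply: ler_sum => k _; apply: le_trans (div_coef_sqr_le _ _ _) _.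
  rewrite ler_wpM2r ?freq_sq_decay// sumr_ge0// => i _.
  by rewrite addr_ge0 ?sqr_ge0.
rewrite -mulr_sumr exchange_big/= ler_wpM2l ?invr_ge0 ?sqrtr_ge0//.
by apply: ler_sum => i _; exact: bessel.
Qed.

(** The sup norm bounds all coefficients and the multiplier is summable, so that C depends
    on c alone. *)
Lemma div_semigroup_lip c : 0 < c -> exists2 C, 0 <= C & forall nu t V W del,
  nu * t = c -> 0 <= del -> cper_field V -> cper_field W ->
  (forall x i, `|V x 0 i - W x 0 i| <= del) ->
  forall x, `|div_semigroup nu t V x - div_semigroup nu t W x| <= C * del.
Proof.
move=> c0.
have sw := box_summableZ (2 * d%:R) (biharmonic_summable (R := R) d 1 c0).
have [C HC] := sw; exists `|C| => // nu t V W del tc d0 cV cW VW x.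
have H (F : 'I_d -> R) k : (forall i, `|F i| <= del) ->
    `|\sum_i (k 0 i)%:~R * F i| <= (1 + freq_sq R k) * (d%:R * del).
  move=> HF; rewrite (le_trans (ler_norm_sum _ _ _))//.
  have -> : d%:R * del = \sum_(i < d) del by rewrite sumr_const card_ord mulr_natl.
  rewrite mulr_sumr; apply: ler_sum => i _.
  by rewrite normrM ler_pM// freq_coord_le.
have Hc k : `|div_cos c V k - div_cos c W k| <= decay c k * ((1 + freq_sq R k) * (d%:R * del)).
  rewrite /div_cos -mulrBr normrM (ger0_norm (decay_ge0 _ _)) ler_wpM2l ?decay_ge0//.
  rewrite -sumrB; under eq_bigr do rewrite -mulrBr.
  by apply: H => i; rewrite -fsinB//; apply: fsin_bound => //; exact: cperB.
have Hs k : `|div_sin c V k - div_sin c W k| <= decay c k * ((1 + freq_sq R k) * (d%:R * del)).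
  rewrite /div_sin -opprD -mulrBr normrN normrM (ger0_norm (decay_ge0 _ _)) ler_wpM2l ?decay_ge0//.
  rewrite -sumrB; under eq_bigr do rewrite -mulrBr.
  by apply: H => i; rewrite -fcosB//; apply: fcos_bound => //; exact: cperB.
rewrite !div_semigroupE ?tc// !tseriesE.
have sV := tterm_summable x (tsummable_div c0 cV).
have sW := tterm_summable x (tsummable_div c0 cW).
rewrite -mulN1r -lim_bsumZ// -lim_bsumD//; last exact: box_summableZ.
apply: (@lim_bsum_bound _ _ _ (fun k => del * (2 * d%:R * ((1 + freq_sq R k) ^+ 1 * decay c k)))).
  move=> k /=.
  have -> : div_cos c V k * cos (freq_dot k x) + div_sin c V k * sin (freq_dot k x) +
    -1 * (div_cos c W k * cos (freq_dot k x) + div_sin c W k * sin (freq_dot k x)) =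
    (div_cos c V k - div_cos c W k) * cos (freq_dot k x) +
    (div_sin c V k - div_sin c W k) * sin (freq_dot k x) by ring.
  apply: (le_trans (ler_normD _ _)); rewrite !normrM.
  have -> : del * (2 * d%:R * ((1 + freq_sq R k) ^+ 1 * decay c k)) =
    decay c k * ((1 + freq_sq R k) * (d%:R * del)) * 1 +
    decay c k * ((1 + freq_sq R k) * (d%:R * del)) * 1 by ring.
  by apply: lerD; apply: ler_pM; rewrite ?cos_max ?sin_max.
move=> N; rewrite /bsum -mulr_sumr mulrC.
rewrite ler_wpM2r// (le_trans _ (ler_norm C))//; apply: le_trans (HC N).
by apply: ler_sum => k _; exact: ler_norm.
Qed.

End semigroup_bounds.

Section tp_calculus.
Variables (R : realType) (d : nat).
Local Notation vec := 'rV[R]_d.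
Local Notation freq := 'rV[int]_d.
Implicit Types (k l : freq) (x y : vec) (e c nu t : R) (p : seq (R * R * freq)).

Definition tp_deriv (i : 'I_d) p : seq (R * R * freq) :=
  [seq ((q.2 0 i)%:~R * q.1.2, - ((q.2 0 i)%:~R * q.1.1), q.2) |
    q : R * R * freq <- p].

Lemma is_derive_tp p x i : is_derive x ('e_i : vec) (tp p) (tp (tp_deriv i p) x).
Proof.
apply: (@quadratic_is_derive _ _ _ _ _ _
  (\sum_(q <- p) 2 * (`|q.1.1| + `|q.1.2|) * (((q.2 : freq) 0 i)%:~R) ^+ 2)) => h.
rewrite /tp big_map mulr_sumr -!sumrB mulr_suml.
rewrite (le_trans (ler_norm_sum _ _ _))//; apply: ler_sum => -[[a b] k] _ /=.
rewrite freq_dotDr freq_dotZr freq_dot_delta.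
have := trig_taylor a b (freq_dot k x) (h * (k 0 i)%:~R).
have -> : 2 * (`|a| + `|b|) * (h * (k 0 i)%:~R) ^+ 2 =
  2 * (`|a| + `|b|) * (k 0 i)%:~R ^+ 2 * h ^+ 2 by ring.
by congr (`| _ | <= _); ring.
Qed.

Lemma div_semigroup_tp nu t (p : 'I_d -> seq (R * R * freq)) x :
  div_semigroup nu t (fun z => \row_i tp (p i) z) x =
  \sum_i tp (tp_deriv i (tp_mult (decay (nu * t)) (p i))) x.
Proof.
rewrite /div_semigroup /div; apply: eq_bigr => i _; rewrite /partial.
have -> : (fun y : vec => (\row_i0 bilaplacian_semigroup nu t
    (fun z => (\row_i1 tp (p i1) z) 0 i0) y) 0 i) = tp (tp_mult (decay (nu * t)) (p i)).
  apply/funext => y; rewrite mxE.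
  under [X in bilaplacian_semigroup _ _ X]eq_fun do rewrite mxE.
  by apply: fourier_multiplier_tp => k; exact: decayN.
by have h := is_derive_tp (tp_mult (decay (nu * t)) (p i)) x i; rewrite derive_val.
Qed.

End tp_calculus.

(** * Fourier coefficients of derivatives *)
Section integration_by_parts.
Variables (R : realType) (d : nat).
Local Notation vec := 'rV[R]_d.
Local Notation freq := 'rV[int]_d.
Implicit Types (k l : freq) (x y : vec) (e c : R) (f g : vec -> R).

Lemma cper_shift a f : cper f -> cper (fun x => f (x + a)).
Proof.
move=> cpf; split=> [x|x k]; last by rewrite addrAC cpf.2.
apply/(@cvgrPdist_lt _ _ _ (nbhs x)) => e e0.
have [r r0 Hr] := cper_unif cpf e0.
apply/nbhs_ballP; exists r => // y [_ xy]; apply: Hr => i.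
by rewrite !mxE opprD addrACA subrr addr0; exact: xy.
Qed.

(** Evident for trigonometric polynomials, whose mean is their zero mode; uniform density
    does the rest. *)
Lemma avg_shift a f : cper f -> avg (fun x => f (x + a)) = avg f.
Proof.
move=> cf; apply/eqP; rewrite -subr_eq0 -normr_le0.
apply/ler_addgt0Pl => e e0; rewrite addr0.
have e2 : 0 < e / 2 by rewrite divr_gt0.
have [p Hp] := fejer_density cf e2.
have ct := @cper_tp R d p.
have T : avg (fun x => tp p (x + a)) = avg (tp p).
  have cc := @cper_cos R d; have cs := @cper_sin R d.
  rewrite /tp avg_sum => [|q]; last first.
    by apply: (@cper_shift a (fun x => q.1.1 * cos (freq_dot q.2 x) + q.1.2 * sin (freq_dot q.2 x)));
      apply: cperD; exact: cperZ.
  rewrite avg_sum => [|q]; last by apply: cperD; exact: cperZ.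
  apply: eq_bigr => -[[b c] k] _ /=.
  rewrite [RHS]avgD; [|exact: cperZ|exact: cperZ].
  rewrite !avgZ// avg_sin mulr0 addr0.
  pose A := b * cos (freq_dot k a) + c * sin (freq_dot k a).
  pose B := c * cos (freq_dot k a) - b * sin (freq_dot k a).
  have -> : (fun x => b * cos (freq_dot k (x + a)) + c * sin (freq_dot k (x + a))) =
      (fun x => A * cos (freq_dot k x) + B * sin (freq_dot k x)).
    by apply/funext => x; rewrite /A /B freq_dotDr cosD sinD; ring.
  rewrite avgD; [|exact: cperZ|exact: cperZ]; rewrite !avgZ// avg_sin mulr0 addr0.
  rewrite avg_cos; case: eqP => [k0|_]; last by rewrite !mulr0.
  by rewrite /A k0 freq_dot0l cos0 sin0 /=; ring.
have cfa := cper_shift a cf; have cta := cper_shift a ct.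
have -> : avg (fun x => f (x + a)) - avg f =
    avg (fun x => f (x + a) - tp p (x + a)) - avg (fun x => f x - tp p x).
  by rewrite !avgB// T; ring.
rewrite (le_trans (ler_normB _ _))// (splitr e) lerD//; apply: avg_bound => //; exact: cperB.
Qed.

Lemma derivable_line f x (i : 'I_d) (s : R) :
  derivable f (x + s *: 'e_i) 'e_i ->
  is_derive s (1 : R) (fun u => f (x + u *: 'e_i)) (partial i f (x + s *: 'e_i)).
Proof.
move=> df.
have E : (fun h : R => h^-1 *: (((fun u => f (x + u *: 'e_i)) \o shift s) (h *: (1 : R)) -
      f (x + s *: 'e_i))) =
    (fun h : R => h^-1 *: ((f \o shift (x + s *: 'e_i)) (h *: 'e_i) - f (x + s *: 'e_i))).
  apply/funext => h; congr (_ *: (f _ - _)).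
  by rewrite /= [h *: (1 : R)]mulr1 scalerDl addrCA.
split; first by rewrite /derivable E.
by rewrite /derive E.
Qed.

Lemma partial_mean_value f x (i : 'I_d) (h : R) : 0 < h ->
  (forall y, derivable f y 'e_i) ->
  exists2 s, 0 < s < h & f (x + h *: 'e_i) - f x = partial i f (x + s *: 'e_i) * h.
Proof.
move=> h0 df.
have D s : is_derive s (1 : R) (fun u => f (x + u *: 'e_i)) (partial i f (x + s *: 'e_i)).
  exact: derivable_line.
have [|s sh] := @MVT R (fun u => f (x + u *: 'e_i)) (fun s => partial i f (x + s *: 'e_i)) 0 h h0
    (fun s _ => D s).
  apply: continuous_subspaceT => s; apply: differentiable_continuous.
  by apply/derivable1_diffP; case: (D s).
by rewrite scale0r addr0 subr0 => E; exists s.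
Qed.

(** The difference quotients have mean zero by translation invariance, and converge uniformly by
    the mean value theorem. *)
Lemma avg_partial f i : cper f -> (forall x, derivable f x 'e_i) -> cper (partial i f) ->
  avg (partial i f) = 0.
Proof.
move=> cf df cpf; apply/eqP; rewrite -normr_le0.
apply/ler_addgt0Pl => e e0; rewrite addr0.
have [r r0 Hr] := cper_unif cpf e0.
pose h := r / 2; have h0 : 0 < h by rewrite divr_gt0.
have cfh := cper_shift (h *: 'e_i) cf.
pose q x := h^-1 * (f (x + h *: 'e_i) - f x).
have cq : cper q by apply: cperZ; exact: cperB.
have q0 : avg q = 0 by rewrite avgZ ?avgB ?avg_shift ?subrr ?mulr0//; exact: cperB.
rewrite -[avg (partial i f)]subr0 -q0 -avgB//; apply: avg_bound => [|x]; first exact: cperB.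
have [s /andP[s0 sh]] := partial_mean_value x h0 df.
rewrite /q => ->; rewrite mulrCA mulVf ?mulr1 ?gt_eqF//.
apply/ltW/Hr => j; rewrite !mxE /=.
case: eqP => _ /=; last by rewrite mulr0 addr0 subrr normr0.
rewrite mulr1 opprD addrA subrr sub0r normrN gtr0_norm//.
by apply: lt_trans sh _; rewrite /h; lra.
Qed.

Lemma partial_mul f g i x : derivable f x 'e_i -> derivable g x 'e_i ->
  partial i (fun y => f y * g y) x = f x * partial i g x + g x * partial i f x.
Proof. by move=> df dg; rewrite /partial -[LHS]/('D_'e_i (f * g) x) deriveM. Qed.

Lemma cos_freqE k : (fun x => cos (freq_dot k x)) = tp [:: (1 : R, 0, k)].
Proof. by apply/funext => x; rewrite /tp big_seq1 /= mul1r mul0r addr0. Qed.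

Lemma sin_freqE k : (fun x => sin (freq_dot k x)) = tp [:: (0, 1 : R, k)].
Proof. by apply/funext => x; rewrite /tp big_seq1 /= mul1r mul0r add0r. Qed.

Lemma partial_cos k i x :
  partial i (fun x => cos (freq_dot k x)) x = - ((k 0 i)%:~R * sin (freq_dot k x)).
Proof.
rewrite /partial cos_freqE; have h := is_derive_tp [:: (1 : R, 0, k)] x i.
by rewrite derive_val /tp big_seq1 /=; ring.
Qed.

Lemma partial_sin k i x :
  partial i (fun x => sin (freq_dot k x)) x = (k 0 i)%:~R * cos (freq_dot k x).
Proof.
rewrite /partial sin_freqE; have h := is_derive_tp [:: (0, 1 : R, k)] x i.
by rewrite derive_val /tp big_seq1 /=; ring.
Qed.

(** Integration by parts: the mean of the derivative of f cos(k.x) vanishes. *)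
Lemma fcos_partial f i k : cper f -> (forall x, derivable f x 'e_i) -> cper (partial i f) ->
  fcos (partial i f) k = (k 0 i)%:~R * fsin f k.
Proof.
move=> cf df cpf; have cc := @cper_cos R d k; have cs := @cper_sin R d k.
have dc x : derivable (fun x => cos (freq_dot k x) : R) x 'e_i.
  by rewrite cos_freqE; have [] := is_derive_tp [:: (1 : R, 0, k)] x i.
have E : partial i (fun x => f x * cos (freq_dot k x)) = (fun x =>
    partial i f x * cos (freq_dot k x) - (k 0 i)%:~R * (f x * sin (freq_dot k x))).
  by apply/funext => x; rewrite partial_mul// partial_cos; ring.
have c1 := cperM cpf cc; have c2 := cperM cf cs.
have cE : cper (partial i (fun x => f x * cos (freq_dot k x))).
  by rewrite E; apply: cperB => //; exact: cperZ.
have := avg_partial (cperM cf cc) _ cE.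
rewrite E avgB ?avgZ//; last exact: cperZ.
by move=> H; apply/eqP; rewrite -subr_eq0; apply/eqP/H => x; exact: derivableM.
Qed.

Lemma fsin_partial f i k : cper f -> (forall x, derivable f x 'e_i) -> cper (partial i f) ->
  fsin (partial i f) k = - ((k 0 i)%:~R * fcos f k).
Proof.
move=> cf df cpf; have cc := @cper_cos R d k; have cs := @cper_sin R d k.
have dc x : derivable (fun x => sin (freq_dot k x) : R) x 'e_i.
  by rewrite sin_freqE; have [] := is_derive_tp [:: (0, 1 : R, k)] x i.
have E : partial i (fun x => f x * sin (freq_dot k x)) = (fun x =>
    partial i f x * sin (freq_dot k x) + (k 0 i)%:~R * (f x * cos (freq_dot k x))).
  by apply/funext => x; rewrite partial_mul// partial_sin; ring.
have c1 := cperM cpf cs; have c2 := cperM cf cc.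
have cE : cper (partial i (fun x => f x * sin (freq_dot k x))).
  by rewrite E; apply: cperD => //; exact: cperZ.
have := avg_partial (cperM cf cs) _ cE.
rewrite E avgD ?avgZ//; last exact: cperZ.
by move=> H; apply/eqP; rewrite -addr_eq0; apply/eqP/H => x; exact: derivableM.
Qed.

End integration_by_parts.

(** * Singular integrals in time *)
Section improper_integrals.
Variable R : realType.
Implicit Types (a b c t C : R) (f g F : R -> R).
Local Notation mu := (@lebesgue_measure R).

Lemma measurable_open_itv a b f : (forall x, a < x < b -> {for x, continuous f}) ->
  measurable_fun `]a, b[ f.
Proof.
move=> cf; apply: open_continuous_measurable_fun; first exact: interval_open.
by move=> x; rewrite inE /= in_itv /=; exact: cf.
Qed.

(** Integrands with integrable singularities at both ends: it suffices to bound the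
    increments of an antiderivative in the open interval. *)
Lemma antiderivative_integral_le a b C f F :
  (forall x, a < x < b -> 0 <= f x) ->
  (forall x, a < x < b -> is_derive x (1 : R) F (f x)) ->
  (forall x, a < x < b -> {for x, continuous f}) ->
  (forall x y, a < x -> x < y -> y < b -> F y - F x <= C) -> 0 <= C ->
  (\int[mu]_(x in `]a, b[) (f x)%:E <= C%:E)%E.
Proof.
move=> f0 dF cf FC C0; have mf := measurable_open_itv cf.
pose r n : R := n.+1%:R^-1.
have r0 n : 0 < r n by rewrite invr_gt0.
have rn m n : (m <= n)%N -> r n <= r m by move=> mn; rewrite lef_pV2 ?posrE// ler_nat.
pose I n : set R := [set` `]a + r n, b - r n[].
have sI n : I n `<=` `]a, b[.
  by move=> x; rewrite /I /= !in_itv/=; have := r0 n; lra.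
have U : [set` `]a, b[] = \bigcup_n I n :> set R.
  apply/seteqP; split => [x /=|x [n _ /sI]//]; rewrite in_itv /= => /andP[ax xb].
  have m0 : 0 < Num.min (x - a) (b - x) by rewrite lt_min !subr_gt0 ax xb.
  have /cvgrPdist_lt/(_ _ m0)[N _ HN] := @cvg_harmonic R.
  have := HN N (leqnn N); rewrite /harmonic /= sub0r normrN gtr0_norm ?invr_gt0// lt_min => /andP[h1 h2].
  have h1' : r N < x - a := h1; have h2' : r N < b - x := h2.
  by exists N => //; rewrite /I /= in_itv /=; move: (r N) h1' h2' => q; lra.
have cv : (\int[mu]_(x in I i) (f x)%:E)%E @[i --> \oo] --> (\int[mu]_(x in \bigcup_n I n) (f x)%:E)%E.
  apply: ge0_nondecreasing_set_cvg_integral.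
  - move=> m n mn; apply/subsetPset => x; rewrite /I /= !in_itv/=; have := rn _ _ mn; lra.
  - by move=> n; exact: measurable_itv.
  - move=> n; apply/measurable_EFinP; apply: measurable_funS mf => //; exact: sI.
  - by move=> n x /sI /=; rewrite in_itv/= lee_fin => /f0.
rewrite U -(cvg_lim _ cv)//; apply: lime_le; first by apply/cvg_ex; eexists; exact: cv.
apply: nearW => n.
have [cd|dc] := ltP (a + r n) (b - r n); last first.
  by rewrite /I set_itv_ge ?integral_set0 ?lee_fin// bnd_simp -leNgt.
have rn0 := r0 n.
have abx x : x \in `[a + r n, b - r n] -> a < x < b by rewrite in_itv/=; lra.
apply: (@le_trans _ _ (\int[mu]_(x in `[(a + r n)%R, (b - r n)%R]) (f x)%:E)%E).
  apply: ge0_subset_integral => //.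
  - exact: measurable_itv.
  - apply/measurable_EFinP; apply: measurable_funS mf => // x /= /abx; by rewrite /= in_itv.
  - by move=> x /= /abx /f0; rewrite lee_fin.
  - by move=> x; rewrite /I /= !in_itv/=; lra.
have cF x : a < x < b -> {for x, continuous F}.
  by move=> /dF dFx; apply: differentiable_continuous; apply/derivable1_diffP.
rewrite (@continuous_FTC2 _ _ F)//.
- by rewrite -EFinB lee_fin; apply: FC; lra.
- by apply: continuous_in_subspaceT => x; rewrite inE /= => /abx/cf.
- split.
  + move=> x xI; have h : is_derive x (1 : R) F (f x).
      by apply: dF; apply: abx; move: xI; rewrite !in_itv/=; lra.
    exact: ex_derive.
  + by apply: cvg_at_right_filter; apply: cF; lra.
  + by apply: cvg_at_left_filter; apply: cF; lra.
- move=> x xI; rewrite derive1E; have h : is_derive x (1 : R) F (f x).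
    by apply: dF; apply: abx; move: xI; rewrite !in_itv/=; lra.
  exact: derive_val.
Qed.

Lemma antiderivative_integrable a b C f F :
  (forall x, a < x < b -> 0 <= f x) ->
  (forall x, a < x < b -> is_derive x (1 : R) F (f x)) ->
  (forall x, a < x < b -> {for x, continuous f}) ->
  (forall x y, a < x -> x < y -> y < b -> F y - F x <= C) -> 0 <= C ->
  mu.-integrable `]a, b[ (EFin \o f) /\ \int[mu]_(x in `]a, b[) f x <= C.
Proof.
move=> f0 dF cf FC C0; have H := antiderivative_integral_le f0 dF cf FC C0.
have mf := measurable_open_itv cf.
have nn : (0 <= \int[mu]_(x in `]a, b[) (f x)%:E)%E.
  by apply: integral_ge0 => x /=; rewrite in_itv/= lee_fin => /f0.
split; last by rewrite /Rintegral -lee_fin fineK// ge0_fin_numE// (le_lt_trans H)// ltry.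
apply/integrableP; split; first exact/measurable_EFinP.
apply: le_lt_trans (ltry C); apply: le_trans H; rewrite le_eqVlt; apply/orP; left; apply/eqP.
apply: eq_integral => x; rewrite inE /= in_itv/= => /f0 fx0.
by rewrite ger0_norm.
Qed.

Lemma powR_continuous (p x : R) : 0 < x -> {for x, continuous (fun s : R => s `^ p)}.
Proof.
move=> x0; have h := is_derive1_powR p x0.
by apply: differentiable_continuous; apply/derivable1_diffP.
Qed.

Lemma integral_powRN34 t : 0 < t ->
  mu.-integrable `]0, t[ (EFin \o (fun s : R => s `^ (- (3 / 4)))) /\
  \int[mu]_(s in `]0, t[) s `^ (- (3 / 4)) <= 4 * t `^ (1 / 4).
Proof.
move=> t0; apply: (@antiderivative_integrable _ _ _ _ (fun s => 4 * s `^ (1 / 4))).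
- by move=> x _; exact: powR_ge0.
- move=> x /andP[x0 _]; have h := is_derive1_powR (1 / 4) x0.
  have -> : x `^ (- (3 / 4)) = 4 *: (1 / 4 * x `^ (1 / 4 - 1)).
    have -> : 1 / 4 - 1 = - (3 / 4) :> R by field.
    by rewrite /GRing.scale /=; field.
  exact: is_deriveZ.
- by move=> x /andP[x0 _]; exact: powR_continuous.
- move=> x y x0 xy yt; rewrite -mulrBr ler_pM2l//.
  have := powR_ge0 x (1 / 4); have : y `^ (1 / 4) <= t `^ (1 / 4); last by lra.
  by rewrite ge0_ler_powR ?nnegrE; lra.
- by rewrite mulr_ge0 ?powR_ge0.
Qed.

Lemma integral_powRN14_reflected t : 0 < t ->
  mu.-integrable `]0, t[ (EFin \o (fun s : R => (t - s) `^ (- (1 / 4)))).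
Proof.
move=> t0; apply: (proj1 (@antiderivative_integrable 0 t (4 / 3 * t `^ (3 / 4)) _
  (fun s => - (4 / 3) * (t - s) `^ (3 / 4)) _ _ _ _ _)).
- by move=> x _; exact: powR_ge0.
- move=> x /andP[x0 xt]; have tx : 0 < t - x by lra.
  have h := is_derive1_powR (3 / 4) tx.
  have g : is_derive x (1 : R) (fun s : R => t - s) (- 1).
    have := is_derive_affine t (- 1) x.
    by under eq_fun do rewrite mulN1r.
  have -> : (t - x) `^ (- (1 / 4)) = - (4 / 3) *: (3 / 4 * (t - x) `^ (3 / 4 - 1) * -1).
    have -> : 3 / 4 - 1 = - (1 / 4) :> R by field.
    by rewrite /GRing.scale /=; field.
  exact: (is_deriveZ _ (@is_derive1_comp R (fun s => s `^ (3 / 4)) (fun s => t - s) x _ _ h g)).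
- move=> x /andP[x0 xt].
  apply: (@continuous_comp _ _ _ (fun s => t - s) (fun s => s `^ (- (1 / 4)))).
    by apply: cvgB; [exact: cvg_cst|exact: cvg_id].
  by apply: powR_continuous; lra.
- move=> x y x0 xy yt; have := powR_ge0 (t - y) (3 / 4).
  have : (t - x) `^ (3 / 4) <= t `^ (3 / 4) by rewrite ge0_ler_powR ?nnegrE; lra.
  lra.
- by rewrite mulr_ge0 ?powR_ge0//; lra.
Qed.

Lemma integral_expR t c : 0 < t -> 0 < c ->
  mu.-integrable `]0, t[ (EFin \o (fun s : R => expR (c * s))) /\
  \int[mu]_(s in `]0, t[) expR (c * s) <= expR (c * t) / c.
Proof.
move=> t0 c0.
have D x : is_derive x (1 : R) (fun s => c^-1 * expR (c * s)) (expR (c * x)).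
  have g := is_derive_affine 0 c x.
  have := is_deriveZ c^-1 (is_derive1_comp (is_derive_expR _) g); rewrite /GRing.scale /= add0r.
  have -> : c^-1 * (expR (c * x) * c) = expR (c * x) by field; lra.
  by under eq_fun do rewrite /= add0r.
apply: (@antiderivative_integrable _ _ _ _ (fun s => c^-1 * expR (c * s))).
- by move=> x _; exact: expR_ge0.
- move=> x _; apply: (@continuous_comp _ _ _ (fun s => c * s) expR).
    exact: mulrl_continuous.
  exact: continuous_expR.
- move=> x y x0 xy yt.
  have : c^-1 * expR (c * y) <= expR (c * t) / c.
    by rewrite mulrC ler_pM2r ?invr_gt0// ler_expR ler_pM2l//; lra.
  have : 0 <= c^-1 * expR (c * x) by rewrite mulr_ge0 ?expR_ge0// invr_ge0; lra.
  lra.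
- by rewrite divr_ge0 ?expR_ge0//; lra.
Qed.

End improper_integrals.

Section real_integrable.
Context dd (X : measurableType dd) (R : realType) (m : {measure set X -> \bar R}).
Variables (D : set X) (mD : measurable D).
Implicit Types u v : X -> R.

Lemma integrable_scale (l : R) u : m.-integrable D (EFin \o u) ->
  m.-integrable D (EFin \o (fun x => l * u x)).
Proof.
move=> iu; rewrite (_ : _ \o _ = (fun x => l%:E * (EFin \o u) x)%E).
  exact: integrableZl.
by apply/funext => x; rewrite /= EFinM.
Qed.

Lemma integrable_add u v : m.-integrable D (EFin \o u) -> m.-integrable D (EFin \o v) ->
  m.-integrable D (EFin \o (fun x => u x + v x)).
Proof.
move=> iu iv; rewrite (_ : _ \o _ = (fun x => (EFin \o u) x + (EFin \o v) x)%E).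
  exact: integrableD.
by apply/funext => x; rewrite /= EFinD.
Qed.

Lemma integrable_dominated u v : measurable_fun D u -> (forall x, D x -> `|u x| <= v x) ->
  m.-integrable D (EFin \o v) -> m.-integrable D (EFin \o u).
Proof.
move=> mu_ uv iv; apply: le_integrable iv => //; first exact/measurable_EFinP.
by move=> x Dx; rewrite lee_fin (le_trans (uv x Dx))// ler_norm.
Qed.

End real_integrable.

Section weighted_estimates.
Variable R : realType.
Implicit Types (a b c t nu : R).
Local Notation mu := (@lebesgue_measure R).

Lemma sqr_le_mul_of_young (I U V : R) : 0 <= U -> 0 <= V ->
  (forall l, 0 < l -> 2 * I <= l * U + V / l) -> 0 <= I -> I ^+ 2 <= U * V.
Proof.
move=> U0 V0 H; rewrite le_eqVlt => /orP[/eqP <-|I0].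
  by rewrite expr0n /= mulr_ge0.
apply/ler_addgt0Pl => e e0.
pose d := e / (V + 1); have d0 : 0 < d by rewrite divr_gt0// ltr_wpDl.
have Ud : 0 < U + d by rewrite ltr_wpDl.
have := H (I / (U + d)) (divr_gt0 I0 Ud).
have -> : V / (I / (U + d)) = V * (U + d) / I by field; lra.
have h : I / (U + d) * U <= I by rewrite mulrAC ler_pdivrMr// ler_wpM2l ?(ltW I0)//; lra.
move=> h2; have : I <= V * (U + d) / I by move: h h2; lra.
rewrite ler_pdivlMr// => h3.
have : V * d <= e.
  rewrite /d mulrCA ler_piMr ?(ltW e0)// ler_pdivrMr; lra.
by rewrite expr2; move: h3; lra.
Qed.

(** Young's inequality under the integral, optimised over its parameter. *)
Lemma Rintegral_cauchy_schwarz (D : set R) (u v w : R -> R) : measurable D ->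
  mu.-integrable D (EFin \o u) -> mu.-integrable D (EFin \o v) -> mu.-integrable D (EFin \o w) ->
  (forall x, D x -> 0 <= u x) -> (forall x, D x -> 0 <= v x) ->
  (forall x, D x -> w x ^+ 2 <= u x * v x) ->
  (\int[mu]_(x in D) w x) ^+ 2 <= (\int[mu]_(x in D) u x) * (\int[mu]_(x in D) v x).
Proof.
move=> mD iu iv iw u0 v0 wuv; rewrite -[leLHS]real_normK ?num_real//.
apply: sqr_le_mul_of_young => //; [exact: Rintegral_ge0|exact: Rintegral_ge0|move=> l l0].
have i1 : mu.-integrable D (EFin \o (fun x => l * u x)) by exact: integrable_scale.
have i2 : mu.-integrable D (EFin \o (fun x => l^-1 * v x)) by exact: integrable_scale.
have i3 : mu.-integrable D (EFin \o (fun x => l * u x + l^-1 * v x)) by exact: integrable_add.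
have i4 : mu.-integrable D (EFin \o (fun x => `|w x|)) by exact: integrable_norm.
have i5 : mu.-integrable D (EFin \o (fun x => 2 * `|w x|)) by exact: integrable_scale.
apply: (@le_trans _ _ (2 * \int[mu]_(x in D) `|w x|)).
  by rewrite ler_pM2l// le_normr_Rintegral.
have -> : l * (\int[mu]_(x in D) u x) + (\int[mu]_(x in D) v x) / l =
    \int[mu]_(x in D) (l * u x + l^-1 * v x).
  by rewrite RintegralD// !RintegralZl// [_ / l]mulrC.
rewrite -RintegralZl//; apply: le_Rintegral => // x Dx.
have := wuv x Dx; have := u0 x Dx; have := v0 x Dx.
rewrite -[w x ^+ 2]real_normK ?num_real//.
have := normr_ge0 (w x); move: `|w x| (u x) (v x) => W U V W0 V0 U0 h.
have : 0 <= (l * U + l^-1 * V) by rewrite addr_ge0 ?mulr_ge0 ?invr_ge0// ltW.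
have : (2 * W) ^+ 2 <= (l * U + l^-1 * V) ^+ 2.
  have -> : (l * U + l^-1 * V) ^+ 2 = (l * U - l^-1 * V) ^+ 2 + 4 * (U * V) by field; lra.
  have := sqr_ge0 (l * U - l^-1 * V); lra.
move=> h1 h2; rewrite -(ler_pXn2r (n := 2)) ?nnegrE//; lra.
Qed.

(** Uniformly in the frequency: the exponential factor has the same singular mass whatever
    its rate, which is what makes the mode by mode estimate summable. *)
Lemma singular_kernel_le nu t (q : R) : 0 < nu -> 0 < t ->
  mu.-integrable `]0, t[ (EFin \o (fun s : R =>
    q ^+ 2 * expR (- (nu * (t - s) * q ^+ 2)) ^+ 2 * s `^ (- (3 / 4)))) /\
  \int[mu]_(s in `]0, t[) (q ^+ 2 * expR (- (nu * (t - s) * q ^+ 2)) ^+ 2 * s `^ (- (3 / 4))) <=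
    6 / nu * t `^ (- (3 / 4)).
Proof.
move=> nu0 t0; pose E s := expR (- (nu * (t - s) * q ^+ 2)).
have tp0 : 0 < t `^ (- (3 / 4)) by rewrite powR_gt0.
have [ip Ip] := integral_powRN34 t0.
have DE s : is_derive s (1 : R) (fun s => (2 * nu)^-1 * expR (2 * nu * q ^+ 2 * s - 2 * nu * t * q ^+ 2)) (q ^+ 2 * E s ^+ 2).
  have g := is_derive_affine (- (2 * nu * t * q ^+ 2)) (2 * nu * q ^+ 2) s.
  have H := is_deriveZ (2 * nu)^-1 (is_derive1_comp (is_derive_expR _) g).
  have -> : q ^+ 2 * E s ^+ 2 = (2 * nu)^-1 *: (expR (- (2 * nu * t * q ^+ 2) + 2 * nu * q ^+ 2 * s) * (2 * nu * q ^+ 2)).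
    rewrite /E -expRM_natl /GRing.scale /=.
    have -> : 2 * - (nu * (t - s) * q ^+ 2) = - (2 * nu * t * q ^+ 2) + 2 * nu * q ^+ 2 * s by ring.
    by field; lra.
  by under eq_fun do rewrite addrC; exact: H.
have cE s : {for s, continuous (fun s => q ^+ 2 * E s ^+ 2)}.
  have -> : (fun s => q ^+ 2 * E s ^+ 2) =
      (fun s => q ^+ 2 * expR (2 * nu * q ^+ 2 * s - 2 * nu * t * q ^+ 2)).
    by apply/funext => z; rewrite /E -expRM_natl; congr (_ * expR _); ring.
  apply: cvgMr; apply: (@continuous_comp _ _ _ (fun s => 2 * nu * q ^+ 2 * s - 2 * nu * t * q ^+ 2) expR).
    by apply: cvgB; [exact: mulrl_continuous|exact: cvg_cst].
  exact: continuous_expR.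
have [iE IE] : mu.-integrable `]0, t[ (EFin \o (fun s => q ^+ 2 * E s ^+ 2)) /\
    \int[mu]_(s in `]0, t[) (q ^+ 2 * E s ^+ 2) <= (2 * nu)^-1.
  apply: (@antiderivative_integrable _ _ _ _ _
    (fun s => (2 * nu)^-1 * expR (2 * nu * q ^+ 2 * s - 2 * nu * t * q ^+ 2))).
  - by move=> s _; rewrite mulr_ge0 ?sqr_ge0.
  - by move=> s _; exact: cE.
  - move=> x y x0 xy yt.
    have h1 : expR (2 * nu * q ^+ 2 * y - 2 * nu * t * q ^+ 2) <= 1.
      rewrite -[leRHS]expR0 ler_expR.
      have -> : 2 * nu * q ^+ 2 * y - 2 * nu * t * q ^+ 2 = - (2 * nu * (q ^+ 2 * (t - y))) by ring.
      by rewrite oppr_le0; apply: mulr_ge0; [lra|apply: mulr_ge0; [exact: sqr_ge0|lra]].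
    have h2 := expR_ge0 (2 * nu * q ^+ 2 * x - 2 * nu * t * q ^+ 2).
    rewrite -mulrBr -[leRHS]mulr1; apply: ler_wpM2l; first by rewrite invr_ge0; lra.
    by move: (expR _) (expR _) h1 h2 => A B; lra.
  - by rewrite invr_ge0; lra.
pose b s := (nu * t)^-1 * s `^ (- (3 / 4)) + 2 * t `^ (- (3 / 4)) * (q ^+ 2 * E s ^+ 2).
have mD : measurable [set` `]0 : R, t[] by exact: measurable_itv.
have ib : mu.-integrable `]0, t[ (EFin \o b).
  by apply: integrable_add => //; exact: integrable_scale.
have pw s : 0 < s < t -> q ^+ 2 * E s ^+ 2 * s `^ (- (3 / 4)) <= b s.
  move=> /andP[s0 st]; have sp := powR_ge0 s (- (3 / 4)).
  have e0 : 0 <= q ^+ 2 * E s ^+ 2 by rewrite mulr_ge0 ?sqr_ge0.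
  rewrite /b; have [h|h] := leP s (t / 2).
    have : q ^+ 2 * E s ^+ 2 <= (nu * t)^-1.
      have q0 := sqr_ge0 q; rewrite /E -expRM_natl.
      have : expR (2 * - (nu * (t - s) * q ^+ 2)) <= expR (- (nu * t * q ^+ 2)).
        rewrite ler_expR mulrN lerN2.
        have -> : 2 * (nu * (t - s) * q ^+ 2) = nu * (2 * (t - s)) * q ^+ 2 by ring.
        by rewrite ler_wpM2r// ler_wpM2l ?(ltW nu0)//; lra.
      move=> /(ler_wpM2l q0)/le_trans; apply.
      rewrite -[leRHS]mul1r ler_pdivlMr ?mulr_gt0// expRN mulrAC ler_pdivrMr ?expR_gt0// mul1r.
      by have := expR_ge1Dx (nu * t * q ^+ 2); lra.
    move=> /(ler_wpM2r sp)/le_trans; apply; rewrite lerDl.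
    by rewrite mulr_ge0// mulr_ge0// ltW.
  have : s `^ (- (3 / 4)) <= 2 * t `^ (- (3 / 4)).
    apply: (@le_trans _ _ ((t / 2) `^ (- (3 / 4)))).
      rewrite !powRN lef_pV2 ?posrE ?powR_gt0//; last by lra.
      by rewrite ge0_ler_powR ?nnegrE//; lra.
    rewrite powRM; [|lra|lra]; rewrite mulrC ler_wpM2r ?(ltW tp0)//.
    rewrite -[2^-1]powR_inv1 ?ler0n// -powRrM.
    apply: (@le_trans _ _ (2 `^ 1)); last by rewrite powRr1.
    by rewrite ler_powR//; lra.
  move=> /(ler_wpM2l e0)/le_trans; apply; rewrite [leRHS]addrC mulrC lerDl.
  by rewrite mulr_ge0// invr_ge0 mulr_ge0 ?ltW.
have f0 s : 0 < s < t -> 0 <= q ^+ 2 * E s ^+ 2 * s `^ (- (3 / 4)).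
  by move=> _; rewrite mulr_ge0 ?powR_ge0// mulr_ge0 ?sqr_ge0.
have if_ : mu.-integrable `]0, t[ (EFin \o (fun s : R => q ^+ 2 * E s ^+ 2 * s `^ (- (3 / 4)))).
  apply: integrable_dominated ib => //.
    apply: measurable_open_itv => s /andP[s0 st].
    by apply: cvgM; [exact: cE|exact: powR_continuous].
  by move=> s /=; rewrite in_itv/= => st; rewrite ger0_norm ?pw ?f0.
split=> //.
apply: (@le_trans _ _ (\int[mu]_(s in `]0, t[) b s)).
  by apply: le_Rintegral => // s /=; rewrite in_itv/=; exact: pw.
rewrite RintegralD//; [|exact: integrable_scale|exact: integrable_scale].
rewrite [X in X + _ <= _]RintegralZl// [X in _ + X <= _]RintegralZl//.
have h1 : (nu * t)^-1 * (\int[mu]_(s in `]0, t[) s `^ (- (3 / 4))) <= 4 / nu * t `^ (- (3 / 4)).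
  apply: (@le_trans _ _ ((nu * t)^-1 * (4 * t `^ (1 / 4)))).
    by rewrite ler_wpM2l// invr_ge0 mulr_ge0 ?ltW.
  have -> : 1 / 4 = 1 + - (3 / 4) :> R by field.
  rewrite powRD; last by apply/implyP => _; rewrite gt_eqF.
  by rewrite powRr1 ?(ltW t0)// le_eqVlt; apply/orP; left; apply/eqP; field; lra.
have h2 : 2 * t `^ (- (3 / 4)) * (\int[mu]_(s in `]0, t[) (q ^+ 2 * E s ^+ 2)) <= nu^-1 * t `^ (- (3 / 4)).
  have -> : nu^-1 * t `^ (- (3 / 4)) = 2 * t `^ (- (3 / 4)) * (2 * nu)^-1 by field; lra.
  by rewrite ler_wpM2l// mulr_ge0// ltW.
have h3 : 0 <= nu^-1 * t `^ (- (3 / 4)) by rewrite mulr_ge0 ?invr_ge0 ?ltW.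
apply: le_trans (lerD h1 h2) _.
rewrite (_ : 6 / nu = 4 / nu + nu^-1 + nu^-1); last by field; lra.
by rewrite [leRHS]mulrDl [X in _ <= X + _]mulrDl; move: h3; lra.
Qed.

End weighted_estimates.

(** * Fubini for Duhamel integrals *)
Section duhamel_pairing.
Variables (R : realType) (d : nat).
Local Notation vec := 'rV[R]_d.
Local Notation freq := 'rV[int]_d.
Local Notation mu := (@lebesgue_measure R).
Local Notation nuT := (torus_measure R d).
Local Notation T := (measurableTypeR R).

Lemma avg_le_sqrt (f : vec -> R) (b : R) : cper f -> 0 < b ->
  avg (fun x => f x ^+ 2) <= b ^+ 2 -> avg (fun x => `|f x|) <= b.
Proof.
move=> cf b0 H; have cs := cper_sqr cf; have cn := cper_norm cf.
have : avg (fun x => `|f x|) <= avg (fun x => (2 * b)^-1 * f x ^+ 2 + b / 2).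
  apply: avg_le => //; first by apply: cperD; [exact: cperZ|exact: cper_cst].
  move=> x; rewrite -real_normK ?num_real//; set u := `|f x|.
  have -> : (2 * b)^-1 * u ^+ 2 + b / 2 = u + (2 * b)^-1 * (u - b) ^+ 2 by field; lra.
  by rewrite lerDl mulr_ge0 ?sqr_ge0// invr_ge0; lra.
rewrite avgD; [|exact: cperZ|exact: cper_cst]; rewrite (avgZ _ cs) avg_cst => /le_trans; apply.
have : (2 * b)^-1 * avg (fun x => f x ^+ 2) <= (2 * b)^-1 * b ^+ 2.
  by rewrite ler_wpM2l// invr_ge0; lra.
have -> : (2 * b)^-1 * b ^+ 2 = b / 2 by field; lra.
lra.
Qed.

(** Fubini for a Duhamel integral tested against a fixed function: the only quantitative
    input is a bound for the mean of the integrand at each time. *)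
Lemma duhamel_pairing (t : R) (G : R -> vec -> R) (be : R -> R) (u phi : vec -> R) :
  (forall s, 0 < s < t -> cper (G s)) ->
  measurable_fun setT (fun z : T * d.-tuple T =>
    if 0 < z.1 < t then G z.1 (row_of_tuple z.2) else 0) ->
  (forall s, 0 < s < t -> avg (fun x => `|G s x|) <= be s) ->
  mu.-integrable `]0, t[ (EFin \o be) ->
  cper phi -> (forall x, `|phi x| <= 1) -> cper u ->
  (forall x, u x = \int[mu]_(s in `]0, t[) G s x) ->
  mu.-integrable `]0, t[ (EFin \o (fun s => avg (fun x => G s x * phi x))) /\
  avg (fun x => u x * phi x) = \int[mu]_(s in `]0, t[) avg (fun x => G s x * phi x).
Proof.
move=> cG mG Gbe ibe cphi phi1 cu uE.
pose vol : R := (2 * pi) ^+ d.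
have vol0 : 0 < vol by rewrite exprn_gt0// mulr_gt0 ?pi_gt0.
have tintE (f : vec -> R) : torus_int f = vol * avg f.
  by rewrite /avg mulrA -/vol mulfV ?mul1r// gt_eqF.
have mD : measurable [set` `]0 : R, t[] by exact: measurable_itv.
pose f0 (z : T * d.-tuple T) := if 0 < z.1 < t then G z.1 (row_of_tuple z.2) else 0.
pose f1 (z : T * d.-tuple T) := f0 z * phi (row_of_tuple z.2).
have mf1 : measurable_fun setT f1.
  apply: measurable_funM => //.
  apply: (@measurableT_comp _ _ _ _ _ _ (fun x => phi (row_of_tuple x))); last exact: measurable_snd.
  exact: cper_measurable.
have if0 : (mu \x nuT)%E.-integrable setT (EFin \o f0).
  apply/integrable12ltyP; first exact/measurable_EFinP.
  pose bf : T -> \bar R := (EFin \o (fun s => vol * be s)) \_ `]0, t[.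
  apply: (@le_lt_trans _ _ (\int[mu]_x bf x)%E); last first.
    have ib : mu.-integrable `]0, t[ (EFin \o (fun s => vol * be s)) by exact: integrable_scale.
    rewrite /bf -integral_mkcond.
    have /integrable_fin_num : mu.-integrable `]0, t[ (EFin \o (fun s => vol * be s)) by [].
    by move=> /(_ mD) /fin_numPlt /andP[_].
  apply: ge0_le_integral => //.
  - by move=> x _; apply: integral_ge0.
  - apply: (measurable_fun_fubini_tonelli_F (m2 := nuT) (fun z => `|(f0 z)%:E|%E)) => //.
    by apply: measurableT_comp => //; exact/measurable_EFinP.
  - apply/(measurable_restrictT _ mD); apply/measurable_EFinP.
    by apply: measurable_funM => //; have /integrableP[/measurable_EFinP] := ibe.
  - move=> s _; rewrite /bf /patch mem_setE in_itv /= /f0 /=.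
    case: ifPn => [st|_]; last by rewrite normr0 integral0.
    have cn := cper_norm (cG _ st).
    have -> : (\int[nuT]_y `|(G s (row_of_tuple y))%:E|)%E = (torus_int (fun x => `|G s x|))%:E.
      rewrite /torus_int /Rintegral fineK//.
      by exact: (integrable_fin_num measurableT (cper_integrable cn)).
    by rewrite lee_fin tintE ler_pM2l// Gbe.
have if1 : (mu \x nuT)%E.-integrable setT (EFin \o f1).
  apply: le_integrable if0 => //; first exact/measurable_EFinP.
  by move=> z _; rewrite lee_fin /f1 normrM ler_piMr.
have in1 s : (\int[nuT]_y (f1 (s, y))%:E)%E =
    ((EFin \o (fun s => torus_int (fun x => G s x * phi x))) \_ `]0, t[) s.
  rewrite /patch mem_setE in_itv /= /f1 /f0 /=; case: ifPn => [st|_]; last first.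
    by under eq_integral do rewrite mul0r; rewrite integral0.
  rewrite /torus_int /Rintegral fineK//.
  by exact: (integrable_fin_num measurableT (cper_integrable (cperM (cG _ st) cphi))).
have iF : mu.-integrable `]0, t[ (EFin \o (fun s => torus_int (fun x => G s x * phi x))).
  apply/integrable_mkcond => //; rewrite (_ : _ \_ _ = fubini_F nuT (EFin \o f1)).
    exact: integrable_fubini_F.
  by apply/funext => s; rewrite -in1.
have iA : mu.-integrable `]0, t[ (EFin \o (fun s => avg (fun x => G s x * phi x))).
  by rewrite /avg; exact: integrable_scale.
split=> //.
have := Fubini if1 => /=; under eq_integral do rewrite in1.
rewrite -integral_mkcond => FE.
have cuphi : cper (fun x => u x * phi x) by exact: cperM.
have outer : (\int[nuT]_y \int[mu]_x (f1 (x, y))%:E =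
    \int[nuT]_y ((u (row_of_tuple y) * phi (row_of_tuple y))%R)%:E)%E.
  apply: ae_eq_integral => //.
  - exact: (measurable_fubini_G if1).
  - by apply/measurable_EFinP; exact: (cper_measurable cuphi).
  have := ae_integrable2 if0; apply: filterS => y iy _ /=.
  have iy' : mu.-integrable `]0, t[ (EFin \o (fun s => G s (row_of_tuple y))).
    apply/integrable_mkcond => //; move: iy; congr (mu.-integrable _ _).
    by apply/funext => s; rewrite /patch mem_setE in_itv /= /f0 /=; case: ifP.
  transitivity (\int[mu]_(x in `]0%R, t[) ((phi (row_of_tuple y) * G x (row_of_tuple y))%R)%:E)%E.
    rewrite [RHS]integral_mkcond; apply: eq_integral => s _.
    rewrite /patch mem_setE in_itv /= /f1 /f0 /=; case: ifP => _; last by rewrite mul0r.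
    by rewrite mulrC.
  under eq_integral do rewrite EFinM.
  rewrite integralZl// uE mulrC EFinM /Rintegral fineK//; exact: integrable_fin_num.
have := congr1 fine FE; rewrite /= outer.
rewrite -[X in _ = X]/(torus_int (fun x => u x * phi x)) tintE => H.
apply: (mulfI (lt0r_neq0 vol0)); rewrite -H -RintegralZl//.
congr fine; apply: eq_integral => s _; rewrite /= tintE.
by [].
Qed.

End duhamel_pairing.

(** * The flux *)
Section flux_algebra.
Variables (R : realType) (d : nat).
Local Notation vec := 'rV[R]_d.
Implicit Types (v w : vec) (f g : vec -> R).

Definition sqn v : R := \sum_i v 0 i ^+ 2.

Definition cubic v : vec := (sqn v - 1) *: v.

Lemma sqn_ge0 v : 0 <= sqn v.
Proof. by apply: sumr_ge0 => i _; exact: sqr_ge0. Qed.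

Lemma euclid_norm_sqr v : euclid_norm v ^+ 2 = sqn v.
Proof. by rewrite sqr_sqrtr// sqn_ge0. Qed.

Lemma fluxE f x : flux f x = cubic (grad f x).
Proof. by rewrite /flux euclid_norm_sqr. Qed.

Lemma sqnZ c v : sqn (c *: v) = c ^+ 2 * sqn v.
Proof. by rewrite /sqn mulr_sumr; apply: eq_bigr => i _; rewrite mxE exprMn. Qed.

Lemma sqnD_le v w : sqn (v + w) <= 2 * (sqn v + sqn w).
Proof.
rewrite /sqn -big_split mulr_sumr; apply: ler_sum => i _; rewrite mxE /=.
have := sqr_ge0 (v 0 i - w 0 i); lra.
Qed.

Lemma sqnB_le v w : sqn (v - w) <= 2 * (sqn v + sqn w).
Proof.
have -> : sqn w = sqn (- w) by apply: eq_bigr => i _; rewrite mxE sqrrN.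
exact: sqnD_le.
Qed.

Lemma coord_sqr_le v i : v 0 i ^+ 2 <= sqn v.
Proof. by rewrite /sqn (bigD1 i)//= lerDl sumr_ge0// => j _; exact: sqr_ge0. Qed.

Lemma sqn_cubic v : sqn (cubic v) <= (1 + sqn v) ^+ 2 * sqn v.
Proof.
rewrite sqnZ; have := sqn_ge0 v; set s := sqn v => s0.
by rewrite ler_wpM2r// -[leLHS]real_normK ?num_real// lerXn2r ?nnegrE ?ler_norml//; lra.
Qed.

Lemma cubic_lip v w : sqn (cubic v - cubic w) <=
  4 * (1 + sqn v + sqn w) ^+ 2 * sqn (v - w).
Proof.
have -> : cubic v - cubic w = (sqn v - 1) *: (v - w) + (sqn v - sqn w) *: w.
  by apply/rowP => i; rewrite !mxE; ring.
apply: le_trans (sqnD_le _ _) _; rewrite !sqnZ.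
have q : (sqn v - sqn w) ^+ 2 <= sqn (v - w) * (2 * (sqn v + sqn w)).
  have -> : sqn v - sqn w = \sum_i (v - w) 0 i * (v + w) 0 i.
    by rewrite /sqn -sumrB; apply: eq_bigr => i _; rewrite !mxE; ring.
  apply: le_trans (cauchy_schwarz_sum _ _) _.
  by rewrite ler_wpM2l ?sqn_ge0//; exact: sqnD_le.
have := ler_wpM2r (sqn_ge0 w) q.
have := sqn_ge0 v; have := sqn_ge0 w; have := sqn_ge0 (v - w).
move: (sqn v) (sqn w) (sqn (v - w)) ((sqn v - sqn w) ^+ 2 * sqn w) => a b c z c0 b0 a0 h.
have p1 : 0 <= c * (a * b) by rewrite !mulr_ge0.
have p2 : 0 <= c * b by rewrite !mulr_ge0.
have p3 : 0 <= c * a by rewrite !mulr_ge0.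
have p4 : 0 <= c * (a * a) by rewrite !mulr_ge0.
have p5 : 0 <= c * (b * b) by rewrite !mulr_ge0.
nra.
Qed.

Lemma cubic_lip_coord v w (A e : R) : (forall i, `|v 0 i| <= A) -> (forall i, `|w 0 i| <= A) ->
  (forall i, `|v 0 i - w 0 i| <= e) ->
  forall i, `|cubic v 0 i - cubic w 0 i| <= (3 * d%:R * A ^+ 2 + 1) * e.
Proof.
move=> vA wA vw i.
have A0 : 0 <= A by exact: le_trans (normr_ge0 _) (vA i).
have e0 : 0 <= e by exact: le_trans (normr_ge0 _) (vw i).
have -> : cubic v 0 i - cubic w 0 i = (sqn v - 1) * (v 0 i - w 0 i) + (sqn v - sqn w) * w 0 i.
  by rewrite !mxE; ring.
have sv : sqn v <= d%:R * A ^+ 2.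
  have -> : d%:R * A ^+ 2 = \sum_(i < d) A ^+ 2 by rewrite sumr_const card_ord mulr_natl.
  apply: ler_sum => j _; rewrite -[leLHS]real_normK ?num_real// lerXn2r ?nnegrE//.
have svw : `|sqn v - sqn w| <= d%:R * (e * (2 * A)).
  have -> : d%:R * (e * (2 * A)) = \sum_(i < d) (e * (2 * A)) by rewrite sumr_const card_ord mulr_natl.
  rewrite /sqn -sumrB (le_trans (ler_norm_sum _ _ _))//; apply: ler_sum => j _.
  have -> : v 0 j ^+ 2 - w 0 j ^+ 2 = (v 0 j - w 0 j) * (v 0 j + w 0 j) by ring.
  rewrite normrM ler_pM// (le_trans (ler_normD _ _))//.
  by have := vA j; have := wA j; lra.
rewrite (le_trans (ler_normD _ _))// !normrM.
have -> : (3 * d%:R * A ^+ 2 + 1) * e = (d%:R * A ^+ 2 + 1) * e + d%:R * (e * (2 * A)) * A by ring.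
apply: lerD; apply: ler_pM => //.
by rewrite ler_norml; have := sqn_ge0 v; lra.
Qed.

End flux_algebra.

(** * Paths of gradients *)
Section gradient_paths.
Variables (R : realType) (d : nat).
Local Notation vec := 'rV[R]_d.
Local Notation freq := 'rV[int]_d.
Local Notation mu := (@lebesgue_measure R).
Local Notation T_ := (measurableTypeR R).
Implicit Types (g h : R -> vec -> R) (s t nu : R) (k : freq).

(** What the uniqueness argument retains of the solution class: the gradient is continuous
    in time with values in the continuous functions on (0, T], and it is o(t^(-1/4)) at 0
    because the weight t^(1/4) vanishes there. *)
Record grad_path (T : R) g : Prop := GradPath {
  gp_cper : forall t, 0 < t <= T -> cper (g t);
  gp_derivable : forall t x i, 0 < t <= T -> derivable (g t) x 'e_i;
  gp_grad : forall t i, 0 < t <= T -> cper (partial i (g t));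
  gp_bound : exists2 M, 0 <= M &
    forall t x, 0 < t <= T -> sqn (grad (g t) x) <= M * t `^ (- (1 / 2));
  gp_small : forall e, 0 < e -> exists2 del, 0 < del &
    forall t x, 0 < t <= T -> t < del -> sqn (grad (g t) x) <= e * t `^ (- (1 / 2));
  gp_cont : forall t e, 0 < t <= T -> 0 < e -> exists2 del, 0 < del &
    forall s, 0 < s <= T -> `|s - t| < del ->
    forall x i, `|partial i (g s) x - partial i (g t) x| <= e }.

Lemma cper_field_cubic (V : vec -> vec) : cper_field V -> cper_field (fun x => cubic (V x)).
Proof.
move=> cV i; under eq_fun do rewrite mxE; apply: cperM; last exact: cV.
by apply: cperB; [apply: cper_sum => j; exact: cper_sqr|exact: cper_cst].
Qed.

Lemma cper_field_flux T g s : grad_path T g -> 0 < s <= T -> cper_field (flux (g s)).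
Proof.
move=> gp sT; have -> : flux (g s) = (fun x => cubic (grad (g s) x)).
  by apply/funext => x; rewrite fluxE.
apply: cper_field_cubic => i; under eq_fun do rewrite mxE; exact: (gp_grad gp).
Qed.

Lemma flux_time_cont T g t e : grad_path T g -> 0 < t <= T -> 0 < e ->
  exists2 del, 0 < del & forall s, 0 < s <= T -> `|s - t| < del ->
  forall x i, `|flux (g s) x 0 i - flux (g t) x 0 i| <= e.
Proof.
move=> gp tT e0.
pose B i := projT1 (cid2 (cper_bounded (gp_grad gp i tT))).
have HB i x : `|partial i (g t) x| <= B i by rewrite /B; case: cid2.
have B0 i : 0 <= B i by rewrite /B; case: cid2.
pose A := 1 + \sum_i B i.
have BA i : B i + 1 <= A.
  by rewrite /A addrC lerD2l (bigD1 i)//= lerDl sumr_ge0.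
have A0 : 0 <= A by rewrite addr_ge0// sumr_ge0.
pose K := 3 * d%:R * A ^+ 2 + 1.
have K0 : 0 < K by rewrite ltr_wpDl// mulr_ge0 ?sqr_ge0// mulr_ge0.
have m0 : 0 < Num.min 1 (e / K) by rewrite lt_min ltr01 divr_gt0.
have [del del0 H] := gp_cont gp tT m0; exists del => // s sT st x i.
have Hs j : `|partial j (g s) x - partial j (g t) x| <= Num.min 1 (e / K) by exact: H.
have h1 : Num.min 1 (e / K) <= 1 by rewrite ge_min lexx.
have h2 : Num.min 1 (e / K) <= e / K by rewrite ge_min lexx orbT.
rewrite !fluxE; apply: le_trans (cubic_lip_coord (A := A) (e := e / K) _ _ _ i) _.
- move=> j; rewrite mxE -[partial j (g s) x](subrK (partial j (g t) x)).
  apply: (le_trans (ler_normD _ _)); have := Hs j; have := HB j x; have := BA j; lra.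
- by move=> j; rewrite mxE; have := HB j x; have := BA j; lra.
- by move=> j; rewrite !mxE (le_trans (Hs j)).
by rewrite -/K mulrCA mulfV ?mulr1// gt_eqF.
Qed.

Lemma flux_coef_continuous T g t k i : grad_path T g -> 0 < t < T ->
  {for t, continuous (fun s => fcos (fun x => flux (g s) x 0 i) k)} /\
  {for t, continuous (fun s => fsin (fun x => flux (g s) x 0 i) k)}.
Proof.
move=> gp /andP[t0 tT]; have tT' : 0 < t <= T by rewrite t0 ltW.
have nearT : \forall s \near t, 0 < s <= T.
  near=> s; apply/andP; split; near: s; first exact: lt_nbhsr.
  by apply: filterS (lt_nbhsl tT) => s /ltW.
have ct := cper_field_flux gp tT'.
have nearD del : 0 < del -> \forall s \near t, `|t - s| < del by exact: nbhsx_ballx.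
split; apply/cvgrPdist_le => e e0; have [del del0 H] := flux_time_cont gp tT' e0; near=> s.
  have sT : 0 < s <= T by near: s.
  have cs := cper_field_flux gp sT.
  rewrite -fcosB//; apply: fcos_bound => [|x]; first exact: cperB.
  by rewrite distrC; apply: H => //; rewrite distrC; near: s; exact: nearD.
have sT : 0 < s <= T by near: s.
have cs := cper_field_flux gp sT.
rewrite -fsinB//; apply: fsin_bound => [|x]; first exact: cperB.
by rewrite distrC; apply: H => //; rewrite distrC; near: s; exact: nearD.
Unshelve. all: by end_near.
Qed.

Lemma decay_continuous nu t k s : {for s, continuous (fun s => decay (nu * (t - s)) k : R)}.
Proof.
rewrite /decay; have := @continuous_comp _ _ _
  (fun s : R => - (nu * (t - s) * freq_sq R k ^+ 2)) expR s.
apply; last exact: continuous_expR.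
apply: cvgN; apply: cvgMl; apply: cvgMr.
by apply: cvgB; [exact: cvg_cst|exact: cvg_id].
Qed.

Lemma measurable_div_coef T g nu t k : grad_path T g -> 0 < t <= T ->
  measurable_fun `]0, t[ (fun s => div_cos (nu * (t - s)) (flux (g s)) k) /\
  measurable_fun `]0, t[ (fun s => div_sin (nu * (t - s)) (flux (g s)) k).
Proof.
move=> gp /andP[t0 tT]; split; apply: measurable_open_itv => s /andP[s0 st].
  apply: cvgM; first exact: decay_continuous.
  apply: cvg_sumr => i; apply: cvgMr.
  by apply: (flux_coef_continuous k i gp _).2; rewrite s0 (lt_le_trans st).
apply: cvgN; apply: cvgM; first exact: decay_continuous.
apply: cvg_sumr => i; apply: cvgMr.
by apply: (flux_coef_continuous k i gp _).1; rewrite s0 (lt_le_trans st).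
Qed.

(** Jointly measurable as the limit of finite sums of products of a function of time and a
    character. *)
Lemma measurable_duhamel T g nu t : grad_path T g -> 0 < nu -> 0 < t <= T ->
  measurable_fun setT (fun z : T_ * d.-tuple T_ =>
    if 0 < z.1 < t then div_semigroup nu (t - z.1) (flux (g z.1)) (row_of_tuple z.2) else 0).
Proof.
move=> gp nu0 tT; have mD : measurable [set` `]0 : R, t[] by exact: measurable_itv.
pose c k s := if 0 < s < t then div_cos (nu * (t - s)) (flux (g s)) k else 0.
pose b k s := if 0 < s < t then div_sin (nu * (t - s)) (flux (g s)) k else 0.
have mc k : measurable_fun setT (c k : T_ -> R).
  rewrite (_ : c k = (fun s => div_cos (nu * (t - s)) (flux (g s)) k) \_ `]0, t[).
    by apply/(measurable_restrictT _ mD); exact: (measurable_div_coef _ _ gp tT).1.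
  by apply/funext => s; rewrite /patch mem_setE in_itv.
have mb k : measurable_fun setT (b k : T_ -> R).
  rewrite (_ : b k = (fun s => div_sin (nu * (t - s)) (flux (g s)) k) \_ `]0, t[).
    by apply/(measurable_restrictT _ mD); exact: (measurable_div_coef _ _ gp tT).2.
  by apply/funext => s; rewrite /patch mem_setE in_itv.
apply: (@measurable_fun_cvg _ _ _ _ (fun N (z : T_ * d.-tuple T_) =>
    psum N (c^~ z.1) (b^~ z.1) (row_of_tuple z.2))) => [N|[s y] _ /=].
  rewrite /psum; apply: measurable_sum => k; apply: measurable_funD; apply: measurable_funM.
  - by apply: measurableT_comp => //; exact: measurable_fst.
  - apply: (@measurableT_comp _ _ _ _ _ _ (fun y => cos (freq_dot k (row_of_tuple y)))).
      exact: measurable_cos_freq.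
    exact: measurable_snd.
  - by apply: measurableT_comp => //; exact: measurable_fst.
  - apply: (@measurableT_comp _ _ _ _ _ _ (fun y => sin (freq_dot k (row_of_tuple y)))).
      exact: measurable_sin_freq.
    exact: measurable_snd.
rewrite /c /b; case: ifPn => [/andP[s0 st]|_]; last first.
  rewrite (_ : (fun N => _) = (fun=> 0)); first exact: cvg_cst.
  by apply/funext => N; rewrite /psum big1// => k _; rewrite !mul0r addr0.
have c0 : 0 < nu * (t - s) by rewrite mulr_gt0// subr_gt0.
have sT : 0 < s <= T by rewrite s0 (le_trans (ltW st))//; case/andP: tT.
have cV := cper_field_flux gp sT.
by rewrite div_semigroupE//; apply: tseries_cvg; exact: tsummable_div.
Qed.

Lemma powR_half_sqr s (p : R) : 0 < s -> (s `^ p) ^+ 2 = s `^ (2 * p).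
Proof. by move=> s0; rewrite mulrC powRrM -powR_mulrn ?powR_ge0. Qed.

(** The integrand is of size (t - s)^(-1/4) s^(-3/4), and each half of (0, t) contains only one
    of the two singularities. *)
Lemma duhamel_majorant T g nu t : grad_path T g -> 0 < nu -> 0 < t <= T ->
  exists be : R -> R, mu.-integrable `]0, t[ (EFin \o be) /\
  forall s, 0 < s < t ->
    avg (fun x => `|div_semigroup nu (t - s) (flux (g s)) x|) <= be s.
Proof.
move=> gp nu0 /andP[t0 tT]; have [M M0 HM] := gp_bound gp.
have mD : measurable [set` `]0 : R, t[] by exact: measurable_itv.
pose K := (Num.sqrt T + M) ^+ 2 * M + 1.
have K0 : 0 < K by rewrite ltr_wpDl// mulr_ge0 ?sqr_ge0.
have sn0 : 0 < Num.sqrt nu by rewrite sqrtr_gt0.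
pose L := Num.sqrt (K / Num.sqrt nu); have L0 : 0 < L by rewrite sqrtr_gt0 divr_gt0.
pose be0 s := (t - s) `^ (- (1 / 4)) * s `^ (- (3 / 4)).
have ts s : 0 < s < t -> 0 < t - s by move=> /andP[_]; rewrite subr_gt0.
have be00 s : 0 < s < t -> 0 < be0 s.
  by move=> st; rewrite mulr_gt0 ?powR_gt0 ?ts//; case/andP: st.
pose be1 s := (t / 2) `^ (- (1 / 4)) * s `^ (- (3 / 4)) + (t / 2) `^ (- (3 / 4)) * (t - s) `^ (- (1 / 4)).
exists (fun s => L * be1 s); split.
  apply: integrable_scale => //; apply: integrable_add => //; apply: integrable_scale => //.
    exact: (integral_powRN34 t0).1.
  exact: integral_powRN14_reflected.
have anti (p x y : R) : 0 < x -> x <= y -> 0 < p -> y `^ (- p) <= x `^ (- p).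
  move=> x0 xy p0; have y0 : 0 < y by exact: lt_le_trans xy.
  by rewrite !powRN lef_pV2 ?posrE ?powR_gt0// ge0_ler_powR ?nnegrE ?(ltW p0)// ltW.
move=> s st; have s0 : 0 < s by case/andP: st.
have sT : 0 < s <= T by rewrite s0 (le_trans _ tT)// ltW//; case/andP: st.
have c0 : 0 < nu * (t - s) by rewrite mulr_gt0// ts.
have cV := cper_field_flux gp sT.
apply: (@le_trans _ _ (L * be0 s)); last first.
  rewrite ler_pM2l// /be0 /be1; have p1 := powR_ge0 s (- (3 / 4)); have p2 := powR_ge0 (t - s) (- (1 / 4)).
  have p3 := powR_ge0 (t / 2) (- (1 / 4)); have p4 := powR_ge0 (t / 2) (- (3 / 4)).
  have [h|h] := leP s (t / 2).
    rewrite ler_wpDr ?mulr_ge0// ler_wpM2r// anti//; [by lra|by lra].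
  rewrite ler_wpDl ?mulr_ge0// mulrC ler_wpM2r// anti//; lra.
apply: avg_le_sqrt; [exact: cper_div_semigroup|by rewrite mulr_gt0 ?be00|].
apply: le_trans (avg_div_semigroup_sqr c0 cV) _.
have sumE : \sum_i avg (fun x => flux (g s) x 0 i ^+ 2) <= K * s `^ (- (3 / 2)).
  rewrite -avg_sum => [|i]; last exact: cper_sqr.
  rewrite -[leRHS](@avg_cst R d); apply: avg_le => [||x].
  - by apply: cper_sum => i; exact: cper_sqr.
  - exact: cper_cst.
  rewrite fluxE -/(sqn _); apply: le_trans (sqn_cubic _) _.
  have := HM s x sT; have := sqn_ge0 (grad (g s) x); move: (sqn _) => u u0 uM.
  have q0 : 0 < s `^ (- (1 / 2)) by rewrite powR_gt0.
  have one : 1 <= Num.sqrt T * s `^ (- (1 / 2)).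
    rewrite powRN div1r powR12_sqrt ?(ltW s0)// ler_pdivlMr ?sqrtr_gt0// mul1r ler_sqrt//.
      by case/andP: sT.
    by case/andP: sT => _ sT; apply: ltW (lt_le_trans s0 sT).
  have -> : s `^ (- (3 / 2)) = (s `^ (- (1 / 2))) ^+ 2 * s `^ (- (1 / 2)).
    rewrite powR_half_sqr// -powRD; first by congr powR; field.
    by apply/implyP => _; rewrite gt_eqF.
  rewrite /K; move: (s `^ (- (1 / 2))) (Num.sqrt T) q0 one uM => q S q0 one uM.
  apply: (@le_trans _ _ ((S * q + M * q) ^+ 2 * (M * q))).
    apply: ler_pM => //; first exact: sqr_ge0.
    by rewrite lerXn2r ?nnegrE; lra.
  have -> : (S * q + M * q) ^+ 2 * (M * q) = ((S + M) ^+ 2 * M) * (q ^+ 2 * q) by ring.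
  by rewrite ler_wpM2r ?mulr_ge0 ?sqr_ge0 ?(ltW q0)// lerDl.
have i0 : 0 <= (Num.sqrt (nu * (t - s)))^-1 by rewrite invr_ge0 sqrtr_ge0.
apply: le_trans (ler_wpM2l i0 sumE) _.
rewrite le_eqVlt; apply/orP; left; apply/eqP.
rewrite exprMn sqr_sqrtr ?(ltW (divr_gt0 K0 sn0))// /be0 exprMn !powR_half_sqr ?ts//.
have -> : 2 * - (1 / 4) = - (1 / 2) :> R by field.
have -> : 2 * - (3 / 4) = - (3 / 2) :> R by field.
have -> : (t - s) `^ (- (1 / 2)) = (Num.sqrt (t - s))^-1.
  by rewrite powRN div1r powR12_sqrt// ltW// ts.
by rewrite sqrtrM ?(ltW nu0)// invfM; ring.
Qed.

End gradient_paths.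

(** * Uniqueness of mild solutions *)
Section mode_formula.
Variables (R : realType) (d : nat).
Local Notation vec := 'rV[R]_d.
Local Notation freq := 'rV[int]_d.
Local Notation mu := (@lebesgue_measure R).
Implicit Types (g h : R -> vec -> R) (s t nu T : R) (k : freq) (x : vec).

Lemma measurable_duhamel_section T g nu t x : grad_path T g -> 0 < nu -> 0 < t <= T ->
  measurable_fun `]0, t[ (fun s => div_semigroup nu (t - s) (flux (g s)) x).
Proof.
move=> gp nu0 tT.
apply: (@measurable_fun_cvg _ _ _ _ (fun N s =>
    psum N (div_cos (nu * (t - s)) (flux (g s))) (div_sin (nu * (t - s)) (flux (g s))) x)) => [N|s /=].
  rewrite /psum; apply: measurable_sum => k; apply: measurable_funD; apply: measurable_funM => //.
    exact: (measurable_div_coef nu k gp tT).1.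
  exact: (measurable_div_coef nu k gp tT).2.
rewrite in_itv /= => /andP[s0 st].
have c0 : 0 < nu * (t - s) by rewrite mulr_gt0// subr_gt0.
have sT : 0 < s <= T by rewrite s0 (le_trans (ltW st))//; case/andP: tT.
have cV := cper_field_flux gp sT.
by rewrite div_semigroupE//; apply: tseries_cvg; exact: tsummable_div.
Qed.

Lemma Rintegral_closed_open t (f : R -> R) : 0 < t -> measurable_fun `]0, t[ f ->
  \int[mu]_(s in `[0, t]) f s = \int[mu]_(s in `]0, t[) f s.
Proof.
move=> t0 mf; have mE : measurable_fun `]0, t[ (EFin \o f) by exact/measurable_EFinP.
rewrite /Rintegral -(@integral_itv_obnd_cbnd R 0 (BRight t) (EFin \o f)).
  by rewrite -(@integral_itv_bndo_bndc R (BRight 0) t (EFin \o f)).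
have -> : [set` `]0, t]] = [set` `]0, t[] `|` [set t] :> set R.
  by apply/seteqP; split=> s /=; rewrite !in_itv/=; [have [->|] := eqVneq s t; [right|left]; lra|case=> [|->]; lra].
apply/measurable_funU => //; split=> //; exact: measurable_fun_set1.
Qed.

(** The Duhamel formula holds pointwise in x; Fubini against a character turns it into a scalar
    formula with an explicit kernel. *)
Lemma mode_formula T g nu t k (S : vec -> R) : grad_path T g -> 0 < nu -> 0 < t <= T -> cper S ->
  (forall x, g t x = S x + \int[mu]_(s in `[0, t]) div_semigroup nu (t - s) (flux (g s)) x) ->
  [/\ mu.-integrable `]0, t[ (EFin \o (fun s => div_cos (nu * (t - s)) (flux (g s)) k)),
      mu.-integrable `]0, t[ (EFin \o (fun s => div_sin (nu * (t - s)) (flux (g s)) k)),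
      fcos (g t) k = fcos S k + \int[mu]_(s in `]0, t[) div_cos (nu * (t - s)) (flux (g s)) k &
      fsin (g t) k = fsin S k + \int[mu]_(s in `]0, t[) div_sin (nu * (t - s)) (flux (g s)) k].
Proof.
move=> gp nu0 tT cS gE; have t0 : 0 < t by case/andP: tT.
have cg := gp_cper gp tT.
have [be [ibe Hbe]] := duhamel_majorant gp nu0 tT.
have inT s : 0 < s < t -> 0 < nu * (t - s) /\ 0 < s <= T.
  by case/andP: tT => _ tT /andP[s0 st]; rewrite mulr_gt0 ?subr_gt0 ?s0 ?(le_trans (ltW st)).
have cG s : 0 < s < t -> cper (div_semigroup nu (t - s) (flux (g s))).
  by move=> /inT[c0 sT]; apply: cper_div_semigroup => //; exact: cper_field_flux gp sT.
have cu : cper (fun x => g t x - S x) by exact: cperB.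
have uE x : g t x - S x = \int[mu]_(s in `]0, t[) div_semigroup nu (t - s) (flux (g s)) x.
  rewrite gE addrC addKr Rintegral_closed_open//; exact: measurable_duhamel_section gp nu0 tT.
have P (u phi : vec -> R) := @duhamel_pairing R d t _ be u phi cG (measurable_duhamel gp nu0 tT) Hbe ibe.
have [i1 E1] := P _ _ (@cper_cos R d k) (fun x => cos_max _) cu uE.
have [i2 E2] := P _ _ (@cper_sin R d k) (fun x => sin_max _) cu uE.
have mD : measurable [set` `]0 : R, t[] by exact: measurable_itv.
have e1 s : s \in [set` `]0, t[] ->
    avg (fun x => div_semigroup nu (t - s) (flux (g s)) x * cos (freq_dot k x)) =
    div_cos (nu * (t - s)) (flux (g s)) k.
  rewrite inE /= in_itv /= => /inT[c0 sT].
  by rewrite -/(fcos _ k) fcos_div_semigroup//; exact: cper_field_flux gp sT.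
have e2 s : s \in [set` `]0, t[] ->
    avg (fun x => div_semigroup nu (t - s) (flux (g s)) x * sin (freq_dot k x)) =
    div_sin (nu * (t - s)) (flux (g s)) k.
  rewrite inE /= in_itv /= => /inT[c0 sT].
  by rewrite -/(fsin _ k) fsin_div_semigroup//; exact: cper_field_flux gp sT.
split.
- by apply: eq_integrable i1 => // s sD; rewrite /= e1.
- by apply: eq_integrable i2 => // s sD; rewrite /= e2.
- have /= <- := eq_Rintegral mu e1; rewrite -E1 -/(fcos _ k) fcosB//; ring.
- have /= <- := eq_Rintegral mu e2; rewrite -E2 -/(fsin _ k) fsinB//; ring.
Qed.

End mode_formula.

Section uniqueness.
Variables (R : realType) (d : nat).
Local Notation vec := 'rV[R]_d.
Local Notation freq := 'rV[int]_d.
Local Notation mu := (@lebesgue_measure R).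
Implicit Types (g h : R -> vec -> R) (s t nu T : R) (k : freq) (x : vec).

Definition mode_gap g h k s : R := \sum_i
  ((fcos (fun x => flux (g s) x 0 i) k - fcos (fun x => flux (h s) x 0 i) k) ^+ 2 +
   (fsin (fun x => flux (g s) x 0 i) k - fsin (fun x => flux (h s) x 0 i) k) ^+ 2).

Definition grad_gap g h s : R := avg (fun x => sqn (grad (g s) x - grad (h s) x)).

Definition flux_gap g h s : R := avg (fun x => sqn (flux (g s) x - flux (h s) x)).

Lemma mode_gap_ge0 g h k s : 0 <= mode_gap g h k s.
Proof. by apply: sumr_ge0 => i _; rewrite addr_ge0 ?sqr_ge0. Qed.

Lemma cper_sqn_field (V W : vec -> vec) : cper_field V -> cper_field W ->
  cper (fun x => sqn (V x - W x)).
Proof.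
move=> cV cW; apply: cper_sum => i; under eq_fun do rewrite !mxE.
by apply: cper_sqr; exact: cperB.
Qed.

Lemma cper_field_grad T g s : grad_path T g -> 0 < s <= T -> cper_field (grad (g s)).
Proof. by move=> gp sT i; under eq_fun do rewrite mxE; exact: (gp_grad gp). Qed.

Lemma mode_gap_bessel T g h s N : grad_path T g -> grad_path T h -> 0 < s <= T ->
  \sum_(k <- fbox d N) mode_gap g h k s <= flux_gap g h s.
Proof.
move=> gp hp sT; have cV := cper_field_flux gp sT; have cW := cper_field_flux hp sT.
have cB i : cper (fun x => flux (g s) x 0 i - flux (h s) x 0 i) by exact: cperB.
have -> : flux_gap g h s = \sum_i avg (fun x => (flux (g s) x 0 i - flux (h s) x 0 i) ^+ 2).
  rewrite -avg_sum => [|i]; last exact: cper_sqr.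
  by congr avg; apply/funext => x; apply: eq_bigr => i _; rewrite !mxE.
rewrite /mode_gap exchange_big/=; apply: ler_sum => i _.
apply: le_trans (bessel N (cB i)); apply: ler_sum => k _.
by rewrite fcosB// fsinB.
Qed.

Lemma flux_gap_lip T g h s L : grad_path T g -> grad_path T h -> 0 < s <= T ->
  (forall x, 4 * (1 + sqn (grad (g s) x) + sqn (grad (h s) x)) ^+ 2 <= L) ->
  flux_gap g h s <= L * grad_gap g h s.
Proof.
move=> gp hp sT HL; have cV := cper_field_flux gp sT; have cW := cper_field_flux hp sT.
have cg := cper_sqn_field (cper_field_grad gp sT) (cper_field_grad hp sT).
rewrite /grad_gap -avgZ//; apply: avg_le => [||x].
- exact: cper_sqn_field.
- exact: cperZ.
by rewrite !fluxE; apply: le_trans (cubic_lip _ _) _; rewrite ler_wpM2r ?sqn_ge0.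
Qed.

Lemma grad_gap_parseval T g h t e : grad_path T g -> grad_path T h -> 0 < t <= T -> 0 < e ->
  exists N, grad_gap g h t <= \sum_(k <- fbox d N) freq_sq R k *
    ((fcos (g t) k - fcos (h t) k) ^+ 2 + (fsin (g t) k - fsin (h t) k) ^+ 2) + e.
Proof.
move=> gp hp tT e0.
have cg := gp_cper gp tT; have ch := gp_cper hp tT.
have cgi i := gp_grad gp i tT; have chi i := gp_grad hp i tT.
have cB i : cper (fun x => partial i (g t) x - partial i (h t) x) by exact: cperB.
have ed : 0 < e / d.+1%:R by rewrite divr_gt0.
pose N i := projT1 (cid (parseval_le (cB i) ed)).
have HN i : avg (fun x => (partial i (g t) x - partial i (h t) x) ^+ 2) <=
    energy (fun x => partial i (g t) x - partial i (h t) x) (N i) + e / d.+1%:R.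
  exact: projT2 (cid (parseval_le (cB i) ed)).
exists (\sum_i N i)%N.
have Nle i : (N i <= \sum_i N i)%N by rewrite (bigD1 i)//= leq_addr.
have -> : grad_gap g h t = \sum_i avg (fun x => (partial i (g t) x - partial i (h t) x) ^+ 2).
  rewrite -avg_sum => [|i]; last exact: cper_sqr.
  by congr avg; apply/funext => x; apply: eq_bigr => i _; rewrite !mxE.
apply: (@le_trans _ _ (\sum_i (energy (fun x => partial i (g t) x - partial i (h t) x) (\sum_i N i)%N + e / d.+1%:R))).
  apply: ler_sum => i _; apply: le_trans (HN i) _; rewrite lerD2r.
  apply: (@bsum_nd _ _ (fun k => fcos _ k ^+ 2 + fsin _ k ^+ 2)) (Nle i) => k.
  by rewrite addr_ge0 ?sqr_ge0.
rewrite big_split/= sumr_const card_ord lerD//; last first.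
  rewrite -[_ *+ d]mulr_natl mulrA ler_pdivrMr// mulrC ler_wpM2l ?(ltW e0)// ler_nat//.
rewrite /energy exchange_big/=; apply: ler_sum => k _; rewrite le_eqVlt; apply/orP; left; apply/eqP.
rewrite /freq_sq mulr_suml; apply: eq_bigr => i _.
have dg x : derivable (g t) x 'e_i by exact: (gp_derivable gp).
have dh x : derivable (h t) x 'e_i by exact: (gp_derivable hp).
by rewrite fcosB// fsinB// !fcos_partial// !fsin_partial//; ring.
Qed.

Lemma Rintegral_sum_le (D : set R) (I : Type) (r : seq I) (F : I -> R -> R) (G : R -> R) :
  measurable D -> (forall i, mu.-integrable D (EFin \o F i)) -> mu.-integrable D (EFin \o G) ->
  (forall s, D s -> \sum_(i <- r) F i s <= G s) ->
  \sum_(i <- r) \int[mu]_(s in D) F i s <= \int[mu]_(s in D) G s.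
Proof.
move=> mD iF iG H.
have [iS ES] : mu.-integrable D (EFin \o (fun s => \sum_(i <- r) F i s)) /\
    \int[mu]_(s in D) (\sum_(i <- r) F i s) = \sum_(i <- r) \int[mu]_(s in D) F i s.
  elim: r {H} => [|i r [IH1 IH2]].
    under eq_fun do rewrite big_nil; rewrite big_nil.
    rewrite Rintegral_cst// mul0r; split=> //.
    rewrite (_ : _ \o _ = cst 0%E); last by apply/funext.
    exact: integrable0.
  under eq_fun do rewrite big_cons; rewrite big_cons.
  rewrite RintegralD// IH2; split=> //.
  exact: integrable_add.
by rewrite -ES; apply: le_Rintegral.
Qed.

(** Cauchy-Schwarz in time for each mode, the modes then summed by Bessel's inequality; the
    weight s^(3/4) pays for the singularity of the fluxes at 0. *)
Lemma grad_gap_le nu T g h t (S : R -> vec -> R) (be : R -> R) : 0 < nu ->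
  grad_path T g -> grad_path T h -> 0 < t <= T -> cper (S t) ->
  (forall x, g t x = S t x + \int[mu]_(s in `[0, t]) div_semigroup nu (t - s) (flux (g s)) x) ->
  (forall x, h t x = S t x + \int[mu]_(s in `[0, t]) div_semigroup nu (t - s) (flux (h s)) x) ->
  mu.-integrable `]0, t[ (EFin \o be) ->
  (forall s, 0 < s < t -> s `^ (3 / 4) * flux_gap g h s <= be s) ->
  grad_gap g h t <= 6 / nu * t `^ (- (3 / 4)) * \int[mu]_(s in `]0, t[) be s.
Proof.
move=> nu0 gp hp tT cS gE hE ibe Hbe; have t0 : 0 < t by case/andP: tT.
have mD : measurable [set` `]0 : R, t[] by exact: measurable_itv.
have inT s : 0 < s < t -> 0 < s <= T.
  by case/andP: tT => _ tT /andP[s0 st]; rewrite s0 (le_trans (ltW st)).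
pose dc i k s := fcos (fun x => flux (g s) x 0 i) k - fcos (fun x => flux (h s) x 0 i) k.
pose ds i k s := fsin (fun x => flux (g s) x 0 i) k - fsin (fun x => flux (h s) x 0 i) k.
have cdc i k s : 0 < s < t -> {for s, continuous (dc i k)} /\ {for s, continuous (ds i k)}.
  move=> /andP[s0 st]; have sT' : 0 < s < T by rewrite s0 (lt_le_trans st)//; case/andP: tT.
  have [a1 b1] := flux_coef_continuous k i gp sT'; have [a2 b2] := flux_coef_continuous k i hp sT'.
  by split; [exact: (cvgB a1 a2)|exact: (cvgB b1 b2)].
pose Pc k s := \sum_i dc i k s ^+ 2; pose Ps k s := \sum_i ds i k s ^+ 2.
have PcPs k s : Pc k s + Ps k s = mode_gap g h k s by rewrite /Pc /Ps -big_split.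
have Pc0 k s : 0 <= Pc k s by apply: sumr_ge0 => i _; exact: sqr_ge0.
have Ps0 k s : 0 <= Ps k s by apply: sumr_ge0 => i _; exact: sqr_ge0.
have gapk k s : 0 < s < t -> mode_gap g h k s <= flux_gap g h s.
  move=> /inT sT; have [N kN] := fbox_absorb R k.
  apply: le_trans (mode_gap_bessel N gp hp sT).
  by rewrite (bigD1_seq k) ?fbox_uniq//= lerDl sumr_ge0// => l _; exact: mode_gap_ge0.
have iPc k : mu.-integrable `]0, t[ (EFin \o (fun s => s `^ (3 / 4) * Pc k s)).
  apply: integrable_dominated ibe => // [|s /=].
    apply: measurable_open_itv => s st; apply: cvgM.
      by apply: powR_continuous; case/andP: st.
    by apply: cvg_sumr => i; under eq_cvg do rewrite expr2; rewrite expr2; apply: cvgM; apply: (cdc i k s st).1.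
  rewrite in_itv/= => st; rewrite ger0_norm ?mulr_ge0 ?powR_ge0//.
  apply: le_trans (Hbe s st); rewrite ler_wpM2l ?powR_ge0//.
  by apply: le_trans (gapk k s st); rewrite -PcPs lerDl.
have iPs k : mu.-integrable `]0, t[ (EFin \o (fun s => s `^ (3 / 4) * Ps k s)).
  apply: integrable_dominated ibe => // [|s /=].
    apply: measurable_open_itv => s st; apply: cvgM.
      by apply: powR_continuous; case/andP: st.
    by apply: cvg_sumr => i; under eq_cvg do rewrite expr2; rewrite expr2; apply: cvgM; apply: (cdc i k s st).2.
  rewrite in_itv/= => st; rewrite ger0_norm ?mulr_ge0 ?powR_ge0//.
  apply: le_trans (Hbe s st); rewrite ler_wpM2l ?powR_ge0//.
  by apply: le_trans (gapk k s st); rewrite -PcPs lerDr.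
have wcs k (D1 D2 P : R -> R) : 
    mu.-integrable `]0, t[ (EFin \o D1) -> mu.-integrable `]0, t[ (EFin \o D2) ->
    mu.-integrable `]0, t[ (EFin \o (fun s => s `^ (3 / 4) * P s)) -> (forall s, 0 <= P s) ->
    (forall s, 0 < s < t -> (D1 s - D2 s) ^+ 2 <= decay (nu * (t - s)) k ^+ 2 * (freq_sq R k * P s)) ->
    freq_sq R k * (\int[mu]_(s in `]0, t[) D1 s - \int[mu]_(s in `]0, t[) D2 s) ^+ 2 <=
      6 / nu * t `^ (- (3 / 4)) * \int[mu]_(s in `]0, t[) (s `^ (3 / 4) * P s).
  move=> iD1 iD2 iP P0 HD.
  have k0 := freq_sq_ge0 R k; set q := freq_sq R k in k0 HD *.
  have iD2' : mu.-integrable `]0, t[ (EFin \o (fun s => -1 * D2 s)) by exact: integrable_scale.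
  have iD : mu.-integrable `]0, t[ (EFin \o (fun s => D1 s + -1 * D2 s)) by exact: integrable_add.
  have -> : \int[mu]_(s in `]0, t[) D1 s - \int[mu]_(s in `]0, t[) D2 s =
      \int[mu]_(s in `]0, t[) (D1 s + -1 * D2 s).
    by rewrite RintegralD// RintegralZl// mulN1r.
  have [iu Iu] := singular_kernel_le q nu0 t0.
  have iw : mu.-integrable `]0, t[ (EFin \o (fun s => Num.sqrt q * (D1 s + -1 * D2 s))).
    exact: integrable_scale.
  have -> : q * (\int[mu]_(s in `]0, t[) (D1 s + -1 * D2 s)) ^+ 2 =
      (\int[mu]_(s in `]0, t[) (Num.sqrt q * (D1 s + -1 * D2 s))) ^+ 2.
    by rewrite RintegralZl// exprMn sqr_sqrtr.
  apply: le_trans (Rintegral_cauchy_schwarz mD iu iP iw _ _ _) _.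
  - by move=> s _; rewrite mulr_ge0 ?powR_ge0// mulr_ge0 ?sqr_ge0.
  - by move=> s _; rewrite mulr_ge0 ?powR_ge0.
  - move=> s /=; rewrite in_itv/= => st; have s0 : 0 < s by case/andP: st.
    rewrite exprMn sqr_sqrtr// mulN1r.
    have -> : q ^+ 2 * expR (- (nu * (t - s) * q ^+ 2)) ^+ 2 * s `^ (- (3 / 4)) * (s `^ (3 / 4) * P s) =
        q * (expR (- (nu * (t - s) * q ^+ 2)) ^+ 2 * (q * P s)) * (s `^ (- (3 / 4)) * s `^ (3 / 4)).
      by ring.
    rewrite -powRD; last by apply/implyP => _; rewrite gt_eqF.
    by rewrite addNr powRr0 mulr1 ler_wpM2l// HD.
  rewrite ler_wpM2r//; apply: Rintegral_ge0 => s /=; by rewrite mulr_ge0 ?powR_ge0.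
have mode k : freq_sq R k *
    ((fcos (g t) k - fcos (h t) k) ^+ 2 + (fsin (g t) k - fsin (h t) k) ^+ 2) <=
    6 / nu * t `^ (- (3 / 4)) * \int[mu]_(s in `]0, t[) (s `^ (3 / 4) * mode_gap g h k s).
  have [ig1 ig2 -> ->] := mode_formula k gp nu0 tT cS gE.
  have [ih1 ih2 -> ->] := mode_formula k hp nu0 tT cS hE.
  have E (a b c : R) : a + b - (a + c) = b - c by ring.
  rewrite !E.
  have -> : \int[mu]_(s in `]0, t[) (s `^ (3 / 4) * mode_gap g h k s) =
      \int[mu]_(s in `]0, t[) (s `^ (3 / 4) * Ps k s) + \int[mu]_(s in `]0, t[) (s `^ (3 / 4) * Pc k s).
    rewrite -RintegralD//; apply: eq_Rintegral => s _; rewrite -PcPs; ring.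
  have Hc s : 0 < s < t ->
      (div_cos (nu * (t - s)) (flux (g s)) k - div_cos (nu * (t - s)) (flux (h s)) k) ^+ 2 <=
      decay (nu * (t - s)) k ^+ 2 * (freq_sq R k * Ps k s).
    move=> st; rewrite /div_cos -mulrBr exprMn ler_wpM2l ?sqr_ge0// -sumrB.
    by under eq_bigr do rewrite -mulrBr; exact: cauchy_schwarz_sum.
  have Hs s : 0 < s < t ->
      (div_sin (nu * (t - s)) (flux (g s)) k - div_sin (nu * (t - s)) (flux (h s)) k) ^+ 2 <=
      decay (nu * (t - s)) k ^+ 2 * (freq_sq R k * Pc k s).
    move=> st; rewrite /div_sin opprK addrC -mulrBr exprMn ler_wpM2l ?sqr_ge0// -sumrB.
    under eq_bigr do rewrite -mulrBr.
    have -> : Pc k s = \sum_i (fcos (fun x => flux (h s) x 0 i) k -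
        fcos (fun x => flux (g s) x 0 i) k) ^+ 2.
      by apply: eq_bigr => i _; rewrite /dc; move: (fcos _ k) (fcos _ k) => a b; ring.
    exact: cauchy_schwarz_sum.
  have mc := wcs k _ _ (Ps k) ig1 ih1 (iPs k) (Ps0 k) Hc.
  have ms := wcs k _ _ (Pc k) ig2 ih2 (iPc k) (Pc0 k) Hs.
  move: mc ms; set A := _ ^+ 2; set B := _ ^+ 2.
  set IP := \int[mu]_(_ in _) _; set IC := \int[mu]_(_ in _) _ => mc ms.
  by rewrite (mulrDr _ A B) (mulrDr _ IP IC) lerD.
apply/ler_addgt0Pl => e e0; have [N HN] := grad_gap_parseval gp hp tT e0.
apply: le_trans HN _; rewrite addrC lerD2l.
apply: (@le_trans _ _ (\sum_(k <- fbox d N) 6 / nu * t `^ (- (3 / 4)) *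
    \int[mu]_(s in `]0, t[) (s `^ (3 / 4) * mode_gap g h k s))).
  by apply: ler_sum => k _; exact: mode.
rewrite -mulr_sumr; apply: ler_wpM2l.
  by apply: mulr_ge0; [rewrite divr_ge0// ltW|exact: powR_ge0].
apply: (@Rintegral_sum_le _ _ (fbox d N) (fun k s => s `^ (3 / 4) * mode_gap g h k s) be) => // [k|s /=].
  have ii : mu.-integrable `]0, t[
      (EFin \o (fun s => s `^ (3 / 4) * Pc k s + s `^ (3 / 4) * Ps k s)).
    by apply: integrable_add.
  by apply: eq_integrable ii => // s _ /=; rewrite -PcPs mulrDr.
rewrite in_itv/= => st; rewrite -mulr_sumr; apply: le_trans (Hbe s st).
by rewrite ler_wpM2l ?powR_ge0//; exact: mode_gap_bessel gp hp (inT _ st).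
Qed.

End uniqueness.

Section uniqueness_bootstrap.
Variables (R : realType) (d : nat).
Local Notation vec := 'rV[R]_d.
Local Notation mu := (@lebesgue_measure R).
Implicit Types (g h : R -> vec -> R) (s t nu T : R) (x : vec).

Definition lip_weight g h s x : R :=
  4 * (1 + sqn (grad (g s) x) + sqn (grad (h s) x)) ^+ 2.

(** The squared Lipschitz constant of the flux may blow up like 1/s, which is critical;
    what saves the argument is that the coefficient of the singularity is as small as
    desired near 0. *)
Lemma lip_weight_split T g h e : 0 < T -> grad_path T g -> grad_path T h -> 0 < e ->
  exists del B, [/\ 0 < del, 0 <= B,
    forall s x, 0 < s <= T -> s < del -> lip_weight g h s x * s `^ (1 / 4) <= e * s `^ (- (3 / 4)) &
    forall s x, 0 < s <= T -> lip_weight g h s x * s `^ (1 / 4) <= e * s `^ (- (3 / 4)) + B].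
Proof.
move=> T0 gp hp e0.
pose a := Num.sqrt (e / 32); have a0 : 0 < a by rewrite sqrtr_gt0 divr_gt0.
have aE : a ^+ 2 = e / 32 by rewrite sqr_sqrtr// divr_ge0// ltW.
have a20 : 0 < a / 2 by rewrite divr_gt0.
have [d1 d10 H1] := gp_small gp a20; have [d2 d20 H2] := gp_small hp a20.
have [M1 M10 HM1] := gp_bound gp; have [M2 M20 HM2] := gp_bound hp.
pose del := Num.min (Num.min d1 d2) (e / 32).
have del0 : 0 < del by rewrite !lt_min d10 d20 divr_gt0.
pose B := 4 * (1 + (M1 + M2) * del `^ (- (1 / 2))) ^+ 2 * T `^ (1 / 4).
have small s x : 0 < s <= T -> s < del ->
    lip_weight g h s x * s `^ (1 / 4) <= e * s `^ (- (3 / 4)).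
  move=> sT sd; have s0 : 0 < s by case/andP: sT.
  have [sd1 sd2 se] : [/\ s < d1, s < d2 & s < e / 32].
    by move: sd; rewrite !lt_min => /andP[/andP[? ?] ?].
  have := H1 s x sT sd1; have := H2 s x sT sd2.
  rewrite /lip_weight; have := sqn_ge0 (grad (g s) x); have := sqn_ge0 (grad (h s) x).
  move: (sqn _) (sqn _) => u v; set q := s `^ (- (1 / 2)) => v0 u0 uq vq.
  have q0 : 0 < q by rewrite powR_gt0.
  have q2 : q ^+ 2 = s^-1.
    rewrite /q powR_half_sqr// (_ : 2 * - (1 / 2) = - 1); last by field.
    by rewrite powR_inv1// ltW.
  have E : s `^ (1 / 4) = s * s `^ (- (3 / 4)).
    rewrite -{2}(powRr1 (ltW s0)) -powRD; first by congr powR; field.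
    by apply/implyP => _; rewrite gt_eqF.
  rewrite E mulrA ler_wpM2r ?powR_ge0//.
  have sq : s * q ^+ 2 = 1 by rewrite q2 mulfV// gt_eqF.
  have : (1 + u + v) ^+ 2 <= 2 + 2 * (a ^+ 2 * q ^+ 2).
    have : u + v <= a * q by lra.
    have uv0 : 0 <= u + v by rewrite addr_ge0.
    move=> uvz; have -> : 1 + u + v = 1 + (u + v) by ring.
    have -> : a ^+ 2 * q ^+ 2 = (a * q) ^+ 2 by ring.
    have : (u + v) ^+ 2 <= (a * q) ^+ 2 by rewrite lerXn2r ?nnegrE//; lra.
    have := sqr_ge0 (1 - (u + v)); lra.
  move=> /(ler_wpM2l (ltW s0)); rewrite aE.
  have -> : s * (2 + 2 * (e / 32 * q ^+ 2)) = 2 * s + e / 16 * (s * q ^+ 2) by field.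
  rewrite sq; have -> : 4 * (1 + u + v) ^+ 2 * s = 4 * (s * (1 + u + v) ^+ 2) by ring.
  lra.
exists del, B; split=> //.
  by rewrite mulr_ge0 ?powR_ge0// mulr_ge0 ?sqr_ge0.
move=> s x sT; have [sd|sd] := ltP s del.
  rewrite ler_wpDr ?small// mulr_ge0 ?powR_ge0// mulr_ge0 ?sqr_ge0//.
have s0 : 0 < s by case/andP: sT.
rewrite ler_wpDl ?mulr_ge0 ?powR_ge0 ?(ltW e0)//.
have qd : s `^ (- (1 / 2)) <= del `^ (- (1 / 2)).
  by rewrite !powRN lef_pV2 ?posrE ?powR_gt0// ge0_ler_powR ?nnegrE ?(ltW s0) ?(ltW del0)//; lra.
have h1 := HM1 s x sT; have h2 := HM2 s x sT.
have k1 := ler_wpM2l M10 qd; have k2 := ler_wpM2l M20 qd.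
have u0 := sqn_ge0 (grad (g s) x); have v0 := sqn_ge0 (grad (h s) x).
have T4 : s `^ (1 / 4) <= T `^ (1 / 4).
  by rewrite ge0_ler_powR ?nnegrE ?(ltW s0) ?(ltW T0)//; case/andP: sT.
rewrite /lip_weight /B; apply: ler_pM => //; [by rewrite mulr_ge0 ?sqr_ge0|exact: powR_ge0|].
rewrite ler_pM2l//; apply: lerXn2r; rewrite ?nnegrE; [lra| |rewrite mulrDl; lra].
by rewrite addr_ge0// mulr_ge0 ?powR_ge0 ?addr_ge0.
Qed.

Lemma sum_sqr_le0 (I : finType) (a b c e : I -> R) :
  \sum_i ((a i - b i) ^+ 2 + (c i - e i) ^+ 2) <= 0 -> forall i, a i = b i /\ c i = e i.
Proof.
move=> H i; move: H; rewrite (bigD1 i)//=; set r := \sum_(j | _) _ => H.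
have r0 : 0 <= r by apply: sumr_ge0 => j _; rewrite addr_ge0 ?sqr_ge0.
have p0 := sqr_ge0 (a i - b i); have q0 := sqr_ge0 (c i - e i).
by split; apply/eqP; rewrite -subr_eq0 -sqrf_eq0 eq_le ?p0 ?q0 andbT; lra.
Qed.

(** Once the gradients agree in the mean, so do all the Fourier coefficients of the fluxes, by
    Bessel's inequality. *)
Lemma duhamel_eq_of_gap nu T g h t x : 0 < nu -> grad_path T g -> grad_path T h ->
  (forall s, 0 < s <= T -> grad_gap g h s <= 0) -> 0 < t <= T ->
  \int[mu]_(s in `[0, t]) div_semigroup nu (t - s) (flux (g s)) x =
  \int[mu]_(s in `[0, t]) div_semigroup nu (t - s) (flux (h s)) x.
Proof.
move=> nu0 gp hp gap0 tT.
have [M1 M10 HM1] := gp_bound gp; have [M2 M20 HM2] := gp_bound hp.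
have t0 : 0 < t by case/andP: tT.
have mg : measurable_fun `]0, t[ (fun s => div_semigroup nu (t - s) (flux (g s)) x).
  exact: measurable_duhamel_section gp nu0 tT.
have mh : measurable_fun `]0, t[ (fun s => div_semigroup nu (t - s) (flux (h s)) x).
  exact: measurable_duhamel_section hp nu0 tT.
have Eg := Rintegral_closed_open t0 mg; have Eh := Rintegral_closed_open t0 mh.
apply: (etrans Eg); apply: (etrans _ (esym Eh)); clear Eg Eh mg mh.
apply: eq_Rintegral => s; rewrite inE /= in_itv /= => /andP[s0 st].
have sT : 0 < s <= T by rewrite s0 (le_trans (ltW st))//; case/andP: tT.
have c0 : 0 < nu * (t - s) by rewrite mulr_gt0// subr_gt0.
have cg := cper_field_flux gp sT; have ch := cper_field_flux hp sT.
have [Mg Mg0 HMg] : exists2 M, 0 <= M & forall y, lip_weight g h s y <= M.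
  exists (4 * (1 + M1 * s `^ (- (1 / 2)) + M2 * s `^ (- (1 / 2))) ^+ 2); first by rewrite mulr_ge0 ?sqr_ge0.
  move=> y; rewrite /lip_weight ler_pM2l//.
  have := HM1 s y sT; have := HM2 s y sT.
  have := sqn_ge0 (grad (g s) y); have := sqn_ge0 (grad (h s) y).
  move: (sqn (grad (g s) y)) (sqn (grad (h s) y)) (M1 * _) (M2 * _) => p q P Q p0 q0 pP qQ.
  by apply: lerXn2r; rewrite ?nnegrE; lra.
have fg0 : flux_gap g h s <= 0.
  apply: le_trans (flux_gap_lip gp hp sT HMg) _.
  by have := ler_wpM2l Mg0 (gap0 s sT); rewrite mulr0.
have coefs k i : fcos (fun y => flux (g s) y 0 i) k = fcos (fun y => flux (h s) y 0 i) k /\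
    fsin (fun y => flux (g s) y 0 i) k = fsin (fun y => flux (h s) y 0 i) k.
  have [N kN] := fbox_absorb R k.
  have H := le_trans (mode_gap_bessel N gp hp sT) fg0.
  have H1 : mode_gap g h k s <= 0.
    apply: le_trans H; rewrite (bigD1_seq k kN (fbox_uniq _ _)) lerDl.
    by apply: sumr_ge0 => l _; exact: mode_gap_ge0.
  exact: (sum_sqr_le0 (a := fun j => fcos (fun y => flux (g s) y 0 j) k)
    (b := fun j => fcos (fun y => flux (h s) y 0 j) k)
    (c := fun j => fsin (fun y => flux (g s) y 0 j) k)
    (e := fun j => fsin (fun y => flux (h s) y 0 j) k) H1).
rewrite (div_semigroupE c0 cg) (div_semigroupE c0 ch).
have -> : div_cos (nu * (t - s)) (flux (g s)) = div_cos (nu * (t - s)) (flux (h s)).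
  apply/funext => k; rewrite /div_cos; apply: (congr1 (fun z => _ * z)).
  by apply: eq_bigr => i _; rewrite (coefs k i).2.
have -> // : div_sin (nu * (t - s)) (flux (g s)) = div_sin (nu * (t - s)) (flux (h s)).
apply/funext => k; rewrite /div_sin; apply: (congr1 (fun z => - (_ * z))).
by apply: eq_bigr => i _; rewrite (coefs k i).1.
Qed.

(** [grad_gap_le] halves every bound of the form D s^(-1/2) e^(Lam s) for the gap: near 0
    because the gradients are small there, and later because Lam is large. Iterating, the
    gap is zero. *)
Theorem mild_unique nu T g h (S : R -> vec -> R) : 0 < nu -> 0 < T ->
  grad_path T g -> grad_path T h -> (forall t, 0 < t <= T -> cper (S t)) ->
  (forall t x, 0 < t <= T ->
    g t x = S t x + \int[mu]_(s in `[0, t]) div_semigroup nu (t - s) (flux (g s)) x) ->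
  (forall t x, 0 < t <= T ->
    h t x = S t x + \int[mu]_(s in `[0, t]) div_semigroup nu (t - s) (flux (h s)) x) ->
  forall t x, 0 < t <= T -> g t x = h t x.
Proof.
move=> nu0 T0 gp hp cS gE hE.
(* 96 = 4 * 24: the kernel costs 6 / nu and the time integral 4, and a quarter must be left. *)
pose e := nu / 96; have e0 : 0 < e by rewrite divr_gt0.
have [del [B [del0 B0 Hs Hb]]] := lip_weight_split T0 gp hp e0.
pose dq := del `^ (- (1 / 4)); have dq0 : 0 < dq by rewrite powR_gt0.
(* The bounded part of the Lipschitz constant is absorbed by the rate of the exponential. *)
pose Lam := 24 / nu * dq * B + 1.
have Lam0 : 0 < Lam by rewrite ltr_wpDl// !mulr_ge0 ?invr_ge0 ?(ltW dq0) ?(ltW nu0).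
pose P D := forall s, 0 < s <= T -> grad_gap g h s <= D * (s `^ (- (1 / 2)) * expR (Lam * s)).
have mD t : measurable [set` `]0 : R, t[] by exact: measurable_itv.
have step D : 0 <= D -> P D -> P (D / 2).
  move=> D0 PD t tT; have t0 : 0 < t by case/andP: tT.
  pose Bt := if t < del then 0 else B.
  have Bt0 : 0 <= Bt by rewrite /Bt; case: ifP.
  have [ip Ip] := integral_powRN34 t0; have [iE IE] := integral_expR t0 Lam0.
  pose be s := D * (e * expR (Lam * t)) * s `^ (- (3 / 4)) + D * Bt * expR (Lam * s).
  have ibe : mu.-integrable `]0, t[ (EFin \o be).
    by apply: integrable_add => //; exact: integrable_scale.
  have inT s : 0 < s < t -> 0 < s <= T.
    by case/andP: tT => _ tT /andP[s0 st]; rewrite s0 (le_trans (ltW st)).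
  have Hbe s : 0 < s < t -> s `^ (3 / 4) * flux_gap g h s <= be s.
    move=> st; have sT := inT s st; have s0 : 0 < s by case/andP: st.
    have p4 : 0 < s `^ (1 / 4) by rewrite powR_gt0.
    pose L := (e * s `^ (- (3 / 4)) + Bt) / s `^ (1 / 4).
    have HL x : lip_weight g h s x <= L.
      rewrite /L ler_pdivlMr// /Bt; case: ltP => td; last exact: Hb.
      by rewrite addr0; apply: Hs => //; apply: lt_trans td; case/andP: st.
    have := flux_gap_lip gp hp sT HL.
    have L0 : 0 <= L by rewrite divr_ge0 ?powR_ge0// addr_ge0// mulr_ge0 ?powR_ge0// ltW.
    move=> /le_trans/(_ (ler_wpM2l L0 (PD s sT))) h1.
    apply: le_trans (ler_wpM2l (powR_ge0 s (3 / 4)) h1) _.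
    have E : s `^ (3 / 4) = s `^ (1 / 4) * s `^ (1 / 2).
      by rewrite -powRD; [congr powR; field|apply/implyP => _; rewrite gt_eqF].
    have E2 : s `^ (1 / 2) * s `^ (- (1 / 2)) = 1.
      by rewrite -powRD ?subrr ?powRr0//; apply/implyP => _; rewrite gt_eqF.
    rewrite E /L.
    have -> : s `^ (1 / 4) * s `^ (1 / 2) * ((e * s `^ (- (3 / 4)) + Bt) / s `^ (1 / 4) *
        (D * (s `^ (- (1 / 2)) * expR (Lam * s)))) =
      (s `^ (1 / 2) * s `^ (- (1 / 2))) * (s `^ (1 / 4) / s `^ (1 / 4)) *
      ((e * s `^ (- (3 / 4)) + Bt) * (D * expR (Lam * s))) by ring.
    rewrite E2 mulfV ?gt_eqF// !mul1r /be.
    have -> : (e * s `^ (- (3 / 4)) + Bt) * (D * expR (Lam * s)) =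
      D * (e * expR (Lam * s)) * s `^ (- (3 / 4)) + D * Bt * expR (Lam * s) by ring.
    rewrite lerD2r ler_wpM2r ?powR_ge0// ler_wpM2l// ler_wpM2l ?(ltW e0)// ler_expR.
    by rewrite ler_pM2l// ltW//; case/andP: st.
  apply: le_trans (grad_gap_le nu0 gp hp tT (cS t tT) _ _ ibe Hbe) _.
  - by move=> x; exact: gE.
  - by move=> x; exact: hE.
  rewrite RintegralD//; [|exact: integrable_scale|exact: integrable_scale].
  rewrite [X in _ * (X + _)]RintegralZl// [X in _ * (_ + X)]RintegralZl//.
  set I1 := \int[mu]_(_ in _) _ in Ip *; set I2 := \int[mu]_(_ in _) _ in IE *.
  have p34 : 0 < t `^ (- (3 / 4)) by rewrite powR_gt0.
  have ex0 : 0 < expR (Lam * t) by exact: expR_gt0.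
  have E1 : t `^ (- (3 / 4)) * t `^ (1 / 4) = t `^ (- (1 / 2)).
    by rewrite -powRD; [congr powR; field|apply/implyP => _; rewrite gt_eqF].
  have h1 : 6 / nu * t `^ (- (3 / 4)) * (D * (e * expR (Lam * t)) * I1) <=
      D / 4 * (t `^ (- (1 / 2)) * expR (Lam * t)).
    have c0 : 0 <= 6 / nu * t `^ (- (3 / 4)) * (D * (e * expR (Lam * t))).
      by rewrite !mulr_ge0 ?invr_ge0 ?(ltW nu0) ?(ltW p34) ?(ltW e0) ?(ltW ex0).
    rewrite mulrA; apply: le_trans (ler_wpM2l c0 Ip) _.
    rewrite -E1 le_eqVlt; apply/orP; left; apply/eqP; rewrite /e; field; lra.
  have h2 : 6 / nu * t `^ (- (3 / 4)) * (D * Bt * I2) <=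
      D / 4 * (t `^ (- (1 / 2)) * expR (Lam * t)).
    have c0 : 0 <= 6 / nu * t `^ (- (3 / 4)) * (D * Bt).
      by rewrite !mulr_ge0 ?invr_ge0 ?(ltW nu0) ?(ltW p34).
    rewrite mulrA; apply: le_trans (ler_wpM2l c0 IE) _.
    have q12 : 0 < t `^ (- (1 / 2)) by rewrite powR_gt0.
    rewrite /Bt; case: ltP => td.
      by rewrite !mulr0 mul0r !mulr_ge0 ?(ltW q12) ?(ltW ex0).
    have E3 : t `^ (- (3 / 4)) = t `^ (- (1 / 4)) * t `^ (- (1 / 2)).
      by rewrite -powRD; [congr powR; field|apply/implyP => _; rewrite gt_eqF].
    have tq : t `^ (- (1 / 4)) <= dq.
      by rewrite /dq !powRN lef_pV2 ?posrE ?powR_gt0// ge0_ler_powR ?nnegrE ?(ltW t0) ?(ltW del0)//; lra.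
    rewrite E3.
    have -> : 6 / nu * (t `^ (- (1 / 4)) * t `^ (- (1 / 2))) * (D * B) * (expR (Lam * t) / Lam) =
      (6 / nu * t `^ (- (1 / 4)) * B / Lam) * (D * (t `^ (- (1 / 2)) * expR (Lam * t))) by ring.
    have -> : D / 4 * (t `^ (- (1 / 2)) * expR (Lam * t)) =
      4^-1 * (D * (t `^ (- (1 / 2)) * expR (Lam * t))) by ring.
    rewrite ler_wpM2r ?mulr_ge0 ?(ltW q12) ?(ltW ex0)//.
    rewrite ler_pdivrMr//.
    have : 6 / nu * B * t `^ (- (1 / 4)) <= 6 / nu * B * dq.
      by rewrite ler_wpM2l// mulr_ge0// divr_ge0// ltW.
    rewrite /Lam; set nn := nu^-1; lra.
  by move: h1 h2; rewrite mulrDr; lra.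
have [M1 M10 HM1] := gp_bound gp; have [M2 M20 HM2] := gp_bound hp.
pose D0 := 2 * (M1 + M2); have D00 : 0 <= D0 by rewrite mulr_ge0// addr_ge0.
have init : P D0.
  move=> s sT; have s0 : 0 < s by case/andP: sT.
  have q0 : 0 < s `^ (- (1 / 2)) by rewrite powR_gt0.
  apply: (@le_trans _ _ (D0 * s `^ (- (1 / 2)))).
    rewrite -[leRHS](@avg_cst R d); apply: avg_le => [||x].
    - by apply: cper_sqn_field; [exact: cper_field_grad gp sT|exact: cper_field_grad hp sT].
    - exact: cper_cst.
    apply: le_trans (sqnB_le _ _) _.
    by have := HM1 s x sT; have := HM2 s x sT; rewrite /D0; lra.
  rewrite ler_wpM2l// ler_peMr ?(ltW q0)// -[leLHS]expR0 ler_expR.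
  by rewrite mulr_ge0// ltW.
have PN n : P (D0 / 2 ^+ n).
  elim: n => [|n IH]; first by rewrite expr0 divr1.
  by rewrite exprSr invfM mulrA; apply: step => //; rewrite divr_ge0// exprn_ge0.
have gap0 s : 0 < s <= T -> grad_gap g h s <= 0.
  move=> sT; set K := s `^ (- (1 / 2)) * expR (Lam * s).
  have K0 : 0 <= K by rewrite mulr_ge0 ?powR_ge0 ?expR_ge0.
  apply/ler_addgt0Pl => r r0; rewrite addr0.
  have [n Hn] : exists n, D0 * K / r < 2 ^+ n.
    exists (Num.truncn (D0 * K / r)).+1.
    have trn : (D0 * K / r) < (Num.truncn (D0 * K / r)).+1%:R by rewrite truncnS_gt.
    apply: lt_le_trans trn _; rewrite -natrX ler_nat ltnW// ltn_expl//.
  apply: le_trans (PN n s sT) _; rewrite -/K mulrAC ler_pdivrMr ?exprn_gt0//.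
  by move: Hn; rewrite ltr_pdivrMr// [_ * r]mulrC => /ltW.
move=> t x tT; rewrite (gE t x tT) (hE t x tT); apply: (congr1 (fun z => S t x + z)).
exact: duhamel_eq_of_gap nu0 gp hp gap0 tT.
Qed.

End uniqueness_bootstrap.

(** * Regularity contained in the solution class *)
Section mild_regularity.
Variables (R : realType) (d : nat).
Local Notation vec := 'rV[R]_d.
Implicit Types (g : R -> vec -> R) (s t T : R) (x y : vec).

Lemma ecvg0_within T t (F : R -> \bar R) e : 0 < e ->
  F s @[s --> within [set` `[0, T]] (nbhs t)] --> 0%E ->
  exists2 del, 0 < del & forall s, 0 <= s <= T -> `|s - t| < del -> (F s < e%:E)%E.
Proof.
move=> e0 cF.
have /cF : nbhs (0%:E : \bar R) [set y | (y < e%:E)%E].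
  exact: (@nbhs_open_ereal_lt _ 0 (fun=> e)).
rewrite /nbhs /= => /nbhs_ballP[del /= del0 H]; exists del => // s sT st.
apply: H; last by rewrite in_itv.
by rewrite /ball /= distrC.
Qed.

Lemma periodic_derive (i : 'I_d) (f : vec -> R) : torus_periodic f -> torus_periodic (partial i f).
Proof.
move=> pf x k; rewrite /partial /derive; apply: (congr1 (fun F : R -> R => lim (F @ 0^'))).
by apply/funext => h /=; rewrite addrA (pf _ k) pf.
Qed.

(** Change the coordinates one by one, with the mean value theorem at each step. *)
Lemma lipschitz_of_partials (f : vec -> R) B : 0 <= B ->
  (forall x i, derivable f x 'e_i) -> (forall x i, `|partial i f x| <= B) ->
  forall x y, `|f y - f x| <= B * \sum_i `|y 0 i - x 0 i|.
Proof.
move=> B0 df bf.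
have line x (i : 'I_d) h : `|f (x + h *: 'e_i) - f x| <= B * `|h|.
  have pos z r : 0 < r -> `|f (z + r *: 'e_i) - f z| <= B * r.
    move=> r0; have [s _ ->] := partial_mean_value z r0 (fun y => df y i).
    by rewrite normrM (gtr0_norm r0) ler_wpM2r// ltW.
  case: (ltgtP h 0) => [h0|h0|->].
  - have := pos (x + h *: 'e_i) (- h); rewrite oppr_gt0 => /(_ h0).
    by rewrite -addrA -scalerDl subrr scale0r addr0 distrC (ltr0_norm h0).
  - by rewrite (gtr0_norm h0); exact: pos.
  - by rewrite scale0r addr0 subrr normr0 mulr0.
move=> x y.
pose z n : vec := \row_j (if (j < n)%N then y 0 j else x 0 j).
have z0 : z 0%N = x by apply/rowP => j; rewrite mxE.
have zd : z d = y by apply/rowP => j; rewrite mxE ltn_ord.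
have zS (i : 'I_d) : z i.+1 = z i + (y 0 i - x 0 i) *: 'e_i.
  apply/rowP => j; rewrite !mxE /= ltnS eq_sym.
  case: (ltngtP j i) => ji; last 1 first.
  - by rewrite (ord_inj ji) eqxx mulr1 addrC subrK.
  - by rewrite (_ : (i == j) = false) ?mulr0 ?addr0//; apply/eqP => ij; rewrite ij ltnn in ji.
  - by rewrite (_ : (i == j) = false) ?mulr0 ?addr0//; apply/eqP => ij; rewrite ij ltnn in ji.
rewrite -{1}zd -{1}z0 -(telescope_sumr (fun n => f (z n)) (leq0n d)) big_mkord mulr_sumr.
apply: (le_trans (ler_norm_sum _ _ _)); apply: ler_sum => i _.
by rewrite zS; exact: line.
Qed.

Lemma continuous_of_partials (f : vec -> R) B : 0 <= B ->
  (forall x i, derivable f x 'e_i) -> (forall x i, `|partial i f x| <= B) -> continuous f.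
Proof.
move=> B0 df bf x; apply/(@cvgrPdist_le _ _ _ (nbhs x)) => e e0.
pose K := B * d%:R + 1; have K0 : 0 < K by rewrite ltr_wpDl// mulr_ge0.
have r0 : 0 < e / K by rewrite divr_gt0.
have := @nbhsx_ballx _ _ x _ r0; apply: (@filterS _ (nbhs x) (nbhs_filter x)) => y xy.
rewrite distrC; apply: le_trans (lipschitz_of_partials B0 df bf x y) _.
apply: (@le_trans _ _ (B * (d%:R * (e / K)))).
  rewrite ler_wpM2l//; apply: (@le_trans _ _ (\sum_(i < d) e / K)).
    by apply: ler_sum => i _; rewrite distrC; apply/ltW; exact: (xy.2 0 i).
  by rewrite sumr_const card_ord mulr_natl.
have -> : B * (d%:R * (e / K)) = e * ((B * d%:R) / K) by ring.
by rewrite ler_piMr ?(ltW e0)// ler_pdivrMr// mul1r /K lerDl.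
Qed.

Section weighted_gradient.
Variables (T : R) (g : R -> vec -> R).
Hypothesis T0 : 0 < T.
Hypothesis gP : forall t, t \in `[0, T] -> torus_periodic (g t).
Hypothesis gD : forall t x i, t \in `]0, T] -> derivable (g t) x 'e_i.
Hypothesis gC : C0tC0x T (fun t x => t `^ (4^-1) *: grad (g t) x).

Let G t x := t `^ (4^-1) *: grad (g t) x.

Let Gcont t : 0 <= t <= T -> continuous (G t).
Proof. by move=> tT; have [] := gC (t := t); rewrite ?in_itv. Qed.

Let Gunif t e : 0 <= t <= T -> 0 < e -> exists2 del, 0 < del &
  forall s, 0 <= s <= T -> `|s - t| < del -> forall x, sqn (G s x - G t x) <= e ^+ 2.
Proof.
move=> tT e0; have tI : t \in `[0, T] by rewrite in_itv.
have [_ /(ecvg0_within e0)[del del0 H]] := gC tI; exists del => // s sT st x.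
rewrite -euclid_norm_sqr lerXn2r ?nnegrE ?sqrtr_ge0 ?(ltW e0)// -lee_fin.
apply: le_trans (ltW (H s sT st)); rewrite /sup_norm.
by apply: ereal_sup_ubound; exists x.
Qed.

Let gradE t x : 0 < t -> grad (g t) x = t `^ (- (4^-1)) *: G t x.
Proof.
move=> t0; rewrite /G scalerA -powRD; last by apply/implyP => _; rewrite gt_eqF.
by rewrite addNr powRr0 scale1r.
Qed.

Let partialE t x i : 0 < t -> partial i (g t) x = t `^ (- (4^-1)) * G t x 0 i.
Proof. by move=> t0; have := gradE x t0 => /(congr1 (fun v : vec => v 0 i)); rewrite !mxE. Qed.

Let sqnE t x : 0 < t -> sqn (grad (g t) x) = sqn (G t x) * t `^ (- (1 / 2)).
Proof.
move=> t0; rewrite gradE// sqnZ mulrC powR_half_sqr//.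
by rewrite (_ : 2 * - (4^-1) = - (1 / 2))//; field.
Qed.

Let gradper t i : 0 < t <= T -> cper (partial i (g t)).
Proof.
move=> /andP[t0 tT]; have tT' : 0 <= t <= T by rewrite ltW.
have pp : torus_periodic (partial i (g t)) by apply: periodic_derive; apply: gP; rewrite in_itv.
have -> : partial i (g t) = fun x => t `^ (- (4^-1)) * G t x 0 i.
  by apply/funext => x; exact: partialE.
apply: cperZ; split=> [x|x k]; last by rewrite !mxE pp.
apply: (@continuous_comp _ _ _ (G t) (fun v : vec => v 0 i)); first exact: Gcont.
exact: coord_continuous.
Qed.

Let Gbounded t : 0 <= t <= T -> exists2 M, 0 <= M & forall x, sqn (G t x) <= M.
Proof.
move=> /andP[]; rewrite le_eqVlt => /orP[/eqP <-|t0] tT.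
  by exists 0 => // x; rewrite /G powR0// scale0r /sqn big1// => i _; rewrite mxE expr0n.
have tT' : 0 < t <= T by rewrite t0.
pose B i := projT1 (cid2 (cper_bounded (gradper i tT'))).
have HB i x : `|partial i (g t) x| <= B i by rewrite /B; case: cid2.
exists ((t `^ (4^-1)) ^+ 2 * \sum_i B i ^+ 2) => [|x].
  by rewrite mulr_ge0 ?sqr_ge0// sumr_ge0// => i _; exact: sqr_ge0.
rewrite /G sqnZ ler_wpM2l ?sqr_ge0//; apply: ler_sum => i _.
rewrite mxE -real_normK ?num_real//; have := HB i x; have := normr_ge0 (partial i (g t) x).
by move=> n0 nB; rewrite lerXn2r ?nnegrE// (le_trans n0).
Qed.

(** The weight t^(1/4) makes the weighted gradient vanish at 0, whence the smallness; the bound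
    is compactness of [0, T]. *)
Lemma grad_path_of_C0tC0x : grad_path T g.
Proof.
have uni t : 0 < t <= T -> exists2 M, 0 <= M & forall x, sqn (G t x) <= M.
  by move=> /andP[t0 tT]; apply: Gbounded; rewrite ltW.
split.
- move=> t tT; have /andP[t0 tT'] := tT.
  have [M M0 HM] := uni t tT; split; last by apply: gP; rewrite in_itv/= ltW.
  apply: (@continuous_of_partials _ (t `^ (- (4^-1)) * (1 + M))) => [||x i].
  + by rewrite mulr_ge0 ?powR_ge0 ?addr_ge0.
  + by move=> x i; apply: gD; rewrite in_itv.
  rewrite partialE// normrM (ger0_norm (powR_ge0 _ _)) ler_wpM2l ?powR_ge0//.
  have := le_trans (coord_sqr_le (G t x) i) (HM x); rewrite -real_normK ?num_real//.
  by have := sqr_ge0 (1 - `|G t x 0 i|); have := normr_ge0 (G t x 0 i); nra.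
- by move=> t x i tT; apply: gD; rewrite in_itv.
- by move=> t i tT; exact: gradper.
- have /compact_near_coveringP cov := @segment_compact R 0 T.
  have [M [Mr HM]] : \forall M \near +oo%R,
      `[0, T] `<=` (fun t => t \in `[0, T] -> forall x, sqn (G t x) <= M).
    apply: cov => t /=; rewrite in_itv => tT; have [M M0 HM] := Gbounded tT.
    have [del del0 Hd] := Gunif tT ltr01.
    near=> s r => /=; rewrite in_itv => sT x; rewrite -[G s x](subrK (G t x)).
    apply: le_trans (sqnD_le _ _) _.
    have : sqn (G s x - G t x) <= 1 ^+ 2.
      by apply: Hd => //; near: s; have := @nbhsx_ballx _ _ t _ del0; apply: filterS => s' /=;
        rewrite /ball /= distrC.
    have := HM x; have : 2 * (1 + M) <= r by near: r; apply: nbhs_pinfty_ge; exact: num_real.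
    lra.
  have [N [N0 HN]] : exists N, 0 <= N /\ forall t x, 0 < t <= T -> sqn (G t x) <= N.
    exists (Num.max 0 (M + 1)); rewrite le_max lexx; split=> // t x /andP[t0 tT].
    apply: (@le_trans _ _ (M + 1)); last by rewrite le_max lexx orbT.
    by apply: (HM (M + 1)) => /=; rewrite ?ltrDl ?in_itv /= ?(ltW t0).
  exists N => // t x tT; have /andP[t0 _] := tT.
  by rewrite sqnE// ler_wpM2r ?powR_ge0 ?HN.
- move=> e e0; have r0 : 0 < Num.sqrt e by rewrite sqrtr_gt0.
  have [||del del0 H] := @Gunif 0 (Num.sqrt e); rewrite ?lexx ?(ltW T0)//.
  exists del => // t x /andP[t0 tT] td; rewrite sqnE// ler_wpM2r ?powR_ge0//.
  have := H t _ _ x; rewrite sqr_sqrtr ?(ltW e0)// subr0 /G powR0// scale0r subr0.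
  by apply; rewrite ?(ltW t0) ?gtr0_norm.
- move=> t e tT e0; have /andP[t0 tT'] := tT.
  have [M M0 HM] := uni t tT.
  pose p := t `^ (- (4^-1)); have p0 : 0 < p by rewrite powR_gt0.
  pose a := Num.min 1 (e / (2 * (M + 1))).
  have a0 : 0 < a by rewrite lt_min ltr01 divr_gt0// mulr_gt0// ltr_wpDl.
  have b0 : 0 < e / (2 * (p + 1)) by rewrite divr_gt0// mulr_gt0// ltr_wpDl// ltW.
  have tT'' : 0 <= t <= T by rewrite ltW.
  have [d1 d10 H1] := Gunif tT'' b0.
  have /cvgrPdist_lt/(_ a a0)/nbhs_ballP[d2 /= d20 H2] := @powR_continuous R (- (4^-1)) t t0.
  exists (Num.min d1 d2); first by rewrite lt_min d10.
  move=> s /andP[s0 sT]; rewrite lt_min => /andP[sd1 sd2] x i.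
  rewrite !partialE//; set u := G s x 0 i; set v := G t x 0 i; rewrite -/p.
  set q := s `^ _.
  have qp : `|p - q| < a by apply: H2; rewrite /ball /= distrC.
  have uv : `|u - v| <= e / (2 * (p + 1)).
    rewrite -(ler_sqr (x := `|u - v|)) ?nnegrE ?(ltW b0)// real_normK ?num_real//.
    have := H1 s _ sd1 x; rewrite (ltW s0) sT => /(_ isT); apply: le_trans.
    by have := coord_sqr_le (G s x - G t x) i; rewrite [X in X ^+ 2]mxE [X in (_ + X) ^+ 2]mxE.
  have vM : `|v| <= M + 1.
    have := le_trans (coord_sqr_le (G t x) i) (HM x); rewrite -/v -real_normK ?num_real//.
    by have := sqr_ge0 (1 - `|v|); have := normr_ge0 v; nra.
  have -> : q * u - p * v = q * (u - v) - (p - q) * v by ring.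
  apply: le_trans (ler_normB _ _) _; rewrite !normrM.
  have q0 : 0 < q by rewrite powR_gt0.
  have a1 : a <= 1 by rewrite ge_min lexx.
  have a2 : a <= e / (2 * (M + 1)) by rewrite ge_min lexx orbT.
  have qp1 : `|q| <= p + 1.
    have := ler_norm (q - p); rewrite distrC (gtr0_norm q0); lra.
  have E1 : (p + 1) * (e / (2 * (p + 1))) = e / 2 by field; lra.
  have E2 : (e / (2 * (M + 1))) * (M + 1) = e / 2 by field; lra.
  rewrite [leRHS](splitr e) -{1}E1 -E2; apply: lerD; apply: ler_pM => //.
  by apply: ltW; apply: lt_le_trans qp a2.
Unshelve. all: by end_near.
Qed.

End weighted_gradient.

Lemma mild_grad_path nu (h0 : vec -> R) T (h : R -> vec -> R) : 0 < T ->
  mild_solution_on nu h0 T h -> grad_path T h.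
Proof. by move=> T0 [hP hD [_ hC _] _]; exact: grad_path_of_C0tC0x. Qed.

End mild_regularity.

(** * Functions of one coordinate *)
Section one_dimensional_profiles.
Variables (R : realType) (d : nat) (i0 : 'I_d) (lam : nat).
Hypothesis lam0 : (0 < lam)%N.
Local Notation vec := 'rV[R]_d.
Local Notation freq := 'rV[int]_d.
Local Notation profile := (seq (R * int)).
Implicit Types (P Q : profile) (m : int) (x y : vec).

Definition wave m : freq := (m * lam%:Z) *: ('e_i0 : freq).

Definition wnum m : R := (m * lam%:Z)%:~R.

(** A profile is a list of cosine modes of the slope of a function of one coordinate; dividing
    by the frequency turns it into the function itself. *)
Definition slope P : vec -> R := tp [seq (p.1, 0, wave p.2) | p <- P].

Definition height P : vec -> R := tp [seq (0, p.1 / wnum p.2, wave p.2) | p <- P].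

(** The exponential weight makes the norm submultiplicative for the product of profiles, and
    dominates every power of the frequency. *)
Definition weight m : R := expR (`|m|%:~R).

Definition wnorm P : R := \sum_(p <- P) `|p.1| * weight p.2.

Let lamR : 1 <= lam%:R :> R. Proof. by rewrite ler1n. Qed.

Lemma freq_dot_wave m x : freq_dot (wave m) x = wnum m * x 0 i0.
Proof. exact: freq_dot_axis. Qed.

Lemma wnum0 : wnum 0 = 0.
Proof. by rewrite /wnum mul0r. Qed.

Lemma wnumD m n : wnum (m + n) = wnum m + wnum n.
Proof. by rewrite /wnum mulrDl intrD. Qed.

Lemma wnumN m : wnum (- m) = - wnum m.
Proof. by rewrite /wnum mulNr intrN. Qed.

Lemma wave_coord m i : wave m 0 i = if i == i0 then m * lam%:Z else 0.
Proof. by rewrite /wave !mxE /=; case: eqP => _; rewrite ?mulr1 ?mulr0. Qed.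

Lemma wave_axis m : (wave m 0 i0)%:~R = wnum m.
Proof. by rewrite wave_coord eqxx. Qed.

Lemma freq_sq_wave m : freq_sq R (wave m) = wnum m ^+ 2.
Proof.
rewrite /freq_sq (bigD1 i0)//= wave_coord eqxx big1 ?addr0// => i /negPf ii0.
by rewrite wave_coord ii0 expr0n.
Qed.

Lemma weight_ge1 m : 1 <= weight m.
Proof. by rewrite -[leLHS]expR0 ler_expR ler0z. Qed.

Lemma weight_gt0 m : 0 < weight m. Proof. exact: expR_gt0. Qed.

Lemma weightD m n : weight (m + n) <= weight m * weight n.
Proof. by rewrite -expRD ler_expR -rmorphD ler_int ler_normD. Qed.

Lemma weightN m : weight (- m) = weight m.
Proof. by rewrite /weight normrN. Qed.

Lemma wnum_norm m : `|wnum m| = lam%:R * `|m|%:~R.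
Proof. by rewrite /wnum intrM normrM mulrC -!intr_norm. Qed.

Lemma wnum_ge1 m : m != 0 -> 1 <= `|wnum m|.
Proof.
move=> m0; rewrite wnum_norm -[leLHS]mulr1; apply: ler_pM => //.
by rewrite -[1](mulr1z 1) ler_int; lia.
Qed.

Lemma wnum_le m : `|wnum m| <= lam%:R * weight m.
Proof.
rewrite wnum_norm ler_wpM2l//; apply: le_trans (expR_ge1Dx _).
by rewrite lerDr.
Qed.

(** This includes m = 0, where the inverse of 0 is 0. *)
Lemma div_wnum_le (r : R) m : `|r / wnum m| <= `|r|.
Proof.
rewrite normrM normfV; have [->|m0] := eqVneq m 0.
  by rewrite /wnum mul0r normr0 invr0 mulr0.
by rewrite ler_pdivrMr ?ler_peMr ?wnum_ge1// (lt_le_trans ltr01)// wnum_ge1.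
Qed.

Lemma wnorm_ge0 P : 0 <= wnorm P.
Proof. by apply: sumr_ge0 => p _; rewrite mulr_ge0// ltW// weight_gt0. Qed.

Lemma slopeE P x : slope P x = \sum_(p <- P) p.1 * cos (freq_dot (wave p.2) x).
Proof. by rewrite /slope /tp big_map; apply: eq_bigr => p _ /=; rewrite mul0r addr0. Qed.

Lemma heightE P x : height P x = \sum_(p <- P) p.1 / wnum p.2 * sin (freq_dot (wave p.2) x).
Proof. by rewrite /height /tp big_map; apply: eq_bigr => p _ /=; rewrite mul0r add0r. Qed.

Lemma slope_cat P Q x : slope (P ++ Q) x = slope P x + slope Q x.
Proof. by rewrite !slopeE big_cat. Qed.

Lemma height_cat P Q x : height (P ++ Q) x = height P x + height Q x.
Proof. by rewrite !heightE big_cat. Qed.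

Lemma slope_bound P x : `|slope P x| <= wnorm P.
Proof.
rewrite slopeE; apply: (le_trans (ler_norm_sum _ _ _)); apply: ler_sum => p _.
by rewrite normrM ler_pM// (le_trans (cos_max _)) ?weight_ge1.
Qed.

Lemma height_bound P x : `|height P x| <= wnorm P.
Proof.
rewrite heightE; apply: (le_trans (ler_norm_sum _ _ _)); apply: ler_sum => p _.
by rewrite normrM ler_pM ?div_wnum_le// (le_trans (sin_max _)) ?weight_ge1.
Qed.

Lemma sine_taylor (r w u h : R) (b : bool) : w != 0 ->
  `|r / w * sin (h * (if b then w else 0) + u) - r / w * sin u -
    h * (if b then r * cos u else 0)| <= 2 * `|r| * `|w| * h ^+ 2.
Proof.
move=> w0; have wn : 0 < `|w| by rewrite normr_gt0.
case: b => /=; last first.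
  rewrite !mulr0 add0r subrr subr0 normr0.
  by rewrite mulr_ge0 ?sqr_ge0// !mulr_ge0.
have := trig_taylor 0 (r / w) u (h * w).
rewrite !mul0r !add0r subr0 normr0 add0r.
have -> : h * w * (r / w * cos u) = h * (r * cos u) by field.
move=> /le_trans; apply; rewrite normrM normfV exprMn -[w ^+ 2]real_normK ?num_real//.
by rewrite le_eqVlt; apply/orP; left; apply/eqP; field; exact: lt0r_neq0.
Qed.

(** The error depends on the profile through its norm alone, and thus survives the limit of the
    iteration. *)
Lemma height_taylor P i x (h : R) : all (fun p => p.2 != 0) P ->
  `|height P (h *: 'e_i + x) - height P x - h * (if i == i0 then slope P x else 0)| <=
    2 * lam%:R * wnorm P * h ^+ 2.
Proof.
move=> P0; rewrite !heightE slopeE.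
have -> : h * (if i == i0 then \sum_(p <- P) p.1 * cos (freq_dot (wave p.2) x) else 0) =
    \sum_(p <- P) h * (if i == i0 then p.1 * cos (freq_dot (wave p.2) x) else 0).
  by case: eqP => _; rewrite ?mulr_sumr// mulr0 big1// => p _; rewrite mulr0.
rewrite -!sumrB /wnorm mulr_sumr mulr_suml; apply: (le_trans (ler_norm_sum _ _ _)).
elim: P P0 => [|[r m] P IH] /=; first by rewrite !big_nil.
move=> /andP[m0 /IH{}IH]; rewrite !big_cons; apply: lerD => //=.
have w1 := wnum_ge1 m0; have w0 : wnum m != 0 by rewrite -normr_gt0 (lt_le_trans ltr01).
rewrite freq_dotDr freq_dotZr freq_dot_delta wave_coord.
have -> : ((if i == i0 then m * lam%:Z else 0)%:~R : R) = if i == i0 then wnum m else 0.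
  by case: ifP.
apply: le_trans (sine_taylor _ _ _ _ w0) _.
rewrite (_ : 2 * lam%:R * (`|r| * weight m) * h ^+ 2 = 2 * `|r| * (lam%:R * weight m) * h ^+ 2).
  by rewrite ler_wpM2r ?sqr_ge0// ler_wpM2l ?mulr_ge0// wnum_le.
by ring.
Qed.

Lemma cper_slope P : cper (slope P). Proof. exact: cper_tp. Qed.
Lemma cper_height P : cper (height P). Proof. exact: cper_tp. Qed.

End one_dimensional_profiles.

(** * Sobolev norms *)
Section sobolev_limits.
Variables (R : realType) (d : nat) (i0 : 'I_d) (lam : nat).
Hypothesis lam0 : (0 < lam)%N.
Local Notation vec := 'rV[R]_d.
Local Notation freq := 'rV[int]_d.
Local Notation profile := (seq (R * int)).
Implicit Types (P Q : profile) (m : int) (x y : vec) (f : vec -> R).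
Local Notation wave := (@wave d i0 lam).
Local Notation wnum := (@wnum R lam).
Local Notation height := (@height R d i0 lam).

(** The n-th power of 1 + x <= n (1 + x/n) <= n e^(x/n). *)
Lemma poly_le_exp (n : nat) (x : R) : (0 < n)%N -> 0 <= x -> (1 + x) ^+ n <= n%:R ^+ n * expR x.
Proof.
move=> n0 x0; have nR : 0 < n%:R :> R by rewrite ltr0n.
have -> : expR x = expR (x / n%:R) ^+ n.
  by rewrite -expRM_natl -mulr_natl mulrCA mulfV ?mulr1// gt_eqF.
rewrite -exprMn lerXn2r ?nnegrE ?addr_ge0 ?mulr_ge0 ?expR_ge0//.
apply: le_trans (ler_wpM2l (ltW nR) (expR_ge1Dx _)).
rewrite mulrDr mulr1 mulrCA mulfV ?gt_eqF// mulr1 lerD2r.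
by rewrite ler1n.
Qed.

Lemma sum_sqr_le_sqr_sum (I : Type) (A : seq I) (y : I -> R) : (forall k, 0 <= y k) ->
  \sum_(k <- A) y k ^+ 2 <= (\sum_(k <- A) y k) ^+ 2.
Proof.
move=> y0; elim: A => [|k A IH]; first by rewrite !big_nil expr0n.
rewrite !big_cons; have S0 : 0 <= \sum_(j <- A) y j by exact: sumr_ge0.
by have := y0 k; nra.
Qed.

(** The square root of the weight in the Sobolev norm, as it multiplies the coefficients in
    an l^1 norm. *)
Definition sobolev_weight (s : R) (k : freq) : R := (1 + freq_sq R k) `^ (s / 2).

Lemma sobolev_weight_ge0 s k : 0 <= sobolev_weight s k.
Proof. exact: powR_ge0. Qed.

Lemma sobolev_weightN s k : sobolev_weight s (- k) = sobolev_weight s k.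
Proof. by rewrite /sobolev_weight freq_sqN. Qed.

Lemma sobolev_weight_le s : exists2 K, 0 <= K &
  forall m, sobolev_weight s (wave m) <= K * weight R m.
Proof.
pose n := (Num.truncn (s / 2)).+1; pose p := (n * 2)%N.
have sn : s / 2 <= n%:R by apply/ltW; rewrite truncnS_gt.
exists ((1 + lam%:R) ^+ p * p%:R ^+ p) => [|m].
  by apply: mulr_ge0; apply: exprn_ge0; rewrite ?ler0n// addr_ge0.
have M0 : 0 <= `|m|%:~R :> R by rewrite ler0z.
have b1 : 1 <= 1 + freq_sq R (wave m) by rewrite lerDl freq_sq_ge0.
apply: (@le_trans _ _ ((1 + freq_sq R (wave m)) ^+ n)).
  by rewrite -powR_mulrn ?(le_trans ler01)// ler_powR.
apply: (@le_trans _ _ (((1 + lam%:R) * (1 + `|m|%:~R)) ^+ p)).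
  rewrite /p mulnC exprM lerXn2r ?nnegrE ?sqr_ge0 ?(le_trans ler01)//.
  rewrite freq_sq_wave -[_ ^+ 2]real_normK ?num_real// wnum_norm.
  have l0 : 0 <= lam%:R :> R by [].
  by move: M0 l0; move: (`|m|%:~R) (lam%:R) => a b a0 b0; nra.
rewrite exprMn -mulrA ler_wpM2l ?exprn_ge0 ?addr_ge0//.
exact: poly_le_exp.
Qed.

Let cabs f k : R := `|fcos f k| + `|fsin f k|.

Lemma height_coef_sum s K (A : seq freq) P : uniq A ->
  (forall m, sobolev_weight s (wave m) <= K * weight R m) ->
  \sum_(k <- A) sobolev_weight s k * cabs (height P) k <= K * wnorm P.
Proof.
move=> uA HK.
have K0 : 0 <= K.
  have := le_trans (sobolev_weight_ge0 s _) (HK 0); rewrite pmulr_lge0//.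
  exact: expR_gt0.
have cab k : cabs (height P) k <=
    \sum_(p <- P) `|p.1| * (((k == wave p.2)%:R + (k == - wave p.2)%:R) / 2).
  rewrite /cabs /height fcos_tp fsin_tp !big_map big1 ?normr0 ?add0r => [|p _]; last by rewrite mul0r.
  apply: (le_trans (ler_norm_sum _ _ _)); apply: ler_sum => p _ /=.
  rewrite normrM; apply: ler_pM => //; first exact: div_wnum_le.
  rewrite normrM [`|2^-1|]ger0_norm// ler_wpM2r// (le_trans (ler_normB _ _))//.
  by rewrite !ger0_norm.
apply: (@le_trans _ _ (\sum_(k <- A) \sum_(p <- P) sobolev_weight s k *
    (`|p.1| * (((k == wave p.2)%:R + (k == - wave p.2)%:R) / 2)))).
  by apply: ler_sum => k _; rewrite -mulr_sumr ler_wpM2l ?sobolev_weight_ge0.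
rewrite exchange_big /= /wnorm mulr_sumr; apply: ler_sum => p _.
have delta (l : freq) : sobolev_weight s l = sobolev_weight s (wave p.2) ->
    \sum_(k <- A) (k == l)%:R * sobolev_weight s k <= K * weight R p.2.
  move=> El; have [lA|lA] := boolP (l \in A).
    by rewrite big_seq_delta// El.
  rewrite big_seq big1 ?mulr_ge0 ?(ltW (weight_gt0 _ _))// => k kA.
  by case: eqP => [kl|_]; [rewrite -kl kA in lA|rewrite mul0r].
have d1 := delta _ erefl; have d2 := delta _ (sobolev_weightN s (wave p.2)).
have -> : \sum_(k <- A) sobolev_weight s k *
     (`|p.1| * (((k == wave p.2)%:R + (k == - wave p.2)%:R) / 2)) =
   `|p.1| / 2 * (\sum_(k <- A) (k == wave p.2)%:R * sobolev_weight s k +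
     \sum_(k <- A) (k == - wave p.2)%:R * sobolev_weight s k).
  by rewrite -big_split/= mulr_sumr; apply: eq_bigr => k _; ring.
rewrite mulrCA -mulrA ler_wpM2l//; lra.
Qed.

(** A bound on the l^1 norm of the weighted coefficients survives uniform limits and dominates
    the Sobolev norm, which is an l^2 norm. *)
Lemma sobolev_norm_limit s K f (P : nat -> profile) M :
  (forall m, sobolev_weight s (wave m) <= K * weight R m) -> cper f ->
  (forall e, 0 < e -> exists n, forall x, `|f x - height (P n) x| <= e) ->
  (forall n, wnorm (P n) <= M) -> (sobolev_norm s f <= (K * M)%:E)%E.
Proof.
move=> HK cf appr PM.
have K0 : 0 <= K.
  have := le_trans (sobolev_weight_ge0 s _) (HK 0); rewrite pmulr_lge0//.
  exact: expR_gt0.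
have M0 : 0 <= M := le_trans (wnorm_ge0 _) (PM 0%N).
have fin (A : seq freq) : uniq A -> \sum_(k <- A) sobolev_weight s k * cabs f k <= K * M.
  move=> uA; apply/ler_addgt0Pl => e e0.
  pose S := 2 * \sum_(k <- A) sobolev_weight s k + 1.
  have S0 : 0 < S.
    by rewrite ltr_wpDl// mulr_ge0// sumr_ge0// => k _; exact: sobolev_weight_ge0.
  have [n Hn] := appr (e / S) (divr_gt0 e0 S0).
  have cdiff : cper (fun x => f x - height (P n) x) by apply: cperB => //; exact: cper_height.
  have cb k : cabs f k <= 2 * (e / S) + cabs (height (P n)) k.
    have := fcos_bound k cdiff Hn; have := fsin_bound k cdiff Hn.
    rewrite fcosB ?fsinB//; try exact: cper_height.
    have := ler_normD (fcos f k - fcos (height (P n)) k) (fcos (height (P n)) k).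
    have := ler_normD (fsin f k - fsin (height (P n)) k) (fsin (height (P n)) k).
    by rewrite !subrK /cabs; lra.
  apply: (@le_trans _ _ (\sum_(k <- A) (sobolev_weight s k * (2 * (e / S)) +
      sobolev_weight s k * cabs (height (P n)) k))).
    by apply: ler_sum => k _; rewrite -mulrDr ler_wpM2l ?sobolev_weight_ge0.
  rewrite big_split/= -mulr_suml.
  have h1 := le_trans (height_coef_sum (P n) uA HK) (ler_wpM2l K0 (PM n)).
  apply: lerD => //; have -> : (\sum_(k <- A) sobolev_weight s k) * (2 * (e / S)) =
    e * ((2 * \sum_(k <- A) sobolev_weight s k) / S) by ring.
  by rewrite ler_piMr ?(ltW e0)// ler_pdivrMr// mul1r /S lerDl.
rewrite /sobolev_norm.
have KM0 : 0 <= K * M by rewrite mulr_ge0.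
have -> : K * M = ((K * M) ^+ 2) `^ 2^-1.
  by rewrite powR12_sqrt ?sqr_ge0// sqrtr_sqr ger0_norm.
rewrite -poweR_EFin; apply: gt0_ler_poweR => //.
- by rewrite in_itv /= leey andbT esum_ge0// => k _; rewrite lee_fin mulr_ge0 ?powR_ge0 ?sqr_ge0.
- by rewrite in_itv /= leey andbT lee_fin sqr_ge0.
apply: ge_ereal_sup => _ [A [finA _] <-].
rewrite fsbig_finite//= sumEFin lee_fin; set B := finmap.enum_fset _.
have uB : uniq B by exact: finmap.fset_uniq.
apply: (@le_trans _ _ ((\sum_(k <- B) sobolev_weight s k * cabs f k) ^+ 2)); last first.
  rewrite lerXn2r ?nnegrE//; last exact: fin.
  by apply: sumr_ge0 => k _; rewrite mulr_ge0 ?sobolev_weight_ge0 ?addr_ge0.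
have sq (k : freq) : (1 + freq_sq R k) `^ s * Normc.normc (fourier_coef f k) ^+ 2 <=
    (sobolev_weight s k * cabs f k) ^+ 2.
  have b0 : 0 < 1 + freq_sq R k by rewrite ltr_pwDl// freq_sq_ge0.
  rewrite exprMn /sobolev_weight powR_half_sqr//.
  rewrite (_ : 2 * (s / 2) = s); last by field.
  rewrite ler_wpM2l ?powR_ge0//.
  rewrite /Normc.normc /fourier_coef sqr_sqrtr ?addr_ge0 ?sqr_ge0//.
  rewrite -[_ * torus_int (fun x => f x * cos _)]/(fcos f k).
  rewrite -[_ * torus_int (fun x => f x * sin _)]/(fsin f k) sqrrN /cabs.
  rewrite -(real_normK (num_real (fcos f k))) -(real_normK (num_real (fsin f k))).
  by have := normr_ge0 (fcos f k); have := normr_ge0 (fsin f k); nra.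
apply: le_trans (ler_sum _ (fun k _ => sq k)) _.
by apply: sum_sqr_le_sqr_sum => k; rewrite mulr_ge0 ?sobolev_weight_ge0 ?addr_ge0.
Qed.

End sobolev_limits.

(** * Modes evolving in time *)
Section modes.
Variables (R : realType) (d : nat) (i0 : 'I_d) (lam : nat).
Hypothesis lam0 : (0 < lam)%N.
Local Notation vec := 'rV[R]_d.
Local Notation freq := 'rV[int]_d.
Local Notation mu := (@lebesgue_measure R).
Local Notation wave := (@wave d i0 lam).
Local Notation wnum := (@wnum R lam).
Local Notation slope := (@slope R d i0 lam).
Local Notation height := (@height R d i0 lam).
Implicit Types (s t nu k : R) (x : vec) (f : R -> R).

Lemma continuous_integrable f a b : continuous f -> mu.-integrable `[a, b] (EFin \o f).
Proof.
move=> cf; apply: continuous_compact_integrable; first exact: segment_compact.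
exact: continuous_subspaceT.
Qed.

Lemma continuous_integrable_oo f a b : continuous f -> mu.-integrable `]a, b[ (EFin \o f).
Proof.
move=> cf; apply: integrableS (continuous_integrable a b cf) => //.
exact: subset_itv_oo_cc.
Qed.

Lemma primitive_continuous f : continuous f ->
  continuous (fun t : R => \int[mu]_(s in `]0, `|t|[) f s).
Proof.
move=> cf; pose G (u : R) := \int[mu]_(s in `]-1, u]) f s.
(* The base point -1 leaves room for the fundamental theorem of calculus at 0. *)
have GE (t : R) : \int[mu]_(s in `]0, `|t|[) f s = G `|t| - G 0.
  rewrite Rintegral_itv_bndo_bndc; last exact: continuous_integrable_oo.
  rewrite /G Rintegral_itvB//.
  - apply: integrableS (continuous_integrable (-1) `|t| cf) => //.
    exact: subset_itv_oc_cc.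
  - by rewrite bnd_simp lerN10.
  - by rewrite bnd_simp.
have cG (u : R) : 0 <= u -> {for u, continuous G}.
  move=> u0; have uu : u < u + 1 by rewrite ltrDl.
  have ig : mu.-integrable `]-1, (u + 1)] (EFin \o f).
    apply: integrableS (continuous_integrable (-1) (u + 1) cf) => //.
    exact: subset_itv_oc_cc.
  have u1 : (BRight (-1 : R) < BRight u)%O by rewrite bnd_simp (lt_le_trans _ u0)// ltrN10.
  have [dG _] := continuous_FTC1 uu ig u1 (cf u).
  by apply: differentiable_continuous; apply/derivable1_diffP.
move=> t; under eq_fun do rewrite GE.
apply: cvgB; last exact: cvg_cst.
apply: (@continuous_comp _ _ _ (fun t : R => `|t|) G); first exact: norm_continuous.
exact: cG.
Qed.

Lemma Rintegral_sum_continuous (I : Type) (A : seq I) (G : I -> R -> R) a b :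
  (forall i, continuous (G i)) ->
  \int[mu]_(s in `]a, b[) (\sum_(i <- A) G i s) = \sum_(i <- A) \int[mu]_(s in `]a, b[) G i s.
Proof.
move=> cG; elim: A => [|i A IH].
  by under eq_Rintegral do rewrite big_nil; rewrite big_nil /Rintegral integral0.
under eq_Rintegral do rewrite big_cons.
rewrite big_cons RintegralD//; first by rewrite IH.
  exact: continuous_integrable_oo.
apply: continuous_integrable_oo => s; apply: cvg_sumr => j; exact: cG.
Qed.

(** The solution at time |t| of c' = - k c - q f, c(0) = 0; the absolute value spares a
    discussion of one-sided continuity at 0. *)
Definition duhamel_amp k q f t : R :=
  - (q * (expR (- (k * `|t|)) * \int[mu]_(s in `]0, `|t|[) (expR (k * s) * f s))).

Let cont_exp k : continuous (fun s : R => expR (k * s)).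
Proof.
move=> s; apply: (@continuous_comp _ _ _ (fun s : R => k * s) expR).
  exact: mulrl_continuous.
exact: continuous_expR.
Qed.

Let cont_mul f g : continuous f -> continuous g -> continuous (fun s : R => f s * g s).
Proof. by move=> cf cg s; apply: cvgM; [exact: cf|exact: cg]. Qed.

Lemma duhamel_amp_continuous k q f : continuous f -> continuous (duhamel_amp k q f).
Proof.
move=> cf t; apply: cvgN; apply: cvgM; first exact: cvg_cst.
apply: (@cvgM _ _ _ _ (fun t : R => expR (- (k * `|t|)))).
  apply: (@continuous_comp _ _ _ (fun t : R => - (k * `|t|)) expR); last exact: continuous_expR.
  apply: cvgN; apply: cvgM; [exact: cvg_cst|exact: norm_continuous].
by apply: primitive_continuous; exact: cont_mul.
Qed.

Lemma duhamel_amp_le k q f B t : 0 < k -> continuous f -> (forall s, `|f s| <= B) ->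
  `|duhamel_amp k q f t| <= `|q| / k * B.
Proof.
move=> k0 cf fB; have B0 : 0 <= B := le_trans (normr_ge0 _) (fB 0).
rewrite /duhamel_amp normrN normrM -mulrA ler_wpM2l// normrM ger0_norm ?expR_ge0//.
have [t0|t0] := eqVneq t 0.
  rewrite t0 normr0 set_itv_ge -?leNgt ?bnd_simp// Rintegral_set0 normr0 mulr0.
  by rewrite mulr_ge0// invr_ge0 ltW.
have tn : 0 < `|t| by rewrite normr_gt0.
have [iE IE] := integral_expR tn k0.
have mD : measurable [set` `]0 : R, `|t|[] by exact: measurable_itv.
have ce : continuous (fun s => expR (k * s) * f s) by exact: cont_mul.
have cn : continuous (fun s => `|expR (k * s) * f s|).
  move=> s; apply: (@continuous_comp _ _ _ (fun s => expR (k * s) * f s) Num.norm); first exact: ce.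
  exact: norm_continuous.
have h : `|\int[mu]_(s in `]0, `|t|[) (expR (k * s) * f s)| <= B * (expR (k * `|t|) / k).
  apply: (@le_trans _ _ (\int[mu]_(s in `]0, `|t|[) `|expR (k * s) * f s|)).
    by apply: le_normr_Rintegral => //; exact: continuous_integrable_oo.
  apply: le_trans (ler_wpM2l B0 IE).
  rewrite -RintegralZl//; apply: le_Rintegral => //.
  - exact: continuous_integrable_oo.
  - exact: integrable_scale.
  - by move=> s _; rewrite normrM ger0_norm ?expR_ge0// mulrC ler_wpM2r ?expR_ge0.
apply: le_trans (ler_wpM2l (expR_ge0 _) h) _.
have -> : expR (- (k * `|t|)) * (B * (expR (k * `|t|) / k)) =
    (expR (- (k * `|t|)) * expR (k * `|t|)) * (B / k) by ring.
by rewrite -expRD addNr expR0 mul1r mulrC.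
Qed.

(** With continuity and a bound inside the record, lists of modes can be multiplied and
    integrated without side conditions. *)
Record mode := Mode {
  amp : R -> R;
  bnd : R;
  num : int;
  amp_continuous : continuous amp;
  amp_le : forall t, `|amp t| <= bnd }.

Implicit Types (a b : mode) (L M : seq mode) (m : int).

Definition prof L t : seq (R * int) := [seq (amp a t, num a) | a <- L].

Definition mnorm L : R := \sum_(a <- L) bnd a * weight R (num a).

Lemma bnd_ge0 a : 0 <= bnd a. Proof. exact: le_trans (normr_ge0 _) (amp_le a 0). Qed.

Lemma mnorm_ge0 L : 0 <= mnorm L.
Proof. by apply: sumr_ge0 => a _; rewrite mulr_ge0 ?bnd_ge0// ltW// weight_gt0. Qed.

Lemma mnorm_cat L M : mnorm (L ++ M) = mnorm L + mnorm M.
Proof. by rewrite /mnorm big_cat. Qed.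

Lemma wnorm_prof L t : wnorm (prof L t) <= mnorm L.
Proof.
rewrite /wnorm big_map; apply: ler_sum => a _.
by rewrite ler_wpM2r ?amp_le// ltW// weight_gt0.
Qed.

Lemma prof_cat L M t : prof (L ++ M) t = prof L t ++ prof M t.
Proof. exact: map_cat. Qed.

Lemma opp_continuous a : continuous (fun t => - amp a t).
Proof. by move=> t; apply: cvgN; exact: amp_continuous. Qed.

Lemma opp_le a t : `|- amp a t| <= bnd a.
Proof. by rewrite normrN amp_le. Qed.

Definition opp_mode a : mode := Mode (num a) (@opp_continuous a) (@opp_le a).

Lemma prod_continuous a b : continuous (fun t => 2^-1 * (amp a t * amp b t)).
Proof.
move=> t; apply: cvgM; first exact: cvg_cst.
by apply: cvgM; exact: amp_continuous.
Qed.

Lemma prod_le a b t : `|2^-1 * (amp a t * amp b t)| <= 2^-1 * (bnd a * bnd b).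
Proof. by rewrite !normrM [`|2^-1|]ger0_norm// ler_wpM2l// ler_pM ?amp_le. Qed.

(** The amplitude common to the two modes, at the sum and at the difference of the frequencies,
    into which a product of cosines splits. *)
Definition prod_mode m a b : mode := Mode m (@prod_continuous a b) (@prod_le a b).

Definition mul L M : seq mode :=
  [seq prod_mode (num a + num b) a b | a <- L, b <- M] ++
  [seq prod_mode (num a - num b) a b | a <- L, b <- M].

Definition opp L : seq mode := map opp_mode L.

Lemma mnorm_opp L : mnorm (opp L) = mnorm L.
Proof. by rewrite /mnorm big_map. Qed.

Lemma slope_opp L t x : slope (prof (opp L) t) x = - slope (prof L t) x.
Proof.
rewrite !slopeE !big_map -sumrN; apply: eq_bigr => a _ /=.
by rewrite mulNr.
Qed.

Lemma mnorm_mul L M : mnorm (mul L M) <= mnorm L * mnorm M.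
Proof.
rewrite mnorm_cat /mnorm !big_allpairs_dep -big_split/= mulr_suml; apply: ler_sum => a _.
rewrite -big_split/= mulr_sumr; apply: ler_sum => b _ /=.
have h1 := weightD R (num a) (num b); have h2 := weightD R (num a) (- num b).
rewrite weightN in h2; have p0 : 0 <= bnd a * bnd b by rewrite mulr_ge0 ?bnd_ge0.
by have := ler_wpM2l p0 h1; have := ler_wpM2l p0 h2; lra.
Qed.

Lemma slope_mul L M t x : slope (prof (mul L M) t) x = slope (prof L t) x * slope (prof M t) x.
Proof.
rewrite prof_cat slope_cat !slopeE !big_map !big_allpairs_dep -big_split/= mulr_suml.
apply: eq_bigr => a _; rewrite -big_split/= mulr_sumr; apply: eq_bigr => b _ /=.
rewrite !freq_dot_wave !wnumD wnumN !mulrDl mulNr cosD cosB.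
by field.
Qed.

Section duhamel.
Variables (nu : R) (nu0 : 0 < nu).

(** The gain of a Duhamel integral: two derivatives cost q^2, the integral in time gains nu q^4,
    and q is at least lam. *)
Definition smallness : R := (nu * lam%:R ^+ 2)^-1.

Lemma smallness_ge0 : 0 <= smallness.
Proof. by rewrite invr_ge0 mulr_ge0 ?sqr_ge0// ltW. Qed.

Definition rate m : R := nu * wnum m ^+ 4.

Lemma rate_gt0 m : m != 0 -> 0 < rate m.
Proof.
move=> m0; have w0 : wnum m != 0 by rewrite -normr_gt0 (lt_le_trans ltr01)// wnum_ge1.
by rewrite mulr_gt0// exprn_even_gt0.
Qed.

Lemma duhamel_mode_le a t : `|duhamel_amp (rate (num a)) (wnum (num a) ^+ 2) (amp a) t| <=
  smallness * bnd a.
Proof.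
have [m0|m0] := eqVneq (num a) 0.
  rewrite m0 /duhamel_amp wnum0 expr0n/= mul0r oppr0 normr0.
  by rewrite mulr_ge0 ?smallness_ge0 ?bnd_ge0.
apply: le_trans (duhamel_amp_le _ _ (rate_gt0 m0) (@amp_continuous a) (@amp_le a)) _.
rewrite ler_wpM2r ?bnd_ge0// /rate /smallness.
have w1 := wnum_ge1 R lam0 m0; have w0 : 0 < `|wnum (num a)| := lt_le_trans ltr01 w1.
have l0 : 0 < lam%:R :> R by rewrite ltr0n.
have wl : lam%:R <= `|wnum (num a)|.
  rewrite wnum_norm ler_peMr// -[1](mulr1z 1) ler_int.
  by move: m0; clear; move: (num a) => m; lia.
rewrite ger0_norm ?sqr_ge0// -[wnum _ ^+ 4]/(wnum (num a) ^+ (2 + 2)) exprD.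
rewrite -[wnum (num a) ^+ 2]real_normK ?num_real//.
set w := `|_| in w0 wl *; rewrite (_ : w ^+ 2 / _ = (nu * w ^+ 2)^-1); last by field; rewrite ?lt0r_neq0.
rewrite lef_pV2 ?posrE ?mulr_gt0 ?exprn_gt0// ler_pM2l// lerXn2r ?nnegrE//; exact: ltW.
Qed.

Definition duhamel_mode a : mode :=
  Mode (num a) (duhamel_amp_continuous (k := rate (num a)) (q := wnum (num a) ^+ 2)
    (@amp_continuous a)) (@duhamel_mode_le a).

(** The mean is discarded: the divergence kills it, and it has no antiderivative in x. *)
Definition duh L : seq mode := [seq duhamel_mode a | a <- L & num a != 0].

Lemma duh_cat L M : duh (L ++ M) = duh L ++ duh M.
Proof. by rewrite /duh filter_cat map_cat. Qed.

Lemma duh_num L : all (fun a => num a != 0) (duh L).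
Proof. by rewrite all_map filter_all. Qed.

Lemma mnorm_duh L : mnorm (duh L) <= smallness * mnorm L.
Proof.
rewrite /mnorm big_map big_filter mulr_sumr [leRHS](bigID (fun a => num a != 0))/=.
rewrite -[leLHS]addr0; apply: lerD.
  by apply: ler_sum => a _; rewrite mulrA.
apply: sumr_ge0 => a _; rewrite mulr_ge0 ?smallness_ge0// mulr_ge0 ?bnd_ge0//.
by rewrite ltW// weight_gt0.
Qed.

Definition slope_field L t (z : vec) : vec := \row_i (if i == i0 then slope (prof L t) z else 0).

Lemma cper_slope_field L t : cper_field (slope_field L t).
Proof.
move=> i; have -> : (fun z => slope_field L t z 0 i) = if i == i0 then slope (prof L t) else fun=> 0.
  by apply/funext => z; rewrite mxE; case: ifP.
case: ifP => _; last exact: cper_cst.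
exact: cper_slope.
Qed.

Lemma div_semigroup_slope L s (c : R) x :
  div_semigroup nu c (slope_field L s) x =
  \sum_(a <- L) - (wnum (num a) * expR (- (nu * c * wnum (num a) ^+ 4)) * amp a s) *
    sin (freq_dot (wave (num a)) x).
Proof.
pose p i : seq (R * R * freq) :=
  if i == i0 then [seq (q.1, 0, wave q.2) | q <- prof L s] else [::].
have -> : slope_field L s = fun z => \row_i tp (p i) z.
  apply/funext => z; apply/rowP => i; rewrite !mxE /p; case: ifP => // _.
  by rewrite /tp big_nil.
rewrite div_semigroup_tp (bigD1 i0)//= big1 ?addr0 => [|i /negPf ii0]; last first.
  by rewrite /p ii0 /tp big_nil.
rewrite /p eqxx /tp !big_map; apply: eq_bigr => a _ /=.
rewrite wave_axis !mulr0 mul0r add0r.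
rewrite /decay freq_sq_wave -exprM; ring.
Qed.

(** The semigroup and the divergence act on each mode separately, so that no limit
    is involved. *)
Lemma height_duh L t x : 0 < t ->
  height (prof (duh L) t) x =
  \int[mu]_(s in `]0, t[) div_semigroup nu (t - s) (slope_field L s) x.
Proof.
move=> t0.
pose C a := - (wnum (num a) * expR (- (rate (num a) * t))) * sin (freq_dot (wave (num a)) x).
have E a s : - (wnum (num a) * expR (- (nu * (t - s) * wnum (num a) ^+ 4)) * amp a s) *
    sin (freq_dot (wave (num a)) x) = C a * (expR (rate (num a) * s) * amp a s).
  have -> : - (nu * (t - s) * wnum (num a) ^+ 4) = - (rate (num a) * t) + rate (num a) * s.
    by rewrite /rate; ring.
  by rewrite expRD /C; ring.
have cc a : continuous (fun s => expR (rate (num a) * s) * amp a s).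
  by apply: cont_mul; [exact: cont_exp|exact: amp_continuous].
have -> : \int[mu]_(s in `]0, t[) div_semigroup nu (t - s) (slope_field L s) x =
    \int[mu]_(s in `]0, t[) \sum_(a <- L) C a * (expR (rate (num a) * s) * amp a s).
  by apply: eq_Rintegral => s _; rewrite div_semigroup_slope; apply: eq_bigr.
rewrite Rintegral_sum_continuous => [|a]; last by apply: cont_mul => // s; exact: cvg_cst.
rewrite heightE !big_map big_filter [RHS](bigID (fun a => num a != 0))/=.
rewrite [X in _ = _ + X]big1 ?addr0 => [|a].
  apply: eq_bigr => a m0; have w0 : wnum (num a) != 0.
    by rewrite -normr_gt0 (lt_le_trans ltr01)// wnum_ge1.
  rewrite RintegralZl//; last exact: continuous_integrable_oo.
  rewrite /duhamel_amp gtr0_norm// /C; move: (Rintegral _ _ _) (expR _) (sin _) w0 => I e S.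
  by move: (wnum _) => w w0; field.
move=> /negPn/eqP m0; rewrite /C m0 wnum0 !mul0r oppr0 mul0r.
have -> : (fun s : R => 0 * (expR (rate 0 * s) * amp a s)) = fun=> 0.
  by apply/funext => s; rewrite mul0r.
by rewrite /Rintegral integral0.
Qed.

End duhamel.

End modes.

(** * The Picard iteration *)
Section geometric_convergence.
Variable R : realType.
Implicit Types (a : nat -> R) (A k : R).

Lemma geometric_dist a A k n m : 0 <= k <= 2^-1 -> 0 <= A ->
  (forall j, `|a j.+1 - a j| <= A * k ^+ j) -> (n <= m)%N -> `|a m - a n| <= 2 * A * k ^+ n.
Proof.
move=> /andP[k0 k1] A0 H nm; rewrite -(subnKC nm); move: (m - n)%N => j {nm}.
elim: j n => [|j IH] n.
  by rewrite addn0 subrr normr0 mulr_ge0 ?exprn_ge0// mulr_ge0.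
rewrite addnS -addSn -[a _](subrK (a n.+1)) -addrA.
apply: (le_trans (ler_normD _ _)); have := IH n.+1; have := H n; rewrite exprS.
have : k * k ^+ n <= 2^-1 * k ^+ n by rewrite ler_wpM2r ?exprn_ge0.
by move=> /(ler_wpM2l A0); lra.
Qed.

Lemma geometric_cvg a A k : 0 <= k <= 2^-1 -> 0 <= A ->
  (forall j, `|a j.+1 - a j| <= A * k ^+ j) ->
  cvgn a /\ forall n, `|limn a - a n| <= 2 * A * k ^+ n.
Proof.
move=> kk A0 H; have /andP[k0 k1] := kk.
have k0n : (2 * A * k ^+ n) @[n --> \oo] --> 0.
  rewrite -[X in _ --> X](mulr0 (2 * A)); apply: cvgM; first exact: cvg_cst.
  by apply: cvg_expr; rewrite ger0_norm//; lra.
have D n : `|a n.+1 - a n| <= 2 * A * k ^+ n - 2 * A * k ^+ n.+1.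
  apply: le_trans (H n) _; rewrite exprS.
  have : k * k ^+ n <= 2^-1 * k ^+ n by rewrite ler_wpM2r ?exprn_ge0.
  by move=> /(ler_wpM2l A0); lra.
have cv : cvgn a.
  have cb : cvgn (fun n => a n + 2 * A * k ^+ n).
    apply: nonincreasing_is_cvgn.
      apply/nonincreasing_seqP => n; have := D n; have := ler_norm (a n.+1 - a n); lra.
    exists (a 0%N - 2 * A) => _ [n _ <-].
    have := geometric_dist kk A0 H (leq0n n); rewrite expr0 mulr1 distrC.
    have := ler_norm (a 0%N - a n).
    have : 0 <= 2 * A * k ^+ n by rewrite mulr_ge0 ?exprn_ge0// mulr_ge0.
    lra.
  have -> : a = (fun n => (a n + 2 * A * k ^+ n) - 2 * A * k ^+ n).
    by apply/funext => n; rewrite addrK.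
  by apply: is_cvgB => //; apply/cvg_ex; exists 0.
split=> // n; have ca : a m - a n @[m --> \oo] --> limn a - a n by apply: cvgB => //; exact: cvg_cst.
have cn : `|a m - a n| @[m --> \oo] --> `|limn a - a n| by exact: cvg_norm.
rewrite -(cvg_lim (@Rhausdorff R) cn); apply: limr_le.
  by apply/cvg_ex; exists `|limn a - a n|.
by near=> m; apply: geometric_dist kk A0 H _; near: m; exact: nbhs_infty_ge.
Unshelve. all: by end_near.
Qed.

End geometric_convergence.

Section picard.
Variables (R : realType) (d : nat) (i0 : 'I_d) (lam : nat).
Hypothesis lam0 : (0 < lam)%N.
Variables (nu : R) (nu0 : 0 < nu).
Local Notation vec := 'rV[R]_d.
Local Notation slope := (@slope R d i0 lam).
Local Notation height := (@height R d i0 lam).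
Local Notation mode := (mode R).
Local Notation duh := (@duh R lam lam0 nu nu0).
Local Notation smallness := (@smallness R lam nu).
Variable lin : seq mode.
Implicit Types (n : nat) (t : R) (x : vec) (v dl : seq mode).

(** The difference of two cubes with the increment factored out: this is what makes successive
    increments contract. *)
Definition cubic_increment v dl : seq mode :=
  mul dl (mul (v ++ dl) (v ++ dl) ++ mul (v ++ dl) v ++ mul v v) ++ opp dl.

Definition scalar_flux (z : R) : R := z ^+ 3 - z.

Lemma slope_cubic_increment v dl t x : slope (prof (cubic_increment v dl) t) x =
  scalar_flux (slope (prof (v ++ dl) t) x) - scalar_flux (slope (prof v t) x).
Proof.
rewrite /cubic_increment !(prof_cat, slope_cat, slope_opp, slope_mul).
by rewrite /scalar_flux; ring.
Qed.

Lemma mnorm_cubic_increment v dl (r : R) : mnorm (v ++ dl) <= r ->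
  mnorm (cubic_increment v dl) <= (3 * r ^+ 2 + 1) * mnorm dl.
Proof.
move=> ur; have v0 := mnorm_ge0 v; have d0 := mnorm_ge0 dl.
have vr : mnorm v <= r by move: ur; rewrite mnorm_cat; lra.
have u0 := mnorm_ge0 (v ++ dl).
rewrite /cubic_increment mnorm_cat mnorm_opp mulrDl mul1r lerD2r.
apply: le_trans (mnorm_mul _ _) _; rewrite mulrC ler_wpM2r// !mnorm_cat.
have r0 : 0 <= r := le_trans u0 ur.
have h1 := le_trans (mnorm_mul (v ++ dl) (v ++ dl)) (ler_pM u0 u0 ur ur).
have h2 := le_trans (mnorm_mul (v ++ dl) v) (ler_pM u0 v0 ur vr).
have h3 := le_trans (mnorm_mul v v) (ler_pM v0 v0 vr vr).
move: h1 h2 h3; rewrite !mnorm_cat expr2; lra.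
Qed.

(** The state holds an iterate, its next increment, and the source whose Duhamel integral
    produced the iterate; lists make all three finite sums of modes. *)
Fixpoint picard n : seq mode * seq mode * seq mode :=
  if n is n'.+1 then
    let: (v, dl, w) := picard n' in
    (v ++ dl, duh (cubic_increment v dl), w ++ cubic_increment v dl)
  else ([::], lin, [::]).

Definition iterate n := (picard n).1.1.
Definition increment n := (picard n).1.2.
Definition source n := (picard n).2.

Lemma iterateS n : iterate n.+1 = iterate n ++ increment n.
Proof. by rewrite /iterate /increment /=; case: (picard n) => [[v dl] w]. Qed.

Lemma incrementS n : increment n.+1 = duh (cubic_increment (iterate n) (increment n)).
Proof. by rewrite /increment /iterate /=; case: (picard n) => [[v dl] w]. Qed.

Lemma sourceS n : source n.+1 = source n ++ cubic_increment (iterate n) (increment n).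
Proof. by rewrite /source /increment /iterate /=; case: (picard n) => [[v dl] w]. Qed.

Lemma iterate_duh n : iterate n.+1 = lin ++ duh (source n).
Proof.
elim: n => [|n IH]; first by rewrite /iterate /source /= cats0.
by rewrite iterateS incrementS sourceS duh_cat IH catA.
Qed.

Lemma slope_source n t x :
  slope (prof (source n) t) x = scalar_flux (slope (prof (iterate n) t) x).
Proof.
elim: n => [|n IH]; first by rewrite !slopeE !big_nil /scalar_flux expr0n subr0.
rewrite sourceS prof_cat slope_cat IH slope_cubic_increment -iterateS; ring.
Qed.

Lemma iterate_num n : all (fun a => num a != 0) lin -> all (fun a => num a != 0) (iterate n).
Proof.
move=> l0; elim: n => [//|n IH]; rewrite iterateS all_cat IH/=.
by case: n {IH} => [//|n]; rewrite incrementS duh_num.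
Qed.

Definition size0 : R := mnorm lin.

Definition growth : R := 3 * (2 * size0) ^+ 2 + 1.

Definition ratio : R := smallness * growth.

Hypothesis ratio_small : ratio <= 2^-1.

Let p00 : 0 <= size0 := mnorm_ge0 lin.

Let g0 : 0 <= growth.
Proof. by rewrite addr_ge0// mulr_ge0// sqr_ge0. Qed.

Lemma ratio_ge0 : 0 <= ratio.
Proof. by rewrite mulr_ge0// smallness_ge0. Qed.

(** The two bounds feed each other: while the iterates stay in the ball of radius 2 size0 the
    increments contract by the ratio, and a geometric series of ratio at most 1/2 stays in
    that ball. *)
Lemma iterate_increment_norm n :
  mnorm (iterate n) <= 2 * size0 * (1 - ratio ^+ n) /\ mnorm (increment n) <= size0 * ratio ^+ n.
Proof.
have r0 := ratio_ge0; elim: n => [|n [IH1 IH2]].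
  by rewrite expr0 subrr mulr0 mulr1 /iterate /increment /= /mnorm big_nil.
have rn : 0 <= ratio ^+ n by rewrite exprn_ge0.
have rS : ratio ^+ n.+1 <= 2^-1 * ratio ^+ n by rewrite exprS ler_wpM2r.
have rS' := ler_wpM2l p00 rS; have prn : 0 <= size0 * ratio ^+ n by rewrite mulr_ge0.
have rSn : 0 <= size0 * ratio ^+ n.+1 by rewrite mulr_ge0// exprn_ge0.
have I1 : mnorm (iterate n.+1) <= 2 * size0 * (1 - ratio ^+ n.+1).
  by rewrite iterateS mnorm_cat; lra.
split=> //; rewrite incrementS.
apply: le_trans (mnorm_duh _ _ _) _.
have Hc : mnorm (cubic_increment (iterate n) (increment n)) <= growth * mnorm (increment n).
  apply: mnorm_cubic_increment; rewrite -iterateS; lra.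
apply: le_trans (ler_wpM2l (smallness_ge0 _ nu0) Hc) _.
rewrite mulrA -/ratio exprS mulrCA; exact: ler_wpM2l.
Qed.

Lemma mnorm_iterate n : mnorm (iterate n) <= 2 * size0.
Proof.
have [h _] := iterate_increment_norm n; apply: le_trans h _.
by rewrite ler_piMr ?mulr_ge0// gerBl exprn_ge0// ratio_ge0.
Qed.

Lemma mnorm_increment n : mnorm (increment n) <= size0 * ratio ^+ n.
Proof. by have [] := iterate_increment_norm n. Qed.

Lemma mnorm_source n : mnorm (source n) <= 2 * (growth * size0).
Proof.
have r0 := ratio_ge0.
suff H : mnorm (source n) <= 2 * (growth * size0) * (1 - ratio ^+ n).
  apply: le_trans H _.
  by rewrite ler_piMr ?mulr_ge0// ?gerBl ?exprn_ge0.
elim: n => [|n IH].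
  by rewrite expr0 subrr mulr0 /source /= /mnorm big_nil.
have rn : 0 <= ratio ^+ n by rewrite exprn_ge0.
have rS : ratio ^+ n.+1 <= 2^-1 * ratio ^+ n by rewrite exprS ler_wpM2r.
have gs0 : 0 <= growth * size0 by rewrite mulr_ge0.
have rS' := ler_wpM2l gs0 rS.
have Hc : mnorm (cubic_increment (iterate n) (increment n)) <= growth * mnorm (increment n).
  apply: mnorm_cubic_increment; rewrite -iterateS; exact: mnorm_iterate.
have := ler_wpM2l g0 (mnorm_increment n).
by rewrite sourceS mnorm_cat; lra.
Qed.

End picard.

(** * The limit of the iteration *)
Section picard_limit.
Variables (R : realType) (d : nat) (i0 : 'I_d) (lam : nat).
Hypothesis lam0 : (0 < lam)%N.
Variables (nu : R) (nu0 : 0 < nu).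
Local Notation vec := 'rV[R]_d.
Local Notation mu := (@lebesgue_measure R).
Local Notation slope := (@slope R d i0 lam).
Local Notation height := (@height R d i0 lam).
Variable lin : seq (mode R).
Hypothesis lin_num : all (fun a => num a != 0) lin.
Local Notation iterate := (@iterate R lam lam0 nu nu0 lin).
Local Notation increment := (@increment R lam lam0 nu nu0 lin).
Local Notation source := (@source R lam lam0 nu nu0 lin).
Local Notation ratio := (ratio lam nu lin).
Local Notation size0 := (size0 lin).
Local Notation growth := (growth lin).
Hypothesis ratio_small : ratio <= 2^-1.
Implicit Types (n : nat) (s t e : R) (x : vec).

Definition sol t x : R := limn (fun n => height (prof (iterate n) t) x).

Definition sol_slope t x : R := limn (fun n => slope (prof (iterate n) t) x).

Let size00 : 0 <= size0. Proof. exact: mnorm_ge0. Qed.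

Let ratio_itv : 0 <= ratio <= 2^-1.
Proof. by rewrite ratio_ge0. Qed.

Lemma error_small c e : 0 < e -> exists n, c * ratio ^+ n <= e.
Proof.
move=> e0; have [c0|c0] := leP c 0.
  by exists 0%N; rewrite expr0 mulr1 (le_trans c0) ?ltW.
have k1 : `|ratio| < 1 by have /andP[r0 r1] := ratio_itv; rewrite ger0_norm//; lra.
have /cvgrPdist_lt/(_ (e / c) (divr_gt0 e0 c0)) := cvg_expr k1.
move=> [N _ /(_ N (leqnn N))]; rewrite sub0r normrN => h; exists N.
have := ltW (le_lt_trans (ler_norm _) h); rewrite ler_pdivlMr// mulrC; exact.
Qed.

Lemma sol_approx t x : cvgn (fun n => height (prof (iterate n) t) x) /\
  forall n, `|sol t x - height (prof (iterate n) t) x| <= 2 * size0 * ratio ^+ n.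
Proof.
apply: geometric_cvg ratio_itv size00 _ => n.
rewrite iterateS prof_cat height_cat addrC addKr.
apply: le_trans (height_bound _ _ _ _) _ => //.
by apply: le_trans (wnorm_prof _ _) _; exact: mnorm_increment.
Qed.

Lemma sol_slope_approx t x n :
  `|sol_slope t x - slope (prof (iterate n) t) x| <= 2 * size0 * ratio ^+ n.
Proof.
suff : cvgn (fun n => slope (prof (iterate n) t) x) /\
  forall n, `|sol_slope t x - slope (prof (iterate n) t) x| <= 2 * size0 * ratio ^+ n by case.
apply: geometric_cvg ratio_itv size00 _ => j.
rewrite iterateS prof_cat slope_cat addrC addKr.
apply: le_trans (slope_bound _ _ _ _) _ => //.
by apply: le_trans (wnorm_prof _ _) _; exact: mnorm_increment.
Qed.

Lemma slope_iterate_le t x n : `|slope (prof (iterate n) t) x| <= 2 * size0.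
Proof.
apply: le_trans (slope_bound _ _ _ _) _; apply: le_trans (wnorm_prof _ _) _.
exact: mnorm_iterate.
Qed.

Lemma sol_slope_le t x : `|sol_slope t x| <= 2 * size0.
Proof.
apply/ler_addgt0Pr => e e0; have [n Hn] := error_small (2 * size0) e0.
rewrite -[sol_slope t x](subrK (slope (prof (iterate n) t) x)).
apply: (le_trans (ler_normD _ _)); rewrite addrC lerD ?slope_iterate_le//.
exact: le_trans (sol_slope_approx _ _ _) Hn.
Qed.

Lemma cper_sol t : cper (sol t).
Proof.
apply: cper_uniform_limit => e e0; have [n Hn] := error_small (2 * size0) e0.
exists (height (prof (iterate n) t)); first exact: cper_height.
by move=> x; exact: le_trans ((sol_approx t x).2 n) Hn.
Qed.

Lemma cper_sol_slope t : cper (sol_slope t).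
Proof.
apply: cper_uniform_limit => e e0; have [n Hn] := error_small (2 * size0) e0.
exists (slope (prof (iterate n) t)); first exact: cper_slope.
by move=> x; exact: le_trans (sol_slope_approx t x n) Hn.
Qed.

Lemma norm_sub3_le (a b c a' b' c' w ra rb rc : R) : `|a' - b' - c'| <= w ->
  `|a - a'| <= ra -> `|b - b'| <= rb -> `|c - c'| <= rc ->
  `|a - b - c| <= w + (ra + rb) + rc.
Proof.
move=> hw ha hb hc.
have -> : a - b - c = (a' - b' - c') + ((a - a') - (b - b')) - (c - c') by ring.
apply: le_trans (ler_normB _ _) _; apply: lerD => //.
apply: le_trans (ler_normD _ _) _; apply: lerD => //.
by apply: le_trans (ler_normB _ _) _; apply: lerD.
Qed.

(** [height_taylor] in the limit. *)
Lemma is_derive_sol t x i :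
  is_derive x ('e_i : vec) (sol t) (if i == i0 then sol_slope t x else 0).
Proof.
apply: (@quadratic_is_derive _ _ _ _ _ _ (2 * lam%:R * (2 * size0))) => h.
apply/ler_addgt0Pl => e e0.
have [n Hn] := error_small ((2 + `|h|) * (2 * size0)) e0.
have hT : `|height (prof (iterate n) t) (h *: 'e_i + x) - height (prof (iterate n) t) x -
    h * (if i == i0 then slope (prof (iterate n) t) x else 0)| <=
    2 * lam%:R * wnorm (prof (iterate n) t) * h ^+ 2.
  by apply: height_taylor => //; rewrite all_map; exact: iterate_num lin_num.
have hb := (sol_approx t x).2 n; have ha := (sol_approx t (h *: 'e_i + x)).2 n.
have hc : `|h * (if i == i0 then sol_slope t x else 0) -
    h * (if i == i0 then slope (prof (iterate n) t) x else 0)| <=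
    `|h| * (2 * size0 * ratio ^+ n).
  rewrite -mulrBr normrM ler_wpM2l//; case: ifP => _; first exact: sol_slope_approx.
  by rewrite subrr normr0 mulr_ge0 ?exprn_ge0 ?ratio_ge0// mulr_ge0.
have wP : 2 * lam%:R * wnorm (prof (iterate n) t) * h ^+ 2 <=
    2 * lam%:R * (2 * size0) * h ^+ 2.
  rewrite ler_wpM2r ?sqr_ge0// ler_wpM2l ?mulr_ge0//.
  by apply: le_trans (wnorm_prof _ _) _; exact: mnorm_iterate.
apply: le_trans (norm_sub3_le hT ha hb hc) _.
by apply: le_trans (lerD (lerD wP (lexx _)) (lexx _)) _; lra.
Qed.

Lemma partial_sol t i x : partial i (sol t) x = if i == i0 then sol_slope t x else 0.
Proof. by have h := is_derive_sol t x i; rewrite /partial derive_val. Qed.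

Lemma derivable_sol t x i : derivable (sol t) x 'e_i.
Proof. by have [] := is_derive_sol t x i. Qed.

Lemma grad_sol t x : grad (sol t) x = sol_slope t x *: ('e_i0 : vec).
Proof.
apply/rowP => i; rewrite !mxE partial_sol eqxx /=.
by case: eqP => _; rewrite ?mulr1 ?mulr0.
Qed.

Lemma flux_sol t x :
  flux (sol t) x = \row_i (if i == i0 then scalar_flux (sol_slope t x) else 0).
Proof.
rewrite fluxE grad_sol /cubic sqnZ (_ : sqn ('e_i0 : vec) = 1).
  apply/rowP => i; rewrite !mxE eqxx /= mulr1 /scalar_flux.
  by case: eqP => _; rewrite ?mulr0//= mulr1; ring.
rewrite /sqn (bigD1 i0)//= big1 => [|j /negPf ji]; rewrite !mxE ?ji ?eqxx ?expr1n ?addr0//.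
by rewrite expr0n.
Qed.

Lemma scalar_flux_lip (a b r : R) : `|a| <= r -> `|b| <= r ->
  `|scalar_flux a - scalar_flux b| <= (3 * r ^+ 2 + 1) * `|a - b|.
Proof.
move=> ar br; have r0 : 0 <= r := le_trans (normr_ge0 _) ar.
have -> : scalar_flux a - scalar_flux b = (a * a + a * b + b * b - 1) * (a - b).
  by rewrite /scalar_flux; ring.
rewrite normrM ler_wpM2r//; apply: (le_trans (ler_normB _ _)); rewrite normr1 lerD2r.
apply: (le_trans (ler_normD _ _)); have h3 := ler_pM (normr_ge0 _) (normr_ge0 _) br br.
have h1 := ler_pM (normr_ge0 _) (normr_ge0 _) ar ar.
have h2 := ler_pM (normr_ge0 _) (normr_ge0 _) ar br.
by have := ler_normD (a * a) (a * b); rewrite !normrM; lra.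
Qed.

Lemma cper_field_flux_sol t : cper_field (flux (sol t)).
Proof.
move=> i; have -> : (fun y => flux (sol t) y 0 i) =
    if i == i0 then (fun y => sol_slope t y ^+ 3 - sol_slope t y) else fun=> 0.
  by apply/funext => y; rewrite flux_sol mxE; case: ifP.
case: ifP => _; last exact: cper_cst.
apply: cperB (cper_sol_slope t); have c := cper_sol_slope t.
have -> : (fun y => sol_slope t y ^+ 3) = (fun y => sol_slope t y * sol_slope t y ^+ 2).
  by apply/funext => y; rewrite exprS.
by apply: cperM => //; exact: cper_sqr.
Qed.

Lemma flux_source_gap s n x i :
  `|flux (sol s) x 0 i - slope_field i0 lam (source n) s x 0 i| <=
    growth * (2 * size0 * ratio ^+ n).
Proof.
have g0 : 0 <= growth by rewrite addr_ge0// mulr_ge0// sqr_ge0.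
rewrite flux_sol !mxE; case: ifP => _; last first.
  by rewrite subrr normr0 mulr_ge0// mulr_ge0 ?exprn_ge0 ?ratio_ge0// mulr_ge0.
rewrite slope_source.
apply: le_trans (scalar_flux_lip (sol_slope_le s x) (slope_iterate_le s x n)) _.
by rewrite ler_wpM2l// sol_slope_approx.
Qed.

Let duhamel_term t n x s : R := div_semigroup nu (t - s) (slope_field i0 lam (source n) s) x.

Let duhamel_term_continuous t n x : continuous (duhamel_term t n x).
Proof.
have -> : duhamel_term t n x = fun s => \sum_(a <- source n)
    - (wnum R lam (num a) * expR (- (nu * (t - s) * wnum R lam (num a) ^+ 4)) * amp a s) *
    sin (freq_dot (wave i0 lam (num a)) x).
  by apply/funext => s; exact: div_semigroup_slope.
move=> s; apply: cvg_sumr => a; apply: cvgM; last exact: cvg_cst.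
apply: cvgN; apply: cvgM; last exact: amp_continuous.
apply: cvgM; first exact: cvg_cst.
apply: (@continuous_comp _ _ _ (fun s => - (nu * (t - s) * wnum R lam (num a) ^+ 4)) expR).
  apply: cvgN; apply: cvgM; last exact: cvg_cst.
  by apply: cvgM; [exact: cvg_cst|apply: cvgB; [exact: cvg_cst|exact: cvg_id]].
exact: continuous_expR.
Qed.

Let duhamel_term_le t n x s : s < t ->
  `|duhamel_term t n x s| <= lam%:R * (2 * (growth * size0)).
Proof.
move=> st; apply: (@le_trans _ _ (lam%:R * mnorm (source n))); last first.
  by rewrite ler_wpM2l// mnorm_source.
rewrite /duhamel_term div_semigroup_slope /mnorm mulr_sumr.
apply: (le_trans (ler_norm_sum _ _ _)); apply: ler_sum => a _.
rewrite normrM -[leRHS]mulr1 ler_pM ?sin_max// normrN 2!normrM.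
have ee : `|expR (- (nu * (t - s) * wnum R lam (num a) ^+ 4))| <= 1.
  rewrite ger0_norm ?expR_ge0// -[leRHS]expR0 ler_expR oppr_le0.
  apply: mulr_ge0; last by rewrite exprn_even_ge0.
  by rewrite mulr_ge0 ?(ltW nu0)// subr_ge0 ltW.
have h1 : `|wnum R lam (num a)| * `|expR (- (nu * (t - s) * wnum R lam (num a) ^+ 4))| <=
    lam%:R * weight R (num a).
  by rewrite -[leRHS]mulr1 ler_pM ?wnum_le.
have -> : lam%:R * (bnd a * weight R (num a)) = lam%:R * weight R (num a) * bnd a by ring.
by rewrite ler_pM// ?amp_le// mulr_ge0.
Qed.

Let duhamel_term_cvg t x s : s < t ->
  duhamel_term t n x s @[n --> \oo] --> div_semigroup nu (t - s) (flux (sol s)) x.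
Proof.
move=> st; have c0 : 0 < nu * (t - s) by rewrite mulr_gt0// subr_gt0.
have [C C0 HC] := div_semigroup_lip d c0.
have g0 : 0 <= growth by rewrite addr_ge0// mulr_ge0// sqr_ge0.
have del0 n : 0 <= growth * (2 * size0 * ratio ^+ n).
  by rewrite mulr_ge0// mulr_ge0 ?exprn_ge0 ?ratio_ge0// mulr_ge0.
have H n : `|div_semigroup nu (t - s) (flux (sol s)) x - duhamel_term t n x s| <=
    C * growth * (2 * size0) * ratio ^+ n.
  have := HC nu (t - s) (flux (sol s)) (slope_field i0 lam (source n) s) _ erefl (del0 n)
    (cper_field_flux_sol s) (cper_slope_field _ _ _ _) (flux_source_gap s n) x.
  by rewrite !mulrA.
apply/cvgrPdist_le => e e0.
have k1 : `|ratio| < 1 by have /andP[r0 r1] := ratio_itv; rewrite ger0_norm//; lra.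
have c : (C * growth * (2 * size0) * ratio ^+ n) @[n --> \oo] --> 0.
  rewrite -[X in _ --> X](mulr0 (C * growth * (2 * size0))).
  by apply: cvgM; [exact: cvg_cst|exact: cvg_expr].
have /cvgrPdist_lt/(_ e e0) := c; apply: filterS => n; rewrite sub0r normrN => h.
by apply: le_trans (H n) _; apply: le_trans (ler_norm _) _; exact: ltW.
Qed.

Lemma measurable_duhamel_sol t x :
  measurable_fun `]0, t[ (fun s => div_semigroup nu (t - s) (flux (sol s)) x).
Proof.
apply: (@measurable_fun_cvg _ _ _ _ (fun n => duhamel_term t n x)) => [n|s /=].
  apply: measurable_funTS; apply: continuous_measurable_fun.
  exact: duhamel_term_continuous.
by rewrite in_itv => /andP[_ st]; exact: duhamel_term_cvg.
Qed.

(** Dominated convergence in the exact formulas for the iterates; as their amplitudes are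
    summable against the weight, the integrands stay bounded up to s = t. *)
Lemma duhamel_sol t x : 0 < t -> sol t x = height (prof lin t) x +
  \int[mu]_(s in `[0, t]) div_semigroup nu (t - s) (flux (sol s)) x.
Proof.
move=> t0; rewrite (Rintegral_closed_open t0 (@measurable_duhamel_sol t x)).
pose F s := div_semigroup nu (t - s) (flux (sol s)) x.
pose B := lam%:R * (2 * (growth * size0)).
have mD : measurable [set` `]0 : R, t[] by exact: measurable_itv.
have dom : (\int[mu]_(s in `]0%R, t[) (duhamel_term t n x s)%:E)%E @[n --> \oo] -->
    (\int[mu]_(s in `]0%R, t[) (F s)%:E)%E.
  apply: (@dominated_cvg _ _ _ mu `]0, t[ _ (fun n s => (duhamel_term t n x s)%:E)
    (fun s => (F s)%:E) (fun=> B%:E)) => //.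
  - move=> n; apply/measurable_EFinP; apply: measurable_funTS.
    by apply: continuous_measurable_fun; exact: duhamel_term_continuous.
  - move=> s /=; rewrite in_itv => /andP[_ st].
    by apply: cvg_EFin; [near=> n|exact: duhamel_term_cvg].
  - by apply: (continuous_integrable_oo 0 t (f := fun=> B)) => s; exact: cvg_cst.
  - by move=> n s /=; rewrite in_itv => /andP[_ st]; rewrite lee_fin; exact: duhamel_term_le.
have E n : (\int[mu]_(s in `]0%R, t[) (duhamel_term t n x s)%:E)%E =
    (height (prof (iterate n.+1) t) x - height (prof lin t) x)%:E.
  rewrite iterate_duh prof_cat height_cat addrAC subrr add0r height_duh// /Rintegral fineK//.
  apply: integrable_fin_num => //; apply: continuous_integrable_oo.
  exact: duhamel_term_continuous.
have lim2 : (\int[mu]_(s in `]0%R, t[) (duhamel_term t n x s)%:E)%E @[n --> \oo] -->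
    (sol t x - height (prof lin t) x)%:E.
  under eq_cvg do rewrite E.
  apply: cvg_EFin; first by near=> n.
  apply: cvgB; last exact: cvg_cst.
  have := (sol_approx t x).1; rewrite -(cvg_shiftS (fun n => height (prof (iterate n) t) x)).
  exact.
have := cvg_unique _ dom lim2 => /(_ (@ereal_hausdorff R)) EF.
by rewrite /Rintegral EF /= addrC subrK.
Unshelve. all: by end_near.
Qed.

End picard_limit.

(** * The limit as the maximal mild solution *)
Section picard_mild.
Variables (R : realType) (d : nat) (i0 : 'I_d) (lam : nat).
Hypothesis lam0 : (0 < lam)%N.
Variables (nu : R) (nu0 : 0 < nu).
Local Notation vec := 'rV[R]_d.
Local Notation mu := (@lebesgue_measure R).
Local Notation slope := (@slope R d i0 lam).
Local Notation height := (@height R d i0 lam).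
Variable lin : seq (mode R).
Hypothesis lin_num : all (fun a => num a != 0) lin.
Local Notation iterate := (@iterate R lam lam0 nu nu0 lin).
Local Notation increment := (@increment R lam lam0 nu nu0 lin).
Local Notation ratio := (ratio lam nu lin).
Local Notation size0 := (size0 lin).
Hypothesis ratio_small : ratio <= 2^-1.
Local Notation sol := (@sol R d i0 lam lam0 nu nu0 lin).
Local Notation sol_slope := (@sol_slope R d i0 lam lam0 nu nu0 lin).
Implicit Types (n : nat) (s t e : R) (x : vec) (ph : R -> R) (L M : seq (mode R)).

Let size00 : 0 <= size0. Proof. exact: mnorm_ge0. Qed.

Let ratio_itv : 0 <= ratio <= 2^-1.
Proof. by rewrite ratio_ge0. Qed.

(** The function ph is 1 or t^(1/4), the two weights in the solution class. *)
Definition time_gap ph L s t : seq (R * int) :=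
  [seq (ph s * amp a s - ph t * amp a t, num a) | a <- L].

Lemma height_time_gap ph L s t x :
  height (time_gap ph L s t) x = ph s * height (prof L s) x - ph t * height (prof L t) x.
Proof.
rewrite !heightE !big_map !mulr_sumr -sumrB; apply: eq_bigr => a _ /=.
by rewrite mulrBl mulrBl; ring.
Qed.

Lemma slope_time_gap ph L s t x :
  slope (time_gap ph L s t) x = ph s * slope (prof L s) x - ph t * slope (prof L t) x.
Proof.
rewrite !slopeE !big_map !mulr_sumr -sumrB; apply: eq_bigr => a _ /=; ring.
Qed.

Lemma wnorm_time_gap_le ph L s t (c : R) : `|ph s| <= c -> `|ph t| <= c ->
  wnorm (time_gap ph L s t) <= 2 * c * mnorm L.
Proof.
move=> sc tc; rewrite /wnorm big_map mulr_sumr; apply: ler_sum => a _ /=.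
rewrite mulrA ler_wpM2r ?(ltW (weight_gt0 _ _))//.
apply: (le_trans (ler_normB _ _)); rewrite !normrM.
have := ler_pM (normr_ge0 _) (normr_ge0 _) sc (amp_le a s).
have := ler_pM (normr_ge0 _) (normr_ge0 _) tc (amp_le a t).
lra.
Qed.

Lemma within_itv T t : \forall s \near within [set` `[0, T]] (nbhs t), 0 <= s <= T.
Proof.
have : within [set` `[0, T]] (nbhs t) [set` `[0, T]] by exact: withinT.
by apply: filterS => s /=; rewrite in_itv.
Qed.

(** Up to a small error only finitely many increments matter, and each mode is continuous. *)
Lemma iterate_time_continuous ph (T t c e : R) : 0 < e ->
  (forall s, 0 <= s <= T -> `|ph s| <= c) -> 0 <= t <= T ->
  ph s @[s --> within [set` `[0, T]] (nbhs t)] --> ph t ->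
  \forall s \near within [set` `[0, T]] (nbhs t), forall n, wnorm (time_gap ph (iterate n) s t) <= e.
Proof.
move=> e0 phc tT pht; have c0 : 0 <= c := le_trans (normr_ge0 _) (phc t tT).
have e20 : 0 < e / 2 by rewrite divr_gt0.
have [N HN] := error_small nu0 ratio_small (2 * (2 * c * size0)) e20.
have lim0 : wnorm (time_gap ph (iterate N) s t) @[s --> within [set` `[0, T]] (nbhs t)] --> 0.
  have -> : (fun s => wnorm (time_gap ph (iterate N) s t)) =
      fun s => \sum_(a <- iterate N) `|ph s * amp a s - ph t * amp a t| * weight R (num a).
    by apply/funext => s; rewrite /wnorm big_map.
  rewrite -[X in _ --> X](_ : \sum_(a <- iterate N) 0 * weight R (num a) = 0); last first.
    by rewrite big1// => a _; rewrite mul0r.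
  apply: cvg_sumr => a; apply: cvgM; last exact: cvg_cst.
  have z : ph s * amp a s - ph t * amp a t @[s --> within [set` `[0, T]] (nbhs t)] -->
      ph t * amp a t - ph t * amp a t.
    apply: cvgB; last exact: cvg_cst.
    apply: cvgM => //; apply: cvg_within_filter; exact: amp_continuous.
  have zn : `|ph s * amp a s - ph t * amp a t| @[s --> within [set` `[0, T]] (nbhs t)] -->
      `|ph t * amp a t - ph t * amp a t| by exact: cvg_norm.
  by rewrite subrr normr0 in zn.
have /cvgrPdist_lt/(_ _ e20) := lim0.
apply: filterS2 (within_itv T t) => s sT H n; move: H; rewrite sub0r normrN => H.
have mono m : wnorm (time_gap ph (iterate m.+1) s t) =
    wnorm (time_gap ph (iterate m) s t) + wnorm (time_gap ph (increment m) s t).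
  by rewrite iterateS /wnorm /time_gap map_cat big_cat.
have inc m : `|wnorm (time_gap ph (iterate m.+1) s t) - wnorm (time_gap ph (iterate m) s t)| <=
    2 * c * size0 * ratio ^+ m.
  rewrite mono addrC addKr ger0_norm ?wnorm_ge0//.
  apply: le_trans (wnorm_time_gap_le _ (phc s sT) (phc t tT)) _.
  by rewrite -[leRHS]mulrA ler_wpM2l ?mulr_ge0// mnorm_increment.
have A0 : 0 <= 2 * c * size0 by rewrite !mulr_ge0.
have [nN|Nn] := leqP n N.
  apply: (@le_trans _ _ (wnorm (time_gap ph (iterate N) s t))).
    rewrite -(subnKC nN); elim: (N - n)%N => [|k IH]; first by rewrite addn0.
    by rewrite addnS (le_trans IH)// mono lerDl wnorm_ge0.
  by have := ler_norm (wnorm (time_gap ph (iterate N) s t)); lra.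
have := geometric_dist ratio_itv A0 inc (ltnW Nn).
have := ler_norm (wnorm (time_gap ph (iterate n) s t) - wnorm (time_gap ph (iterate N) s t)).
have := ler_norm (wnorm (time_gap ph (iterate N) s t)).
lra.
Qed.

Lemma ecvg0 (F : set_system R) (f : R -> \bar R) : Filter F -> (forall s, (0 <= f s)%E) ->
  (forall e, 0 < e -> \forall s \near F, (f s <= e%:E)%E) -> f s @[s --> F] --> 0%E.
Proof.
move=> FF f0 H; apply/fine_cvgP; split.
  have := H 1 ltr01; apply: filterS => s fs.
  by rewrite ge0_fin_numE// (le_lt_trans fs)// ltry.
apply/cvgrPdist_le => e e0; have := H e e0; apply: filterS => s fs /=.
have ff : f s \is a fin_num by rewrite ge0_fin_numE// (le_lt_trans fs)// ltry.
by rewrite sub0r normrN ger0_norm ?fine_ge0// -lee_fin fineK.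
Qed.

Section weight_in_time.
Variables (ph : R -> R) (T c : R).
Hypothesis phc : forall s, 0 <= s <= T -> `|ph s| <= c.
Hypothesis ph_cont : forall t, 0 <= t <= T -> ph s @[s --> within [set` `[0, T]] (nbhs t)] --> ph t.

Let inT t : t \in `[0, T] -> 0 <= t <= T. Proof. by rewrite in_itv. Qed.

Lemma C0tHsx_sol (sg : R) : C0tHsx sg T (fun t x => ph t * sol t x).
Proof.
have [K K0 HK] := sobolev_weight_le i0 lam sg.
move=> t /inT tT; have c0 : 0 <= c := le_trans (normr_ge0 _) (phc tT).
have cz z : cper (fun x => z * sol t x) by apply: cperZ; exact: cper_sol.
split => /=.
  pose P n := [seq (ph t * p.1, p.2) | p : R * int <- prof (iterate n) t].
  have hP n x : height (P n) x = ph t * height (prof (iterate n) t) x.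
    rewrite !heightE big_map mulr_sumr; apply: eq_bigr => p _ /=; ring.
  apply: (@le_lt_trans _ _ (K * (c * (2 * size0)))%:E); last exact: ltry.
  apply: (sobolev_norm_limit lam0 (P := P) HK (cz _)) => [e e0|n].
    have [n Hn] := error_small nu0 ratio_small (c * (2 * size0)) e0.
    exists n => x; rewrite hP -mulrBr normrM; apply: le_trans Hn; rewrite -mulrA.
    by apply: ler_pM => //; [exact: phc|exact: (sol_approx i0 lam0 nu0 ratio_small t x).2].
  have -> : wnorm (P n) = `|ph t| * wnorm (prof (iterate n) t).
    by rewrite /wnorm big_map mulr_sumr; apply: eq_bigr => p _ /=; rewrite normrM mulrA.
  apply: ler_pM => //; [exact: wnorm_ge0|exact: phc|].
  by apply: le_trans (wnorm_prof _ _) _; exact: mnorm_iterate.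
apply: ecvg0 => [s|e e0]; first exact: poweR_ge0.
have e10 : 0 < e / (K + 1) by rewrite divr_gt0// ltr_wpDl.
have := iterate_time_continuous e10 phc tT (ph_cont tT); apply: filterS2 (within_itv T t) => s sT H.
apply: (@le_trans _ _ (K * (e / (K + 1)))%:E); last first.
  rewrite lee_fin mulrCA ler_piMr ?(ltW e0)// ler_pdivrMr ?mul1r ?lerDl// ltr_wpDl//.
apply: (sobolev_norm_limit lam0 (P := fun n => time_gap ph (iterate n) s t) HK) => [|e' e'0|//].
  apply: cperB; apply: cperZ; exact: cper_sol.
have [n Hn] := error_small nu0 ratio_small (2 * c * (2 * size0)) e'0.
exists n => x; rewrite height_time_gap !fctE; apply: le_trans Hn.
have h1 := (sol_approx i0 lam0 nu0 ratio_small s x).2 n.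
have h2 := (sol_approx i0 lam0 nu0 ratio_small t x).2 n.
have -> : ph s * sol s x - ph t * sol t x -
    (ph s * height (prof (iterate n) s) x - ph t * height (prof (iterate n) t) x) =
  ph s * (sol s x - height (prof (iterate n) s) x) -
  ph t * (sol t x - height (prof (iterate n) t) x) by ring.
apply: (le_trans (ler_normB _ _)); rewrite !normrM.
have := ler_pM (normr_ge0 _) (normr_ge0 _) (phc sT) h1.
have := ler_pM (normr_ge0 _) (normr_ge0 _) (phc tT) h2.
lra.
Qed.

Lemma C0tC0x_grad_sol : C0tC0x T (fun t x => ph t *: grad (sol t) x).
Proof.
move=> t /inT tT; have c0 : 0 <= c := le_trans (normr_ge0 _) (phc tT).
split => /=.
  have -> : (fun x => ph t *: grad (sol t) x) = fun x => (ph t * sol_slope t x) *: ('e_i0 : vec).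
    by apply/funext => x; rewrite grad_sol// scalerA.
  move=> x; apply: (@cvgZr_tmp _ _ _ (nbhs x)).
  have [cs _] := cperZ (ph t) (cper_sol_slope i0 lam0 nu0 ratio_small t); exact: cs.
apply: ecvg0 => [s|e e0].
  apply: le_trans (ereal_sup_ubound _); last by exists 0.
  by rewrite lee_fin sqrtr_ge0.
have := iterate_time_continuous e0 phc tT (ph_cont tT); apply: filterS2 (within_itv T t) => s sT H.
apply: ge_ereal_sup => _ [x _ <-]; rewrite lee_fin !fctE !grad_sol// !scalerA -scalerBl.
rewrite /euclid_norm.
have -> : \sum_i (((ph s * sol_slope s x - ph t * sol_slope t x) *: 'e_i0) : vec) 0 i ^+ 2 =
    (ph s * sol_slope s x - ph t * sol_slope t x) ^+ 2.
  rewrite (bigD1 i0)//= big1 => [|j /negPf ji]; rewrite !mxE ?ji ?eqxx ?mulr1 ?addr0//=.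
  by rewrite mulr0 expr0n.
rewrite sqrtr_sqr; apply/ler_addgt0Pr => e' e'0.
have [n Hn] := error_small nu0 ratio_small (2 * c * (2 * size0)) e'0.
have h1 := sol_slope_approx i0 lam0 nu0 ratio_small s x n.
have h2 := sol_slope_approx i0 lam0 nu0 ratio_small t x n.
have h3 := le_trans (slope_bound i0 lam (time_gap ph (iterate n) s t) x) (H n).
rewrite slope_time_gap in h3.
have -> : ph s * sol_slope s x - ph t * sol_slope t x =
    (ph s * slope (prof (iterate n) s) x - ph t * slope (prof (iterate n) t) x) +
  (ph s * (sol_slope s x - slope (prof (iterate n) s) x) -
  ph t * (sol_slope t x - slope (prof (iterate n) t) x)) by ring.
apply: (le_trans (ler_normD _ _)); apply: lerD => //; apply: le_trans Hn.
apply: (le_trans (ler_normB _ _)); rewrite !normrM.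
have := ler_pM (normr_ge0 _) (normr_ge0 _) (phc sT) h1.
have := ler_pM (normr_ge0 _) (normr_ge0 _) (phc tT) h2.
lra.
Qed.

End weight_in_time.

Lemma fourth_root_continuous T t : 0 <= t <= T ->
  s `^ 4^-1 @[s --> within [set` `[0, T]] (nbhs t)] --> (t `^ 4^-1 : R).
Proof.
move=> /andP[]; rewrite le_eqVlt => /orP[/eqP <-|t0] tT; last first.
  by apply: cvg_within_filter; exact: powR_continuous.
rewrite powR0//; apply/cvgrPdist_le => e e0.
have d0 : 0 < e ^+ 4 by rewrite exprn_gt0.
have : \forall s \near within [set` `[0, T]] (nbhs (0 : R)), `|s| < e ^+ 4.
  apply: cvg_within; have := @nbhsx_ballx _ _ (0 : R) _ d0; apply: filterS => s.
  by rewrite /ball /= sub0r normrN.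
apply: filterS2 (within_itv T 0) => s /andP[s0 sT] se.
rewrite sub0r normrN ger0_norm ?powR_ge0//.
have -> : e = (e ^+ 4) `^ 4^-1.
  rewrite -powR_mulrn ?(ltW e0)// -powRrM mulfV// powRr1//; exact: ltW.
by rewrite ge0_ler_powR ?nnegrE ?(ltW d0)//; rewrite -(ger0_norm s0) ltW.
Qed.

Hypothesis lin_free : forall t x, 0 <= t ->
  bilaplacian_semigroup nu t (height (prof lin 0)) x = height (prof lin t) x.

Lemma sol_initial x : sol 0 x = height (prof lin 0) x.
Proof.
have E n : height (prof (iterate n.+1) 0) x = height (prof lin 0) x.
  rewrite iterate_duh prof_cat height_cat [X in _ + X](_ : _ = 0) ?addr0//.
  rewrite heightE !big_map; apply: big1 => a _ /=.
  rewrite /duhamel_amp normr0 set_itv_ge -?leNgt ?bnd_simp// Rintegral_set0.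
  by rewrite !mulr0 oppr0 !mul0r.
have [cv _] := sol_approx i0 lam0 nu0 ratio_small 0 x.
have : height (prof (iterate n.+1) 0) x @[n --> \oo] --> sol 0 x.
  by rewrite (cvg_shiftS (fun n => height (prof (iterate n) 0) x)).
under eq_cvg do rewrite E.
move=> h; have h' : height (prof lin 0) x @[_ --> \oo] --> height (prof lin 0) x by exact: cvg_cst.
exact: (cvg_unique (@Rhausdorff R) h h').
Qed.

Lemma Rintegral_point (f : R -> R) : \int[mu]_(s in `[0, 0]) f s = 0.
Proof. by rewrite /Rintegral set_itv1 integral_set1. Qed.

Lemma sol_mild T : 0 < T -> mild_solution_on nu (height (prof lin 0)) T sol.
Proof.
move=> T0; split.
- by move=> t _; have [] := cper_sol i0 lam0 nu0 ratio_small t.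
- by move=> t x i _; exact: derivable_sol.
- have phc (s : R) : 0 <= s <= T -> `|s `^ 4^-1| <= T `^ 4^-1.
    move=> /andP[s0 sT]; rewrite ger0_norm ?powR_ge0//.
    by rewrite ge0_ler_powR ?nnegrE// (le_trans s0).
  have phk := @fourth_root_continuous T.
  split; [|exact: C0tC0x_grad_sol phc phk|exact: C0tHsx_sol phc phk _].
  have := @C0tHsx_sol (fun=> 1) T 1 _ _ (d%:R / 2).
  have -> : (fun t x => 1 * sol t x) = sol by apply/funext => t; apply/funext => x; rewrite mul1r.
  by apply => [s _|t _]; [rewrite normr1|exact: cvg_cst].
move=> t x; rewrite in_itv /= => /andP[]; rewrite le_eqVlt => /orP[/eqP <-|t0] tT.
  by rewrite lin_free// Rintegral_point addr0 sol_initial.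
by rewrite lin_free ?ltW//; exact: duhamel_sol.
Qed.

(** The Picard solution is global, so that maximality reduces to uniqueness. *)
Lemma sol_maximal : maximal_mild_solution nu (height (prof lin 0)) +oo sol.
Proof.
split => [//|T T0 _|Tend g Tend0 gm]; first exact: sol_mild.
split=> [|t x]; first exact: leey.
rewrite le_eqVlt => /orP[/eqP <-|t0] tT.
  have [T [T0 TT]] : exists T : R, 0 < T /\ (T%:E < Tend)%E.
    move: Tend0 {gm tT}; case: Tend => [r|_|//].
      by rewrite lte_fin => r0; exists (r / 2); rewrite lte_fin; split; lra.
    by exists 1; split => //; exact: ltry.
  have [_ _ _ gE] := gm T T0 TT.
  have -> // := gE 0 x; last by rewrite in_itv/= lexx ltW.
  by rewrite Rintegral_point addr0 sol_initial lin_free.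
have gt := gm t t0 tT; have st := sol_mild t0.
have gE := gt; have sE := st.
case: gE => _ _ _ gE; case: sE => _ _ _ sE.
apply: (mild_unique (S := fun s => bilaplacian_semigroup nu s (height (prof lin 0))) nu0 t0
  (mild_grad_path t0 gt) (mild_grad_path t0 st)).
- move=> s /andP[s0 _].
  have -> : bilaplacian_semigroup nu s (height (prof lin 0)) = height (prof lin s).
    by apply/funext => y; rewrite lin_free// ltW.
  exact: cper_height.
- by move=> s y /andP[s0 st']; apply: gE; rewrite in_itv/= ltW.
- by move=> s y /andP[s0 st']; apply: sE; rewrite in_itv/= ltW.
- by rewrite t0 lexx.
Qed.

End picard_mild.

(** * Essential suprema on the torus *)
Section essential_supremum_on_the_torus.
Variable R : realType.
Local Notation T_ := (measurableTypeR R).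

Lemma torus_measure_gt0 d : (0 < torus_measure R d setT)%E.
Proof.
elim: d => [|d IH]; first by rewrite /= diracE in_setT lte01.
have pos : (0 < (@circle_measure R \x torus_measure R d) (setT `*` setT))%E.
  rewrite product_measure1E//; apply: mule_gt0; last exact: IH.
  have E := circle_setT R; by rewrite [X in (0 < X)%E](E) lte_fin mulr_gt0// pi_gt0.
by rewrite setXTT in pos.
Qed.

Lemma Linfty_norm_le d (V : 'rV[R]_d -> 'rV[R]_d) c : (forall x, euclid_norm (V x) <= c) ->
  (Linfty_norm V <= c%:E)%E.
Proof.
move=> Vc; rewrite /Linfty_norm unlock torus_measure_gt0.
apply/ess_supP; apply: nearW => x /=; rewrite lee_fin ger0_norm ?sqrtr_ge0//.
Qed.

(** The slab where the first coordinate lies in [0, del] has positive measure. *)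
Lemma Linfty_norm_ge d (V : 'rV[R]_d.+1 -> 'rV[R]_d.+1) c del : 0 < del <= 2 * pi ->
  (forall x : 'rV[R]_d.+1, 0 <= x 0 ord0 <= del -> c <= euclid_norm (V x)) -> (c%:E <= Linfty_norm V)%E.
Proof.
move=> /andP[d0 dp] Vc; rewrite /Linfty_norm unlock torus_measure_gt0 leNgt; apply/negP => lt.
have [A [mA A0 sA]] := ess_sup_ge (torus_measure R d.+1)
  (abse \o (fun x => (euclid_norm (V (row_of_tuple x)))%:E)).
have mB : measurable (@tuple_cons _ T_ d @^-1` A).
  by rewrite -[X in measurable X]setTI; exact: measurable_tuple_cons.
pose I0 : set T_ := [set` `[0, del]].
have mI : measurable I0 by exact: measurable_itv.
have sub : I0 `*` setT `<=` @tuple_cons _ T_ d @^-1` A.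
  move=> [z x] /= [zd _]; apply: sA => /= le.
  have := le_lt_trans le lt; rewrite lte_fin ger0_norm ?sqrtr_ge0// ltNge Vc//.
  by rewrite /row_of_tuple mxE /tuple_cons /= (tnth_nth 0)/=; move: zd; rewrite /I0 /= in_itv.
have cI : @circle_measure R I0 = del%:E.
  rewrite /circle_measure /mrestr (_ : _ `&` _ = I0).
    by rewrite /I0 lebesgue_measure_itv /= lte_fin d0 oppr0 adde0.
  by apply/setIidPl => z; rewrite /I0 /= !in_itv/= => /andP[-> /le_trans]; exact.
have pos : (0 < (@circle_measure R \x torus_measure R d) (I0 `*` setT))%E.
  rewrite product_measure1E//; apply: mule_gt0; last exact: torus_measure_gt0.
  by rewrite [X in (0 < X)%E](cI) lte_fin.
have mIT : measurable (I0 `*` setT : set (T_ * d.-tuple T_)) by exact: measurableX.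
have le := le_measure (@circle_measure R \x torus_measure R d)%E (mem_set mIT) (mem_set mB) sub.
by have := lt_le_trans pos le; rewrite [X in (0 < X)%E](A0) ltxx.
Qed.

End essential_supremum_on_the_torus.

(** * Initial data and the overshoot *)
Section trigonometric_polynomials.
Variables (R : realType) (d : nat).
Local Notation vec := 'rV[R]_d.

Lemma smooth_tp (p : seq (R * R * 'rV[int]_d)) : smooth_torus (tp p : vec -> R).
Proof.
split; first by have [] := cper_tp p.
move=> s; have [q ->] : exists q, iter_partial s (tp p) = tp q.
  elim: s => [|i s [q IH]]; first by exists p.
  exists (tp_deriv i q); apply/funext => x; rewrite /= IH /partial.
  by have h := is_derive_tp q x i; rewrite derive_val.
split=> [|x i]; first by have [] := cper_tp q.
by have [] := is_derive_tp q x i.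
Qed.

Lemma euclid_norm_axis (a : R) (i : 'I_d) : euclid_norm (a *: ('e_i : vec)) = `|a|.
Proof.
rewrite /euclid_norm (bigD1 i)//= big1 => [|j /negPf ji]; rewrite !mxE ?ji ?eqxx ?mulr1 ?addr0//=.
  by rewrite sqrtr_sqr.
by rewrite mulr0 expr0n.
Qed.

End trigonometric_polynomials.

Section free_evolution.
Variables (R : realType) (d : nat) (i0 : 'I_d) (lam : nat).
Hypothesis lam0 : (0 < lam)%N.
Variables (nu : R) (nu0 : 0 < nu).
Local Notation vec := 'rV[R]_d.
Local Notation slope := (@slope R d i0 lam).
Local Notation height := (@height R d i0 lam).
Local Notation rate := (@rate R lam nu).
Implicit Types (c : R) (m : int) (P : seq (R * int)).

Lemma free_continuous c m : continuous (fun t : R => c * expR (- (rate m * `|t|))).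
Proof.
move=> t; apply: cvgM; first exact: cvg_cst.
apply: (@continuous_comp _ _ _ (fun t : R => - (rate m * `|t|)) expR); last exact: continuous_expR.
by apply: cvgN; apply: cvgM; [exact: cvg_cst|exact: norm_continuous].
Qed.

Lemma free_le c m (t : R) : `|c * expR (- (rate m * `|t|))| <= `|c|.
Proof.
rewrite normrM [`|expR _|]ger0_norm ?expR_ge0// ler_piMr// -[leRHS]expR0 ler_expR oppr_le0.
by rewrite mulr_ge0// mulr_ge0 ?(ltW nu0)// exprn_even_ge0.
Qed.

Definition free_mode (p : R * int) : mode R :=
  Mode p.2 (@free_continuous p.1 p.2) (@free_le p.1 p.2).

Definition free P : seq (mode R) := map free_mode P.

Lemma prof_free0 P : prof (free P) 0 = P.
Proof.
rewrite /prof -map_comp -[RHS]map_id; apply: eq_map => -[c m] /=.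
by rewrite normr0 mulr0 oppr0 expR0 mulr1.
Qed.

Lemma mnorm_free P : mnorm (free P) = wnorm P.
Proof. by rewrite /mnorm /wnorm big_map. Qed.

Lemma free_evolution P t x : 0 <= t ->
  bilaplacian_semigroup nu t (height (prof (free P) 0)) x = height (prof (free P) t) x.
Proof.
move=> t0; rewrite prof_free0 /bilaplacian_semigroup /height.
rewrite fourier_multiplier_tp => [|k]; last by rewrite freq_sqN.
rewrite /tp !big_map; apply: eq_bigr => -[c m] _ /=.
rewrite freq_sq_wave -exprM ger0_norm// /rate !mulr0 !mul0r.
rewrite (_ : nu * t * wnum R lam m ^+ (2 * 2) = nu * wnum R lam m ^+ 4 * t); first by ring.
by rewrite mulrAC.
Qed.

Lemma grad_height P x : all (fun p => p.2 != 0) P ->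
  grad (height P) x = slope P x *: ('e_i0 : vec).
Proof.
move=> P0; have D i : is_derive x ('e_i : vec) (height P) (if i == i0 then slope P x else 0).
  apply: (@quadratic_is_derive _ _ _ _ _ _ (2 * lam%:R * wnorm P)) => h.
  exact: height_taylor.
apply/rowP => i; rewrite !mxE eqxx /partial /=.
have h := D i; rewrite derive_val.
by case: eqP => _; rewrite ?mulr1 ?mulr0.
Qed.

Lemma torus_int_height P : torus_int (height P) = 0.
Proof.
rewrite /height /tp torus_int_sum => [|p]; last first.
  by apply: cperD; apply: cperZ; [exact: cper_cos|exact: cper_sin].
rewrite big_map; apply: big1 => p _ /=.
have cc := @cper_cos R d (wave i0 lam p.2); have cs := @cper_sin R d (wave i0 lam p.2).
rewrite torus_intD; [|exact: cperZ|exact: cperZ].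
by rewrite !torus_intZ// torus_int_sin mul0r mulr0 addr0.
Qed.

End free_evolution.

Section overshoot.
Variable R : realType.

(** Up to the factor 99/100 this is (9/8) cos y - (1/8) cos 3y = (3 cos y - cos^3 y) / 2, which
    stays within [-1, 1] only because of its third harmonic. *)
Definition datum : seq (R * int) := [:: (99 / 100 * (9 / 8), 1); (- (99 / 100 / 8), 3%:Z)].

Lemma cos_triple (y : R) : cos (3 * y) = 4 * cos y ^+ 3 - 3 * cos y.
Proof.
rewrite (_ : 3 * y = y + y + y); last by ring.
rewrite !cosD sinD; have := cos2Dsin2 y; move: (cos y) (sin y) => c s cs.
rewrite (_ : (c * c - s * s) * c - (s * c + c * s) * s = c ^+ 3 - 3 * c * s ^+ 2); last by ring.
by rewrite (_ : s ^+ 2 = 1 - c ^+ 2); [ring|rewrite -cs addrC addKr].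
Qed.

Lemma datum_slope_le (c : R) : `|c| <= 1 ->
  `|99 / 100 * (9 / 8) * c + - (99 / 100 / 8) * (4 * c ^+ 3 - 3 * c)| <= 99 / 100.
Proof.
rewrite !ler_norml => /andP[c1 c2].
(* 2 -+ (3 c - c^3) = (2 +- c) (1 -+ c)^2 *)
have p1 : 0 <= (2 + c) * (1 - c) ^+ 2 by rewrite mulr_ge0 ?sqr_ge0//; lra.
have p2 : 0 <= (2 - c) * (1 + c) ^+ 2 by rewrite mulr_ge0 ?sqr_ge0//; lra.
by apply/andP; split; lra.
Qed.

(** At the time when the fundamental has decayed by e^(-1/27), the third harmonic has decayed by
    e^(-3), and the cancellation at the maximum is lost. *)
Lemma overshoot (y e1 e3 : R) : `|y| <= 1 / 10 -> 26 / 27 <= e1 <= 1 -> 0 <= e3 <= 1 / 4 ->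
  103 / 100 <= 99 / 100 * (9 / 8) * e1 * cos y + - (99 / 100 / 8) * e3 * cos (3 * y).
Proof.
move=> yb /andP[a1 a2] /andP[b1 b2].
have y2 : y ^+ 2 <= (1 / 10) ^+ 2 by rewrite -real_normK ?num_real// lerXn2r ?nnegrE//; lra.
have := cos_sub1_le y; rewrite ler_norml => /andP[cy _].
have c3 : cos (3 * y) <= 1 by exact: cos_le1.
have h1 : 26 / 27 * (199 / 200) <= e1 * cos y by apply: ler_pM => //; lra.
have h2 : e3 * cos (3 * y) <= e3 by rewrite ler_piMr.
lra.
Qed.

End overshoot.

Theorem theorem1p3 (R : realType) (d : nat) (hd : (1 <= d)%N) :
  exists Cd : R, 1 < Cd /\
    forall nu eps : R, 0 < nu -> 0 < eps ->
    exists h0 : 'rV[R]_d -> R,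
      [/\ smooth_torus h0,
          torus_int h0 = 0,
          (Linfty_norm (grad h0) < 1%:E)%E &
          exists (t0 : R) (Tstar : \bar R) (h : R -> 'rV[R]_d -> R),
            [/\ 0 < t0,
                maximal_mild_solution nu h0 Tstar h,
                (t0%:E < Tstar)%E &
                ((Cd - eps)%:E < Linfty_norm (grad (h t0)))%E]].
Proof.
exists (101 / 100); split; first by lra.
move=> nu eps nu0 eps0; case: d hd => [//|d] _.
pose P := datum R; pose q := wnorm P; have q0 : 0 <= q := wnorm_ge0 P.
pose gr := 3 * (2 * q) ^+ 2 + 1; have gr1 : 0 <= gr by rewrite addr_ge0// mulr_ge0// sqr_ge0.
(* At such high frequencies the bilaplacian dominates the nonlinearity. *)
pose lam := (Num.truncn (gr * (100 * (q + 1)) / nu)).+1.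
have lam0 : (0 < lam)%N by [].
have lamR : 1 <= lam%:R :> R by rewrite ler1n.
have lamb : gr * (100 * (q + 1)) / nu <= lam%:R by apply/ltW; rewrite truncnS_gt.
pose lin := free lam nu0 P.
have lin_num : all (fun a => num a != 0) lin by [].
have sz : size0 lin = q by exact: mnorm_free.
have rat : ratio lam nu lin * (100 * (q + 1)) <= 1.
  rewrite /ratio /growth sz -/gr /smallness.
  have l2 : lam%:R <= lam%:R ^+ 2 :> R by rewrite expr2 ler_peMl// (le_trans ler01).
  have n0 : 0 < nu * lam%:R ^+ 2 by rewrite mulr_gt0// exprn_gt0// ltr0n.
  rewrite -mulrA mulrC ler_pdivrMr// mul1r.
  by move: lamb; rewrite ler_pdivrMr// => /le_trans; apply; rewrite mulrC ler_pM2l.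
have r0 := ratio_ge0 lam nu0 lin.
have ratio_small : ratio lam nu lin <= 2^-1.
  have : ratio lam nu lin * 100 <= ratio lam nu lin * (100 * (q + 1)) by rewrite ler_wpM2l//; lra.
  lra.
pose i0 : 'I_d.+1 := ord0; pose h0 : 'rV[R]_d.+1 -> R := height i0 lam P.
have h0E : h0 = height i0 lam (prof lin 0) by rewrite prof_free0.
have P0 : all (fun p => p.2 != 0) P by [].
exists h0; split.
- exact: smooth_tp.
- exact: torus_int_height.
- apply: (@le_lt_trans _ _ (99 / 100)%:E); last by rewrite lte_fin; lra.
  apply: Linfty_norm_le => x; rewrite grad_height// euclid_norm_axis slopeE !big_cons big_nil addr0 /=.
  rewrite !freq_dot_wave (_ : wnum R lam 3 = 3 * wnum R lam 1); last first.
    by rewrite /wnum mul1r intrM.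
  by rewrite -[3 * _ * _]mulrA cos_triple; apply: datum_slope_le; exact: cos_max.
(* The fundamental has decayed by e^(-1/27), its third harmonic by e^(-81/27). *)
pose t0 := (27 * (nu * lam%:R ^+ 4))^-1.
have l4 : 0 < nu * lam%:R ^+ 4 by rewrite mulr_gt0// exprn_gt0// ltr0n.
have t00 : 0 < t0 by rewrite invr_gt0 mulr_gt0.
exists t0, +oo%E, (sol i0 lam0 nu0 lin); split => //; last 1 first.
- apply: (@lt_le_trans _ _ (101 / 100)%:E); first by rewrite lte_fin; lra.
  pose del : R := 1 / (10 * lam%:R); have dl : 0 < del <= 2 * pi.
    have l10 : 0 < 10 * lam%:R :> R by rewrite mulr_gt0 ?ltr0n.
    apply/andP; split; [exact: divr_gt0|rewrite ler_pdivrMr//].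
    have := pi_ge2 R; have : 0 <= (pi : R) := pi_ge0 R; move: (pi : R) => p p0 p2.
    have : p * 1 <= p * lam%:R by rewrite ler_wpM2l.
    lra.
  apply: (Linfty_norm_ge dl) => x /andP[x0 x1].
  rewrite (grad_sol i0 lam0 nu0 lin_num ratio_small) euclid_norm_axis.
  have appr := sol_slope_approx i0 lam0 nu0 ratio_small t0 x 1.
  rewrite iterate_duh (_ : source lam0 nu0 lin 0 = [::])// cats0 sz expr1 in appr.
  have w1 : wnum R lam 1 = lam%:R by rewrite /wnum mul1r.
  have w3 : wnum R lam 3 = 3 * lam%:R by rewrite /wnum intrM.
  have r1 : rate lam nu 1 * `|t0| = 1 / 27.
    by rewrite /rate w1 (gtr0_norm t00) /t0; field; rewrite !lt0r_neq0// ltr0n.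
  have r3 : rate lam nu 3 * `|t0| = 3.
    by rewrite /rate w3 (gtr0_norm t00) /t0; field; rewrite !lt0r_neq0// ltr0n.
  (* 103/100 for the free evolution, less at most 2/100 for the nonlinear correction. *)
  have main : 103 / 100 <= slope i0 lam (prof lin t0) x.
    rewrite slopeE !big_cons big_nil addr0 /= !freq_dot_wave r1 r3 w1 w3 -[3 * _ * _]mulrA.
    apply: overshoot.
    - rewrite ger0_norm; last by rewrite mulr_ge0.
      rewrite mulrC; move: x1; rewrite ler_pdivlMr ?mulr_gt0 ?ltr0n//; lra.
    - have := expR_ge1Dx (- (1 / 27) : R) => e1.
      by rewrite -[X in _ && (_ <= X)]expR0 ler_expR; apply/andP; split; lra.
    - rewrite expR_ge0 expRN /= div1r lef_pV2 ?posrE ?expR_gt0//.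
      by have := expR_ge1Dx (3 : R); lra.
  have small : 2 * q * ratio lam nu lin <= 1 / 50.
    have : q * ratio lam nu lin <= (q + 1) * ratio lam nu lin by rewrite ler_wpM2r// lerDl.
    lra.
  move: appr; rewrite distrC => appr.
  have h1 := le_trans (ler_norm _) appr.
  apply: le_trans (ler_norm _); lra.
- rewrite h0E; apply: sol_maximal => // t x tge; exact: free_evolution.
- exact: ltry.
Qed.
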